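(* For each integer $m\ge 1$ let $H^{t}_{1^m}\in \mathrm{Hom}(\Lambda,\Lambda)$ be any operator with the property that $H^{t}_{1^m} H_\mu[X;t] = H_{1^m|\mu}[X;t]$ for every partition $\mu$ with $\ell(\mu)\le m$. Let $\widetilde{H^{t}_{1^m}}^{q}$ denote its $q$-twisting. Then for every partition $\lambda=(\lambda_1\ge\cdots\ge\lambda_\ell>0)$, $$\widetilde{H^{t}_{1^{\lambda_1}}}^{q}\;\widetilde{H^{t}_{1^{\lambda_2}}}^{q}\cdots \widetilde{H^{t}_{1^{\lambda_\ell}}}^{q}\,1 = H_{\lambda'}[X;q,t],$$ where $\lambda'$ is the conjugate partition of $\lambda$.
   Context: $\Lambda$ is the ring of symmetric functions over $\mathbb{Q}(q,t)$, identified with symmetric functions in $X=x_1+x_2+\cdots$; $\mathrm{Hom}(\Lambda,\Lambda)$ is the space of linear operators on $\Lambda$. Plethystic notation: for a formal series $E$ in variables and the parameters $q,t$, $p_k[E]$ is $E$ with every variable and each of $q,t$ replaced by its $k$-th power (signs and rational constants unchanged); for $P=\sum_\lambda c_\lambda p_\lambda$, $P[E]=\sum_\lambda c_\lambda\prod_i p_{\lambda_i}[E]$. $q$-twisting: for $V\in\mathrm{Hom}(\Lambda,\Lambda)$ define $\widetilde{V}^{q}P[X]=V^Y P[qX+(1-q)Y]\big|_{Y=X}$, where $Y=y_1+y_2+\cdots$ is a second alphabet and $V^Y$ means $V$ acts on symmetric functions in $Y$ (if $P[qX+(1-q)Y]=\sum_i f_i[X]g_i[Y]$ then $\widetilde{V}^qP=\sum_i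 f_i\,V(g_i)$). $\ell(\mu)$ is the number of nonzero parts of $\mu$, and for $\ell(\mu)\le m$, $1^m|\mu=(\mu_1+1,\ldots,\mu_m+1)$. Scalar product: $\langle p_\lambda,p_\mu\rangle_{qt}=\delta_{\lambda\mu}z_\lambda\prod_{i=1}^{\ell(\lambda)}(1-q^{\lambda_i})(1-t^{\lambda_i})$, $z_\lambda=\prod_{i\ge1} i^{n_i(\lambda)}n_i(\lambda)!$ with $n_i(\lambda)$ the number of parts equal to $i$. The Macdonald symmetric functions $H_\mu[X;q,t]$ are defined by: (1) $\langle H_\lambda[X;q,t],H_\mu[X;q,t]\rangle_{qt}=0$ if $\lambda\ne\mu$; (2) $H_\mu[X(1-t);q,t]=\sum_{\lambda\le\mu}c_{\lambda\mu}m_\lambda[X]$ for suitable coefficients, the sum over $\lambda\le\mu$ in dominance order ($m_\lambda$ monomial symmetric functions); (3) $\langle H_\mu[X;q,t],h_n[X]\rangle=t^{n(\mu)}$ for the standard Hall inner product, where $n=|\mu|$ and $n(\mu)=\sum_i(i-1)\mu_i$. The Hall-Littlewood symmetric functions are $H_\mu[X;t]=H_\mu[X;0,t]$. *)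

(* Defs.v *)
From HB Require Import structures.
From mathcomp Require Import all_boot all_order all_algebra.
From mathcomp Require Import finmap.
From mathcomp.multinomials Require Import monalg.
From mathcomp.multinomials Require Import mpoly.

Set Implicit Arguments.
Unset Strict Implicit.
Unset Printing Implicit Defensive.

Import GRing.Theory.
Local Open Scope ring_scope.

(* Partitions are the weakly decreasing lists of positive integers, so that
   [size] is the number of nonzero parts. *)
Definition is_part (la : seq nat) : bool := sorted geq la && (0%N \notin la).

Definition conj_part (la : seq nat) : seq nat :=
  mkseq (fun j => count (fun x => j < x)%N la) (head 0%N la).

(* The partition 1^m|mu = (mu_1 + 1, ..., mu_m + 1). *)
Definition add_col (m : nat) (mu : seq nat) : seq nat :=
  mkseq (fun i => (nth 0%N mu i).+1) m.

(* n(mu) = \sum_i (i - 1) mu_i with parts numbered from 1. *)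
Definition n_part (mu : seq nat) : nat :=
  (\sum_(i < size mu) i * nth 0 mu i)%N.

Definition dom_le (la mu : seq nat) : Prop :=
  sumn la = sumn mu /\
  forall k : nat, (sumn (take k la) <= sumn (take k mu))%N.

(* Both multinomials files provide this notation; polynomials in the variables
   x_1, ..., x_N are those of mpoly. *)
Notation "{ 'mpoly' T [ n ] }" := (mpoly.mpoly n T) : type_scope.

(* In characteristic 0 the ring of symmetric functions is the polynomial ring
   in the power sums p_1, p_2, ...; the generator of index i : nat stands for
   p_(i+1).  A monomial nu is thus a power sum p_lambda, where lambda has nu i
   parts equal to i+1.  The map to symmetric polynomials is [realize]. *)
Notation psmonom := {cmonom nat}.
Notation Lam K := {malg K[psmonom]}.

Section SymmetricFunctions.
Variable K : fieldType.

(* p_lambda[E], where nu encodes lambda and e k = p_k[E]. *)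
Definition psmonom_eval (A : comNzRingType) (e : nat -> A) (nu : psmonom) : A :=
  \prod_(i <- finsupp nu) e i.+1 ^+ nu i.

(* The plethystic substitution P[E], where e k = p_k[E] for k >= 1. *)
Definition plethysm (A : comNzRingType) (iota : {rmorphism K -> A})
    (e : nat -> A) : Lam K -> A :=
  monalg.mmap iota (psmonom_eval e).

(* p_k for k >= 1 *)
Definition psum (k : nat) : Lam K := << ucm k.-1 >>.

(* The symmetric polynomial P(x_1, ..., x_N). *)
Definition realize (N : nat) : Lam K -> {mpoly K[N]} :=
  plethysm (@mpolyC N K) (fun k => \sum_(i < N) 'X_i ^+ k).

(* The monomial symmetric polynomial m_la(x_1, ..., x_N): the sum of all
   monomials whose nonzero exponents are, up to order, the parts of la. *)
Definition msympoly (N : nat) (la : seq nat) : {mpoly K[N]} :=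
  \sum_(m : 'X_{1..N < (sumn la).+1}
        | perm_eq [seq k <- (m : 'X_{1..N}) | (0 < k)%N] la) 'X_[m].

(* The list h_n, ..., h_0, by Newton's identity
   n h_n = \sum_(1 <= k <= n) p_k h_(n-k); see [realize_hsym]. *)
Fixpoint hsym_seq (n : nat) : seq (Lam K) :=
  if n is n'.+1 then
    (n%:R^-1 *: \sum_(i < n) psum i.+1 * nth 0 (hsym_seq n') i) :: hsym_seq n'
  else [:: 1].
Definition hsym (n : nat) : Lam K := head 0 (hsym_seq n).

Section Plethysm.
Variables (A : comNzRingType) (iota : {rmorphism K -> A}) (e : nat -> A).

Lemma psmonom_eval_mmorphism : mmorphism (psmonom_eval e).
Proof.
have wd (nu : psmonom) (D : {fset nat}) : (finsupp nu `<=` D)%fset ->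
    psmonom_eval e nu = \prod_(i <- D) e i.+1 ^+ nu i.
  move=> le; rewrite /psmonom_eval (big_fset_incl _ le) // => i _.
  by rewrite -cmE_eq0 => /eqP ->.
split=> [m1 m2|]; last by rewrite /psmonom_eval mdom1 big_seq_fset0.
set D := (finsupp m1 `|` finsupp m2)%fset.
rewrite (wd _ D) ?mdomD // (wd m1 D) ?fsubsetUl // (wd m2 D) ?fsubsetUr //.
by rewrite -big_split /=; apply: eq_bigr => i _; rewrite cmM exprD.
Qed.

HB.instance Definition _ :=
  monalg.isMultiplicative.Build psmonom A (psmonom_eval e)
    psmonom_eval_mmorphism.

HB.instance Definition _ := GRing.RMorphism.copy (plethysm iota e)
  (monalg.mmap iota (psmonom_eval e)).

Lemma plethysm_psum k : (0 < k)%N -> plethysm iota e (psum k) = e k.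
Proof.
case: k => // k _; rewrite /plethysm mmapU /= rmorph1 mul1r.
by rewrite /psmonom_eval mdomU big_seq_fset1 cmUU expr1.
Qed.

Lemma plethysmZ c f : plethysm iota e (c *: f) = iota c * plethysm iota e f.
Proof. exact: monalg.mmapZ. Qed.
End Plethysm.

Section RealizeHsym.
Variable N : nat.

(* h_n(x_1, ..., x_N) *)
Definition hsympoly (n : nat) : {mpoly K[N]} :=
  \sum_(m : 'X_{1..N < n.+1} | mdeg m == n) 'X_[m].

Lemma mcoeff_hsympoly n (m : 'X_{1..N}) : (hsympoly n)@_m = (mdeg m == n)%:R.
Proof.
rewrite /hsympoly raddf_sum /=; case: eqP => [dm | ndm].
  have lt : (mdeg m < n.+1)%N by rewrite dm.
  rewrite (bigD1 (BMultinom lt)) ?dm //= mcoeffX eqxx big1 ?addr0 // => m' h.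
  rewrite mcoeffX; case: (eqVneq (bmnm m') m) => // e.
  by move: h; rewrite bmeqP /= e eqxx andbF.
rewrite big1 // => m' /eqP dm'; rewrite mcoeffX; case: eqP => // e.
by case: ndm; rewrite -e.
Qed.

Lemma mcoeffXM (p : {mpoly K[N]}) (m k : 'X_{1..N}) :
  ('X_[m] * p)@_k = if (m <= k)%MM then p@_(k - m) else 0.
Proof.
rewrite mulrC; case: ifP => [le | nle].
  by rewrite -{1}(submK le) addmC mcoeffMX.
rewrite mcoeffM big1 // => -[m1 m2] /= /eqP e.
rewrite mcoeffX; case: eqP => e2; last by rewrite mulr0.
have : (m <= k)%MM.
  by rewrite e e2; apply/mnm_lepP => i; rewrite mnmDE leq_addl.
by rewrite nle.
Qed.

Lemma hsympoly_newton n :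
  n.+1%:R * hsympoly n.+1 =
  \sum_(i < n.+1) (\sum_(j < N) 'X_j ^+ i.+1) * hsympoly (n - i).
Proof.
apply/mpolyP => m; rewrite mulr_natl mcoeffMn mcoeff_hsympoly raddf_sum /=.
transitivity (\sum_(i < n.+1) \sum_(j < N)
    ((i < m j)%N && (mdeg m == n.+1))%:R : K).
  case: eqP => [dm | _]; last first.
    by rewrite mul0rn big1 // => i _; rewrite big1 // => j _; rewrite andbF.
  rewrite exchange_big /= -[n.+1 in LHS]dm mdegE natr_sum.
  apply: eq_bigr => j _.
  have le : (m j <= n.+1)%N by rewrite -dm mdegE (bigD1 j) //= leq_addr.
  under eq_bigr do rewrite andbT.
  rewrite -natr_sum; congr (_%:R).
  rewrite -[LHS]card_ord -sum1_card (big_ord_widen _ (fun=> 1%N) le).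
  by rewrite big_mkcond; apply: eq_bigr => i _; case: ltnP.
apply: eq_bigr => i _; rewrite mulr_suml raddf_sum /=; apply: eq_bigr => j _.
rewrite mpolyXn mcoeffXM mcoeff_hsympoly.
have -> : (U_(j) *+ i.+1 <= m)%MM = (i < m j)%N.
  apply/mnm_lepP/idP => [/(_ j) | lt l]; rewrite mulmnE mnm1E.
    by rewrite eqxx mul1n.
  by case: eqP => [<-|]; rewrite ?mul1n ?mul0n.
case: ltnP => //= lt; congr (nat_of_bool _)%:R.
set u := (U_(j) *+ i.+1)%MM.
have le : (u <= m)%MM.
  apply/mnm_lepP => l; rewrite mulmnE mnm1E.
  by case: eqP => [<-|]; rewrite ?mul1n ?mul0n.
rewrite -[in LHS](submK le) mdegD mdegMn mdeg1 mul1n.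
have lei : (i <= n)%N by rewrite -ltnS.
by rewrite addnS eqSS -(eqn_add2r i _ (n - i)) subnK.
Qed.

Lemma realize_psum k : (0 < k)%N ->
  realize N (psum k) = \sum_(j < N) 'X_j ^+ k.
Proof. exact: plethysm_psum. Qed.

(* [hsym n] is the complete homogeneous symmetric function h_n. *)
Lemma realize_hsym n : [pchar K] =i pred0 -> realize N (hsym n) = hsympoly n.
Proof.
move=> char0; suff {n} H n i : (i <= n)%N ->
    realize N (nth 0 (hsym_seq n) i) = hsympoly (n - i).
  by rewrite /hsym -nth0 H // subn0.
have h0 : hsympoly 0 = 1.
  apply/mpolyP => m; rewrite mcoeff_hsympoly mcoeff1 mdeg_eq0; by case: eqP.
elim: n i => [|n IHn] [|i] //= lein; rewrite ?subSS ?subn0; last exact: IHn.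
  by rewrite h0 /realize rmorph1.
rewrite /realize plethysmZ rmorph_sum /=.
under eq_bigr => j _.
  rewrite rmorphM /= plethysm_psum // -/(realize N _) IHn -1?ltnS //.
  over.
rewrite -hsympoly_newton mulrA -mpolyC_nat -mpolyCM mulVf ?mul1r //.
by move/pcharf0P: char0 => ->.
Qed.
End RealizeHsym.

Definition zmonom (nu : psmonom) : nat :=
  (\prod_(i <- finsupp nu) (i.+1 ^ nu i * (nu i)`!))%N.

(* The bilinear form with <p_la, p_mu> = w(la) if la = mu, and 0 otherwise. *)
Definition diag_form (w : psmonom -> K) (f g : Lam K) : K :=
  \sum_(nu <- monalg.msupp f)
     monalg.mcoeff nu f * monalg.mcoeff nu g * w nu.

Definition hall : Lam K -> Lam K -> K := diag_form (fun nu => (zmonom nu)%:R).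

Definition scal_qt (q t : K) : Lam K -> Lam K -> K :=
  diag_form (fun nu => (zmonom nu)%:R *
    \prod_(i <- finsupp nu) ((1 - q ^+ i.+1) * (1 - t ^+ i.+1)) ^+ nu i).

(* P[X(1-t)] *)
Definition pleth_1t (t : K) : Lam K -> Lam K :=
  plethysm (in_alg (Lam K)) (fun k => (1 - t ^+ k) *: psum k).

(* P[qX + (1-q)Y], as a polynomial in the p_k[Y] whose coefficients are
   symmetric functions in X. *)
Definition pleth_XY (q : K) : Lam K -> {malg (Lam K)[psmonom]} :=
  plethysm (in_alg {malg (Lam K)[psmonom]} \o in_alg (Lam K))
    (fun k => (q ^+ k *: psum k) *: 1 + << (1 - q ^+ k) *: 1 *g ucm k.-1 >>).

(* With P[qX + (1-q)Y] = \sum_nu f_nu[X] p_nu[Y], this is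
   \sum_nu f_nu V(p_nu). *)
Definition qtwist (q : K) (V : Lam K -> Lam K) (P : Lam K) : Lam K :=
  monalg.mmap idfun (fun nu : psmonom => V << nu >>) (pleth_XY q P).

Definition is_macdonald (q t : K) (H : seq nat -> Lam K) : Prop :=
  [/\ forall la mu : seq nat, is_part la -> is_part mu -> la <> mu ->
        scal_qt q t (H la) (H mu) = 0,
      forall mu : seq nat, is_part mu ->
        exists (s : seq (seq nat)) (c : seq nat -> K),
          (forall la, la \in s -> is_part la /\ dom_le la mu) /\
          forall N : nat, realize N (pleth_1t t (H mu)) =
                          \sum_(la <- s) c la *: msympoly N la
    & forall mu : seq nat, is_part mu ->
        hall (H mu) (hsym (sumn mu)) = t ^+ n_part mu].

End SymmetricFunctions.

Local Notation "x %:F" := (FracField.tofrac x).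

(* Q(q,t) is realized as Q(t)(q). *)
Definition Qt : fieldType := {fraction {poly rat}}.
Definition Qqt : fieldType := {fraction {poly Qt}}.
Definition Qt_inj (c : Qt) : Qqt := (c%:P)%:F.
Definition q_ : Qqt := ('X : {poly Qt})%:F.
Definition t_ : Qqt := Qt_inj ('X : {poly rat})%:F.

Lemma pchar_Qqt : [pchar Qqt] =i pred0.
Proof.
have charF (R : idomainType) : [pchar R] =i pred0 ->
    [pchar {fraction {poly R}}] =i pred0.
  move=> /pcharf0P charR; apply/pcharf0P => n.
  have tf0 (x : {poly R}) : (x%:F == 0) = (x == 0) by rewrite tofrac_eq0.
  by rewrite -tofrac1 -tofracMn tf0 -polyC1 -polyCMn polyC_eq0 charR.
by apply: (charF Qt); apply: (charF rat); apply: Num.Theory.pchar_num.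
Qed.

(* f(q,t) has no pole at q = 0, and g(t) = f(0,t). *)
Definition value_q0 (f g : Qqt) : Prop :=
  exists a b : {poly Qt},
    [/\ b.[0] != 0, f = a%:F / b%:F & g = Qt_inj (a.[0] / b.[0])].

Definition sym_value_q0 (F G : Lam Qqt) : Prop :=
  forall nu : psmonom, value_q0 (monalg.mcoeff nu F) (monalg.mcoeff nu G).

(* Main.v *)
(* Write g_a for the product of the h_(a_i)[X/(1-q)], where a = (a_1, ..., a_m).
   Since g_a is dual to the coefficient of z^a in f[(z_1 + ... + z_m)(1-t)], it
   expands in the Macdonald functions with coefficients read off H_mu[Z(1-t)].
   A determinantal identity for the Cauchy kernel in X and Z, together with
   triangularity and the normalization (obtained by setting X = x), shows that a
   linear operator V satisfies V H_mu = H_(1^m|mu) for all mu of length at most m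
   if and only if
     sum_w sign(w) V(g_(b - w delta))
       = sum_w sign(w) prod_i (1 - t^((w delta)_i) q^((b + 1^m - w delta)_i))
           g_(b + 1^m - w delta)
   for all b, where delta = (m-1, ..., 0) and w runs over S_m.

   This holds at q = 0 for the Hall-Littlewood functions, which inherit the
   defining properties of H_mu by specialization.  The generating function
   g(z) = sum_n h_n[X/(1-q)] z^n satisfies g(z) = h(z) g(qz), with h(z) the one at
   q = 0, while the substitution X -> qX + (1-q)Y turns g(z) into h[Y](z) g(qz);
   hence the q-twisting carries the identity at q = 0 to the identity at q.

   The form <,>_qt is anisotropic because its weights are positive rationals at
   q = t = 0. *)

From HB Require Import structures.
From mathcomp Require Import all_boot all_order all_algebra.
From mathcomp Require Import perm generic_quotient finmap ring zify.
From mathcomp.multinomials Require Import monalg.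
From mathcomp.multinomials Require Import mpoly.
Require Import Defs.

Set Implicit Arguments.
Unset Strict Implicit.
Unset Printing Implicit Defensive.

Import Order.TTheory GRing.Theory Num.Theory.
Local Open Scope ring_scope.

Local Notation "1" := (@mone _) : monom_scope.
Local Notation "x * y" := (mmul x y) : monom_scope.
Local Notation "x %:F" := (FracField.tofrac x).

(** * Generating functions with a Newton recurrence *)

(** The alternating sums are a Vandermonde determinant times Macdonald's q-difference operator D(u;
    q, t), and the determinantal identity compares D(-1) in Z with D(-t) in X on the Cauchy kernel;
    the factor x_1...x_m z_1...z_m that appears is the source of the added column. Knowing the H_mu
    as eigenfunctions would finish at once, but only orthogonality, triangularity and normalization
    are given. So the coefficients of D(-1) applied to the kernel are solved for recursively along
    n(mu), which dominance reverses. Solving in the variables x gives n(1^m|mu) <= n(nu) for every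
    H_nu that occurs, evaluating in Z gives the opposite inequality, and only nu = 1^m|mu is left.
    Its scalar comes from a single variable x, where H_mu becomes t^n(mu) x^|mu| and n(1^m|mu) =
    n(mu) + m(m-1)/2. The values of V on longer partitions do not matter because H_mu[Z(1-t)]
    vanishes in m variables when mu has more than m parts. Division by diagonal coefficients is
    legitimate because an H_mu with zero diagonal coefficient would be orthogonal to itself. *)

Section NewtonSequences.
Variable B : comNzRingType.
Implicit Types a b phi psi : nat -> B.

(* [phi] is the coefficient sequence of exp(sum_(k >= 1) a_k z^k / k). *)
Definition newton a phi : Prop :=
  phi 0%N = 1 /\
  forall n, n%:R * phi n = \sum_(i < n) a i.+1 * phi (n - i.+1)%N.

Definition conv phi psi (n : nat) : B := \sum_(i < n.+1) phi i * psi (n - i)%N.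

Lemma newton_ext a b phi : (forall n, a n.+1 = b n.+1) -> newton a phi -> newton b phi.
Proof.
move=> ab [p0 pS]; split=> // n; rewrite pS; apply: eq_bigr => i _.
by rewrite ab.
Qed.

Lemma newton_uniq (reg : forall n, GRing.lreg (n.+1%:R : B)) a phi psi :
  newton a phi -> newton a psi -> phi =1 psi.
Proof.
move=> [p0 pS] [s0 sS] n; elim/ltn_ind: n => -[|n] IH; first by rewrite p0 s0.
apply: (reg n); rewrite pS sS; apply: eq_bigr => i _; congr (_ * _).
by apply: IH; rewrite subSS ltnS leq_subr.
Qed.

(** Logarithmic derivatives add: z d/dz of a product splits by Leibniz. The series are truncated at
    degree n so that the comparison of coefficients takes place in [{poly B}]. *)
Lemma newton_conv a b phi psi : newton a phi -> newton b psi ->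
  newton (fun k => a k + b k) (conv phi psi).
Proof.
move=> [p0 pS] [s0 sS]; split=> [|n].
  by rewrite /conv big_ord1 p0 s0 mulr1.
pose tr (f : nat -> B) := \poly_(i < n.+1) f i.
have trE f i : (i <= n)%N -> (tr f)`_i = f i by move=> le; rewrite coef_poly ltnS le.
(* The recurrence reads z F' = A F with A = sum_(k >= 1) a_k z^k. The value of the sequence at 0 is
   unconstrained, so the constant term of A is set to 0. *)
have tra (c f : nat -> B) (cf : newton c f) i : (i <= n)%N ->
    i%:R * f i = (tr (fun k => if k is 0 then 0 else c k) * tr f)`_i.
  move=> le; rewrite coefM big_ord_recl trE // mul0r add0r cf.2.
  apply: eq_bigr => j _; rewrite lift0; have ltj := ltn_ord j.
  by rewrite !trE //; lia.
have convE k : (k <= n)%N -> conv phi psi k = (tr phi * tr psi)`_k.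
  move=> le; rewrite coefM /conv; apply: eq_bigr => i _; have lti := ltn_ord i.
  by rewrite !trE //; lia.
pose z c : {poly B} := tr (fun k => if k is 0 then 0 else c k).
transitivity ((z a * tr phi * tr psi)`_n + (tr phi * (z b * tr psi))`_n).
  rewrite /conv mulr_sumr !coefM -big_split; apply: eq_bigr => i _ /=.
  have lei : (i <= n)%N by rewrite -ltnS.
  rewrite -(tra _ _ (conj p0 pS)) // -(tra _ _ (conj s0 sS)) ?leq_subr //.
  rewrite !trE ?leq_subr //.
  have -> : n%:R = i%:R + (n - i)%:R :> B by rewrite -natrD subnKC.
  ring.
rewrite -coefD.
have -> : z a * tr phi * tr psi + tr phi * (z b * tr psi)
        = (z a + z b) * (tr phi * tr psi) by ring.
rewrite coefM big_ord_recl coefD !trE // addr0 mul0r add0r.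
apply: eq_bigr => i _; rewrite lift0 coefD; have lti := ltn_ord i.
by rewrite !trE ?convE //; lia.
Qed.

Lemma newton_scale (c : B) a phi : newton a phi ->
  newton (fun k => c ^+ k * a k) (fun n => c ^+ n * phi n).
Proof.
move=> [p0 pS]; split=> [|n]; first by rewrite p0 mulr1.
rewrite mulrCA pS mulr_sumr; apply: eq_bigr => i _.
by rewrite [RHS]mulrACA -exprD subnKC.
Qed.

(** This is 1 - c z = exp(- sum_(k >= 1) c^k z^k / k). From n = 2 on, only the last two terms of the
    sum survive, and they cancel. *)
Lemma newton_linear (c : B) :
  newton (fun k => - c ^+ k) (fun n => (1 - c *: 'X : {poly B})`_n).
Proof.
have E n : (1 - c *: 'X : {poly B})`_n = (n == 0%N)%:R - c * (n == 1%N)%:R.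
  by rewrite coefB coefZ coefX coef1.
split=> [|n]; first by rewrite E mulr0 subr0.
under eq_bigr => i _ do rewrite E.
case: n => [|[|n]]; rewrite ?big_ord0 ?mul0r // E.
  by rewrite big_ord1 /=; ring.
rewrite big_ord_recr big_ord_recr big1 => [|i _] /=.
  rewrite subnn subSnn /= !mulr1n !mulr0n [in - c ^+ n.+2]exprS; ring.
have -> : (n.+2 - i.+1 == 0)%N = false by case: i => i /= lt; lia.
have -> : (n.+2 - i.+1 == 1)%N = false by case: i => i /= lt; lia.
by rewrite /=; ring.
Qed.

Lemma conv_poly (f : {poly B}) phi N n : (n < N)%N ->
  conv (fun i => f`_i) phi n = (f * \poly_(i < N) phi i)`_n.
Proof.
move=> lt; rewrite coefM; apply: eq_bigr => i _; rewrite coef_poly.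
by rewrite (leq_ltn_trans (leq_subr _ _) lt).
Qed.

End NewtonSequences.

Lemma newton_morph (B C : comNzRingType) (rho : {rmorphism B -> C}) a phi :
  newton a phi -> newton (rho \o a) (rho \o phi).
Proof.
move=> [p0 pS]; split=> [|n] /=; first by rewrite p0 rmorph1.
rewrite -[n%:R](rmorph_nat rho) -rmorphM pS rmorph_sum.
by apply: eq_bigr => i _; rewrite rmorphM.
Qed.

Local Notation "1" := (@mone _) : monom_scope.
Local Notation "x * y" := (mmul x y) : monom_scope.

(** * Induction on power sum expansions *)

Section LamInduction.
Variable K : fieldType.

Lemma psmonom_ind (P : psmonom -> Prop) :
  P 1%M -> (forall k nu, P nu -> P (ucm k * nu)%M) -> forall nu, P nu.
Proof.
move=> P1 PM nu; move: {2}(monalg.mdeg nu) (erefl (monalg.mdeg nu)) => n.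
elim: n nu => [|n IH] nu dn; first by rewrite (monalg.mdeg_eq0I dn).
have [k nuk] : exists k, nu k != 0%N.
  have : nu != 1%M by rewrite -monalg.mdeg_eq0 dn.
  case: (fset_0Vmem (finsupp nu)) => [e|[k kin]]; last first.
    by exists k; rewrite cmE_neq0.
  by rewrite -monalg.mdeg_eq0 monalg.mdegE e big_seq_fset0.
have e : nu = (ucm k * divcm nu (ucm k))%M.
  apply/eqP/cmP => i; rewrite cmM divcmE subnKC // cmU.
  by case: (eqVneq k i) => [<-|_] //=; rewrite lt0n.
rewrite e; apply/PM/IH/eqP; rewrite -eqSS -dn [in X in _ == X]e monalg.mdegM.
by rewrite monalg.mdegU.
Qed.

Lemma malg_decomp (R : nzRingType) (f : {malg R[psmonom]}) :
  f = \sum_(nu <- monalg.msupp f) monalg.mcoeff nu f *: << nu >>.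
Proof.
rewrite {1}[f]monalgE; apply: eq_bigr => nu _; apply/malgP => k.
rewrite mcoeffU [RHS]monalg.mcoeffZ mcoeffU.
by case: (nu == k); rewrite /= !(mulr0n, mulr1n, mulr1, mulr0).
Qed.

Lemma psumS k : psum K k.+1 = << ucm k >>.
Proof. by []. Qed.

Lemma mul_psumU k nu : psum K k.+1 * << nu >> = << (ucm k * nu)%M >>.
Proof. by rewrite psumS monalg.malgM_def fgmulUU mulr1. Qed.

Lemma lam_lin_ind (P : Lam K -> Prop) : (forall nu, P << nu >>) ->
  (forall c f g, P f -> P g -> P (c *: f + g)) -> forall f, P f.
Proof.
move=> PU PL f.
have P0 : P 0 by move: (PL (-1) 1 1 (PU _) (PU _)); rewrite scaleN1r addNr.
rewrite [f]malg_decomp; apply: big_ind; first exact: P0.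
  by move=> x y Px Py; rewrite -[x]scale1r; apply: PL.
by move=> nu _; rewrite -[_ *: _]addr0; apply: (PL _ _ _ (PU nu) P0).
Qed.

Lemma lam_ind (P : Lam K -> Prop) :
  P 1 -> (forall k f, P f -> P (psum K k.+1 * f)) ->
  (forall c f g, P f -> P g -> P (c *: f + g)) -> forall f, P f.
Proof.
move=> P1 PM PL; apply: lam_lin_ind PL => nu.
elim/psmonom_ind: nu => [|k nu IH]; first exact: P1.
by rewrite -mul_psumU; apply: PM IH.
Qed.

End LamInduction.

(** * Scalar products and their dual families *)

(* The derivation d/dp_(k+1). *)
HB.lock Definition dp (K : fieldType) (k : nat) : Lam K -> Lam K :=
  monalg.mmap (in_alg (Lam K))
    (fun nu : psmonom => (nu k)%:R *: << divcm nu (ucm k) >>).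

Section Derivation.
Variable K : fieldType.
Implicit Types f g : Lam K.
Local Notation dp := (@dp K).

Lemma dpE k f : dp k f = monalg.mmap (in_alg (Lam K))
    (fun nu : psmonom => (nu k)%:R *: << divcm nu (ucm k) >>) f.
Proof. by rewrite dp.unlock. Qed.

Lemma mmap_scale (R : comNzRingType) (A : algType R) (h : psmonom -> A)
    (c : R) (f : {malg R[psmonom]}) :
  monalg.mmap (in_alg A) h (c *: f) = c *: monalg.mmap (in_alg A) h f.
Proof.
rewrite (monalg.mmapEw (d := monalg.msupp f)) ?monalg.msuppZ_le // [in RHS]/monalg.mmap.
rewrite scaler_sumr; apply: eq_bigr => nu _.
by rewrite monalg.mcoeffZ /= -scalerA -scalerAl.
Qed.

Lemma dp_linear k : linear (dp k).
Proof. by move=> c f g; rewrite !dpE raddfD /= mmap_scale. Qed.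

Lemma dpU k nu : dp k << nu >> = (nu k)%:R *: << divcm nu (ucm k) >>.
Proof. by rewrite dpE monalg.mmapU /= scale1r mul1r. Qed.

Lemma dp1 k : dp k 1 = 0.
Proof. by rewrite dpU cm1 scale0r. Qed.

Lemma derivation_step (A : comAlgType K) (D : A -> A) (x c : K) (p f g : A) :
  linear D -> D (p * f) = x *: f + p * D f -> D (p * g) = x *: g + p * D g ->
  D (p * (c *: f + g)) = x *: (c *: f + g) + p * D (c *: f + g).
Proof.
move=> linD Df Dg; rewrite mulrDr -scalerAr !linD Df Dg.
rewrite !scalerDr mulrDr -scalerAr !scalerA [c * x]mulrC -!addrA.
by congr (_ + _); rewrite addrCA.
Qed.

Lemma dp_psumM k j f :
  dp k (psum K j.+1 * f) = (j == k)%:R *: f + psum K j.+1 * dp k f.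
Proof.
elim/lam_lin_ind: f => [nu|c f g IHf IHg]; last first.
  exact: (derivation_step c (dp_linear k) IHf IHg).
have -> : dp k (psum K j.+1 * << nu >>) = (mmul (ucm j) nu k)%:R *: << divcm (mmul (ucm j) nu) (ucm k) >>.
  by rewrite mul_psumU dpU.
have -> : psum K j.+1 * dp k << nu >> = (nu k)%:R *: << mmul (ucm j) (divcm nu (ucm k)) >>.
  by rewrite dpU -scalerAr mul_psumU.
have cancelU : divcm (mmul (ucm j) nu) (ucm j) = nu.
  by apply/eqP/cmP => i; rewrite divcmE cmM addKn.
(* [divcm] truncates, so dividing by [ucm k] may fail to commute with the product when [nu k] is 0;
   in that case the coefficient [(nu k)%:R] kills the term. *)
have shift n : nu k = n.+1 -> divcm (mmul (ucm j) nu) (ucm k) = mmul (ucm j) (divcm nu (ucm k)).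
  move=> nuk; apply/eqP/cmP => i; rewrite divcmE !cmM divcmE !cmU.
  by case: (eqVneq k i) => [<-|_] /=; rewrite ?subn0 // nuk addnS !subn1.
rewrite cmM cmU natrD scalerDl.
apply: (congr2 +%R).
  case: eqP => [<-|_]; first by rewrite cancelU.
  by apply: (etrans (scale0r _)); apply: (esym (scale0r _)).
case nuk: (nu k) => [|n]; last by rewrite (shift n nuk).
by apply: (etrans (scale0r _)); apply: (esym (scale0r _)).
Qed.

End Derivation.

Section AbstractDerivation.
Variables (K : fieldType) (A : comAlgType K) (p : nat -> A).
Hypothesis A_ind : forall P : A -> Prop, P 1 -> (forall k f, P f -> P (p k * f)) ->
  (forall c f g, P f -> P g -> P (c *: f + g)) -> forall f, P f.
Variable d : nat -> A -> A.
Hypothesis d_linear : forall k, linear (d k).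
Hypothesis d1 : forall k, d k 1 = 0.
Hypothesis d_pM : forall k j f, d k (p j * f) = (j == k)%:R *: f + p j * d k f.

Lemma abs_dM k f g : d k (f * g) = d k f * g + f * d k g.
Proof.
elim/A_ind: f => [|j f IH|c f h IHf IHh].
- by rewrite !(mul1r, d1, mul0r) add0r.
- by rewrite -mulrA !d_pM IH !(mulrDl, mulrDr) -scalerAl !mulrA addrA.
rewrite mulrDl -scalerAl !d_linear IHf IHh !mulrDl -!scalerAl scalerDr.
by rewrite -!addrA; congr (_ + _); rewrite addrCA.
Qed.

Lemma abs_d_prod k (I : finType) (F : I -> A) :
  d k (\prod_i F i) = \sum_i d k (F i) * \prod_(j | j != i) F j.
Proof.
have gen (s : seq I) : uniq s -> d k (\prod_(i <- s) F i) =
    \sum_(i <- s) d k (F i) * \prod_(j <- s | j != i) F j.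
  elim: s => [|i s IH] /=; first by rewrite !big_nil d1.
  case/andP=> nis us; rewrite !big_cons abs_dM eqxx IH // mulr_sumr /=.
  congr (_ * _ + _).
    rewrite [RHS]big_seq_cond [LHS]big_seq; apply: eq_bigl => j.
    by case: (eqVneq j i) => [->|]; rewrite ?(negbTE nis) ?andbT.
  rewrite [LHS]big_seq [RHS]big_seq; apply: eq_bigr => j js.
  rewrite big_cons; case: eqP => [e|_]; last by rewrite mulrCA.
  by move: nis; rewrite e js.
exact: gen (index_enum_uniq I).
Qed.

Hypothesis char0 : forall n, n.+1%:R != 0 :> K.
Variables (a : nat -> K) (g : nat -> A).
Hypothesis g_newton : newton (fun k => a k *: p k.-1) g.

Lemma lreg_nat n : GRing.lreg (n.+1%:R : A).
Proof.
move=> x y /(congr1 ( *:%R n.+1%:R^-1)); rewrite -!scaler_nat /= => e.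
by move: e; rewrite -!scalerAl !mul1r !scalerA mulVf ?scale1r.
Qed.

(* Taking d/dp_(k+1) of Newton's recurrence for [g]. *)
Lemma abs_d_newton k n :
  d k (g n) = if (k < n)%N then (k.+1%:R^-1 * a k.+1) *: g (n - k.+1)%N else 0.
Proof.
have [g0 gS] := g_newton.
have d0 : d k 0 = 0 by rewrite -[X in d k X](addNr 1) -scaleN1r d_linear d1 addr0 scaler0.
have dsum n' (F : 'I_n' -> A) : d k (\sum_i F i) = \sum_i d k (F i).
  apply: (big_morph (d k)) => // x y.
  by rewrite -[x]scale1r d_linear !scale1r.
have dZ c x : d k (c *: x) = c *: d k x.
  by rewrite -[c *: x]addr0 d_linear d0 addr0.
elim/ltn_ind: n => -[|n] IH; first by rewrite g0 d1.
have dnat x : n.+1%:R * d k x = d k (n.+1%:R * x).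
  by rewrite !mulr_natl -!scaler_nat dZ.
apply: (@lreg_nat n); rewrite dnat gS.
rewrite dsum /=; transitivity (\sum_(i < n.+1) ((i == k :> nat)%:R * a k.+1) *: g (n - k)%N
   + \sum_(i < n.+1) (a i.+1 *: p i) *
        (if (k < n - i)%N then (k.+1%:R^-1 * a k.+1) *: g (n - i - k.+1)%N else 0)).
  rewrite -big_split; apply: eq_bigr => i _ /=.
  rewrite subSS -scalerAl dZ d_pM IH ?ltnS ?leq_subr // scalerDr -scalerAl; congr (_ + _).
  by rewrite scalerA mulrC; case: eqP => [->|_]; rewrite ?mul1r ?mul0r ?scale0r.
rewrite -scaler_suml -mulr_suml subSS.
case: (ltnP k n.+1) => [ltk|gek]; last first.
  rewrite mulr0 big1 ?mul0r ?scale0r ?add0r; last first.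
    by move=> i _; case: eqP => // e; case: i e => /= i lt e; lia.
  rewrite big1 // => i _; case: ltnP; rewrite ?mulr0 //; case: i => /= i lt; lia.
have -> : \sum_(i < n.+1) ((i == k :> nat)%:R : K) = 1.
  rewrite (bigD1 (Ordinal ltk)) //= eqxx big1 ?addr0 // => i.
  by rewrite -val_eqE /= => /negbTE ->.
(* By Newton's recurrence for n - k, this sum is n - k times the claimed term. The first sum is k +
   1 times it, which makes n + 1 in all. *)
have -> : \sum_(i < n.+1) (a i.+1 *: p i) *
      (if (k < n - i)%N then (k.+1%:R^-1 * a k.+1) *: g (n - i - k.+1)%N else 0)
    = (k.+1%:R^-1 * a k.+1 * (n - k)%:R) *: g (n - k)%N.
  have natZ x : (n - k)%:R *: x = (n - k)%:R * x :> A.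
    by rewrite scaler_nat mulr_natl.
  rewrite -scalerA natZ gS.
  rewrite (big_ord_widen n.+1 (fun i => a i.+1 *: p i.+1.-1 * g (n - k - i.+1)%N)); last lia.
  rewrite scaler_sumr big_mkcond [RHS]big_mkcond /=; apply: eq_bigr => i _.
  case: i => /= i lt; have -> : (k < n - i)%N = (i < n - k)%N by lia.
  case: ifP => lt'; rewrite ?mulr0 //= -scalerAr; congr (_ *: (_ * g _)); lia.
rewrite -scalerDl -scalerAr mulr_natl -scaler_nat scalerA; congr (_ *: _).
have -> : n.+1%:R = k.+1%:R + (n - k)%:R :> K by rewrite -natrD; congr (_%:R); lia.
by rewrite mul1r mulrDr [X in _ = X + _]mulrAC mulVf // mul1r.
Qed.

End AbstractDerivation.

Section DiagonalForms.
Variables (K : fieldType) (w : psmonom -> K).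
Implicit Types f g : Lam K.

Lemma diag_formEw (D : {fset psmonom}) f g : (monalg.msupp f `<=` D)%fset ->
  diag_form w f g = \sum_(nu <- D) monalg.mcoeff nu f * monalg.mcoeff nu g * w nu.
Proof.
move=> le; rewrite /diag_form (big_fset_incl _ le) // => nu _ nin.
by rewrite mcoeff_outdom // !mul0r.
Qed.

Lemma diag_formC f g : diag_form w f g = diag_form w g f.
Proof.
rewrite (diag_formEw (D := monalg.msupp f `|` monalg.msupp g)%fset) ?fsubsetUl //.
rewrite (diag_formEw (D := monalg.msupp f `|` monalg.msupp g)%fset) ?fsubsetUr //.
by apply: eq_bigr => nu _; rewrite [X in X * _]mulrC.
Qed.

Lemma diag_form_linear f : linear (diag_form w f : Lam K -> K^o).
Proof.
move=> c g h; rewrite /diag_form scaler_sumr -big_split; apply: eq_bigr => nu _.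
rewrite monalg.mcoeffD monalg.mcoeffZ /GRing.scale /=; ring.
Qed.

HB.instance Definition _ f :=
  GRing.isLinear.Build K (Lam K) K^o *:%R (diag_form w f) (diag_form_linear f).

Lemma diag_formUl nu g : diag_form w << nu >> g = monalg.mcoeff nu g * w nu.
Proof. by rewrite /diag_form msuppU1 big_seq_fset1 monalg.mcoeffUU mul1r. Qed.

Lemma diag_formDl f g h : diag_form w (f + g) h = diag_form w f h + diag_form w g h.
Proof. by rewrite !(diag_formC _ h) raddfD. Qed.

Lemma diag_formZl c f h : diag_form w (c *: f) h = c * diag_form w f h.
Proof. by rewrite !(diag_formC _ h) linearZ. Qed.

Lemma diag_form_nondeg (w_neq0 : forall nu, w nu != 0) f :
  (forall g, diag_form w g f = 0) -> f = 0.
Proof.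
move=> f0; apply/malgP => nu; move/eqP: (f0 << nu >>).
by rewrite diag_formUl mulf_eq0 (negbTE (w_neq0 _)) orbF monalg.mcoeff0 => /eqP.
Qed.

End DiagonalForms.

Section AbstractPairing.
Variables (K : fieldType) (A : comAlgType K) (p : nat -> A).
Hypothesis A_ind : forall P : A -> Prop, P 1 -> (forall k f, P f -> P (p k * f)) ->
  (forall c f g, P f -> P g -> P (c *: f + g)) -> forall f, P f.
Variable d : nat -> A -> A.
Hypothesis d_linear : forall k, linear (d k).
Hypothesis d1 : forall k, d k 1 = 0.
Hypothesis d_pM : forall k j f, d k (p j * f) = (j == k)%:R *: f + p j * d k f.
Hypothesis char0 : forall n, n.+1%:R != 0 :> K.
Variables (a b : nat -> K) (g : nat -> A).
Hypothesis a_neq0 : forall k, a k.+1 != 0.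
Hypothesis g_newton : newton (fun k => a k *: p k.-1) g.
Variable F : A -> A -> K.
Hypothesis F_linear : forall f, linear (F f : A -> K^o).
Hypothesis F_sym : forall f h, F f h = F h f.
Hypothesis F_adj : forall k f h,
  F (p k * f) h = k.+1%:R * (a k.+1)^-1 * b k * F f (d k h).
Variables (N : nat) (ev : A -> {mpoly K[N]}).
Hypothesis F1 : forall m : 'X_{1..N}, F (\prod_i g (m i)) 1 = (m == 0%MM)%:R.
Hypothesis ev_linear : linear ev.
Hypothesis ev1 : ev 1 = 1.
Hypothesis ev_pM : forall k f, ev (p k * f) = b k *: ((\sum_i 'X_i ^+ k.+1) * ev f).

(** Multiplication by p_(k+1) is adjoint to a multiple of d/dp_(k+1), which lowers the index of one
    factor g by k + 1. On coefficients this is multiplication by x_1^(k+1) + ... + x_N^(k+1), and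
    the constants combine to [b k], as in [ev_pM]. *)
Lemma abs_pairing f (m : 'X_{1..N}) : F (\prod_i g (m i)) f = (ev f)@_m.
Proof.
have F0 h : F h 0 = 0.
  by have := F_linear h (-1) 0 0; rewrite scaler0 addr0 scaleN1r addNr.
have FD h x y : F h (x + y) = F h x + F h y.
  by have := F_linear h 1 x y; rewrite !scale1r.
have FZ h c x : F h (c *: x) = c * F h x.
  by have := F_linear h c x 0; rewrite !addr0 F0 addr0.
have Fsum h (I : finType) (G : I -> A) : F h (\sum_i G i) = \sum_i F h (G i).
  exact: (big_morph (F h) (FD h) (F0 h)).
elim/A_ind: f m => [|k f IH|c f h IHf IHh] m.
- by rewrite F1 ev1 mcoeff1.
- rewrite F_sym F_adj (abs_d_prod A_ind d_linear d1 d_pM) Fsum ev_pM mcoeffZ.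
  rewrite mulr_suml raddf_sum !mulr_sumr; apply: eq_bigr => i _ /=.
  rewrite (abs_d_newton d_linear d1 d_pM char0 g_newton) mpolyXn mcoeffXM.
  have -> : (U_(i) *+ k.+1 <= m)%MM = (k < m i)%N.
    apply/mnm_lepP/idP => [/(_ i) | lt l]; rewrite mulmnE mnm1E.
      by rewrite eqxx mul1n.
    by case: eqP => [<-|]; rewrite ?mul1n ?mul0n.
  case: ifP => [ltk|_]; last by rewrite mul0r F0 !mulr0.
  rewrite -scalerAl FZ -IH F_sym mulrA; congr (_ * F _ _).
    have := char0 k; have := a_neq0 k; move: (a k.+1) (b k) (k.+1%:R) => x y z x0 z0.
    by field; rewrite x0 z0.
  rewrite [RHS](bigD1 i) //= mnmBE mulmnE mnm1E eqxx mul1n; congr (_ * _).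
  apply: eq_bigr => j nji; rewrite mnmBE mulmnE mnm1E eq_sym (negbTE nji).
  by rewrite mul0n subn0.
by rewrite FD FZ IHf IHh ev_linear mcoeffD mcoeffZ.
Qed.
End AbstractPairing.

Section ScalarProduct.
Variables (K : fieldType) (q t : K).
Implicit Types f g : Lam K.

Definition weight (nu : psmonom) : K := (zmonom nu)%:R *
    \prod_(i <- finsupp nu) ((1 - q ^+ i.+1) * (1 - t ^+ i.+1)) ^+ nu i.

Lemma scal_qtE f g : scal_qt q t f g = diag_form weight f g.
Proof. by []. Qed.

Let factor i e : K :=
  (i.+1 ^ e * e`!)%:R * ((1 - q ^+ i.+1) * (1 - t ^+ i.+1)) ^+ e.

Lemma weightEw (D : {fset nat}) (nu : psmonom) : (finsupp nu `<=` D)%fset ->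
  weight nu = \prod_(i <- D) factor i (nu i).
Proof.
move=> le; rewrite /weight /zmonom natr_prod -big_split /=.
rewrite (big_fset_incl _ le) // => i _.
by rewrite -cmE_eq0 => /eqP ->; rewrite /= expr0 mulr1.
Qed.

(** The factor [(nu k).+1] is the one produced by differentiation, so what remains is the adjunction
    constant between p_(k+1) and d/dp_(k+1). *)
Lemma weight_ucm k (nu : psmonom) : weight (ucm k * nu)%M =
  (nu k).+1%:R * (k.+1%:R * (1 - q ^+ k.+1) * (1 - t ^+ k.+1)) * weight nu.
Proof.
pose D := (k |` finsupp nu)%fset.
have kD : k \in D by rewrite !inE eqxx.
rewrite (@weightEw D nu) ?fsubsetUr // (@weightEw D); last first.
  by rewrite mdomD mdomU; apply: fsubset_refl.
rewrite !(big_fsetD1 k kD) /= [RHS]mulrA cmM cmUU add1n; congr (_ * _).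
  rewrite /factor expnS factS !natrM.
  move: (nu k).+1%:R k.+1%:R (k.+1 ^ nu k)%:R (nu k)`!%:R (1 - q ^+ k.+1) => x1 x2 x3 x4 x5.
  move: (1 - t ^+ k.+1) => x6; rewrite exprS; move: ((x5 * x6) ^+ nu k) => x7; ring.
rewrite big_seq [RHS]big_seq; apply: eq_bigr => i; rewrite !inE => /andP[nik _].
by rewrite cmM cmU eq_sym (negbTE nik).
Qed.

Hypothesis char0 : forall n, n.+1%:R != 0 :> K.
Hypothesis q_neq1 : forall n, 1 - q ^+ n.+1 != 0.
Hypothesis t_neq1 : forall n, 1 - t ^+ n.+1 != 0.

Lemma weight_neq0 nu : weight nu != 0.
Proof.
rewrite (@weightEw (finsupp nu) nu) ?fsubset_refl //.
rewrite prodf_seq_neq0; apply/allP => i _ /=; rewrite mulf_neq0 ?expf_neq0 ?mulf_neq0 //.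
by case e : (i.+1 ^ nu i * (nu i)`!)%N (char0 (i.+1 ^ nu i * (nu i)`!).-1) => [|n] //;
  move/eqP: e; rewrite muln_eq0 expn_eq0 /= -leqn0 leqNgt fact_gt0.
Qed.

Lemma weight1 : weight mone = 1.
Proof. by rewrite /weight /zmonom mdom1 !big_seq_fset0 mulr1. Qed.

Lemma mcoeff_dp k nu f :
  monalg.mcoeff nu (dp k f) = (nu k).+1%:R * monalg.mcoeff (ucm k * nu)%M f.
Proof.
elim/lam_lin_ind: f => [mu|c f g IHf IHg]; last first.
  rewrite (dp_linear k c f g) !monalg.mcoeffD !monalg.mcoeffZ IHf IHg; ring.
rewrite dpU monalg.mcoeffZ !monalg.mcoeffU1 eq_sym [_ == mmul _ _]eq_sym.
case muk: (mu k) => [|n].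
  have -> : (mmul (ucm k) nu == mu) = false.
    by apply/negP => /eqP e; move: muk; rewrite -e cmM cmUU.
  by rewrite mul0r mulr0.
have e : (nu == divcm mu (ucm k)) = (mmul (ucm k) nu == mu).
  apply/eqP/eqP => [->|<-]; apply/eqP/cmP => i; rewrite ?(cmM, divcmE, cmU).
    by case: (eqVneq k i) => [<-|]; rewrite ?add0n ?subn0 // muk subn1 add1n.
  by rewrite addKn.
rewrite e; case: eqP => [e'|_]; last by rewrite !mulr0.
by move: muk; rewrite -e' cmM cmUU add1n => -[->].
Qed.

Lemma linear_adjoint_step (A : comAlgType K) (F G : A -> K) (x c : K) (p f g : A) :
  linear (F : A -> K^o) -> linear (G : A -> K^o) ->
  F (p * f) = x * G f -> F (p * g) = x * G g ->
  F (p * (c *: f + g)) = x * G (c *: f + g).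
Proof.
move=> linF linG Ff Fg; rewrite mulrDr -scalerAr linF linG Ff Fg.
by rewrite mulrDr /GRing.scale /= mulrCA.
Qed.

Lemma scal_qt_linear f : linear (scal_qt q t f : Lam K -> K^o).
Proof. exact: diag_form_linear. Qed.

Lemma scal_qtC f g : scal_qt q t f g = scal_qt q t g f.
Proof. exact: diag_formC. Qed.

Lemma scal_qt_adj k f g : scal_qt q t (psum K k.+1 * f) g =
  k.+1%:R * (1 - q ^+ k.+1) * (1 - t ^+ k.+1) * scal_qt q t f (dp k g).
Proof.
rewrite scal_qtC [in RHS]scal_qtC.
elim/lam_lin_ind: f => [nu|c f h IHf IHh]; last first.
  exact: (linear_adjoint_step c (scal_qt_linear g) (scal_qt_linear (dp k g)) IHf IHh).
rewrite scal_qtC [in RHS]scal_qtC mul_psumU.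
apply: (etrans (diag_formUl _ _ _)).
apply: (etrans _ (congr1 (fun x => _ * x) (esym (diag_formUl _ _ _)))).
rewrite mcoeff_dp -/(weight (mmul _ _)) -/(weight nu) weight_ucm.
move: (monalg.mcoeff _ _) (nu k).+1%:R k.+1%:R (1 - q ^+ k.+1) (1 - t ^+ k.+1).
by move=> x1 x2 x3 x4 x5; ring.
Qed.

End ScalarProduct.

Section CompleteFunctions.
Variable K : fieldType.

Lemma hsym_newton (char0 : forall n, n.+1%:R != 0 :> K) :
  newton (fun k => psum K k) (hsym K).
Proof.
split=> // -[|n]; first by rewrite mul0r big_ord0.
have nthE n' i : (i <= n')%N -> nth 0 (hsym_seq K n') i = hsym K (n' - i).
  elim: n' i => [|n' IH] [|i] //= le; rewrite ?subn0 //; exact: IH.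
rewrite /hsym /= mulr_natl -scaler_nat scalerA divff // scale1r.
apply: eq_bigr => i _; rewrite nthE ?subSS //; by rewrite -ltnS.
Qed.

End CompleteFunctions.

(* h_n[X/(1-q)] *)
HB.lock Definition gs (K : fieldType) (q : K) (n : nat) : Lam K :=
  plethysm (in_alg (Lam K)) (fun k => (1 - q ^+ k)^-1 *: psum K k) (hsym K n).

(* f[Z(1-t)] in the variables z_1, ..., z_N *)
HB.lock Definition ev (K : fieldType) (t : K) (N : nat) (f : Lam K) : {mpoly K[N]} :=
  realize N (pleth_1t t f).

Section Pairing.
Variables (K : fieldType) (q t : K).
Hypothesis char0 : forall n, n.+1%:R != 0 :> K.
Hypothesis q_neq1 : forall n, 1 - q ^+ n.+1 != 0.

Lemma gs_newton : newton (fun k => (1 - q ^+ k)^-1 *: psum K k.-1.+1) (gs q).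
Proof.
have [h0 hS] := newton_morph
  (plethysm (in_alg (Lam K)) (fun k => (1 - q ^+ k)^-1 *: psum K k)) (hsym_newton char0).
rewrite gs.unlock; split=> [|n]; first exact: h0.
apply: (etrans (hS n)); apply: eq_bigr => i _ /=.
by rewrite plethysm_psum.
Qed.

Lemma ev_linear N : linear (ev t N).
Proof.
move=> c f g; rewrite ev.unlock /realize /pleth_1t.
rewrite rmorphD /= (plethysmZ (in_alg (Lam K))) /= mulr_algl rmorphD /= plethysmZ.
by rewrite mul_mpolyC.
Qed.

Lemma ev0 N : ev t N 0 = 0.
Proof. by have := @ev_linear N (-1) 0 0; rewrite scaler0 addr0 scaleN1r addNr. Qed.

Lemma evZ N c f : ev t N (c *: f) = c *: ev t N f.
Proof. by have := @ev_linear N c f 0; rewrite !addr0 ev0 addr0. Qed.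

Lemma evD N f g : ev t N (f + g) = ev t N f + ev t N g.
Proof. by have := @ev_linear N 1 f g; rewrite !scale1r. Qed.

Lemma ev1 N : ev t N 1 = 1.
Proof. by rewrite ev.unlock /realize /pleth_1t !rmorph1. Qed.

Lemma evM N f g : ev t N (f * g) = ev t N f * ev t N g.
Proof. by rewrite ev.unlock /realize /pleth_1t !rmorphM. Qed.

Lemma ev_psum N k : ev t N (psum K k.+1) = (1 - t ^+ k.+1) *: \sum_i 'X_i ^+ k.+1.
Proof.
rewrite ev.unlock /realize /pleth_1t plethysm_psum // plethysmZ plethysm_psum //.
by rewrite mul_mpolyC.
Qed.

Lemma gs_const n : monalg.mcoeff mone (gs q n) = (n == 0%N)%:R.
Proof.
have nat_reg k : GRing.lreg (k.+1%:R : K) by apply/lregP.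
apply: (@newton_uniq K nat_reg (fun=> 0) (fun n => monalg.mcoeff mone (gs q n))
  (fun n => (n == 0%N)%:R)).
  apply: (newton_ext _ (newton_morph (monalg.mcoeff (mone : psmonom)) gs_newton)) => k /=.
  by rewrite monalg.mcoeffZ /= psumS monalg.mcoeffU1 monalg.cm1_eq1 mulr0; exact: (erefl (0 : K)).
by split=> // k; rewrite big1 ?mul0r // => [|i _];
  [case: k => [|k]; rewrite ?mul0r ?mulr0 | rewrite mul0r].
Qed.

(** In the weights of the form, the factors 1 - q^k cancel the substitution X/(1-q) made in [gs],
    and the factors 1 - t^k survive as the substitution Z(1-t). *)
Lemma scal_qt_gs N (m : 'X_{1..N}) f :
  scal_qt q t (\prod_i gs q (m i)) f = (ev t N f)@_m.
Proof.
apply: (@abs_pairing K (Lam K) (fun k => psum K k.+1) (@lam_ind K) (@dp K)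
  (@dp_linear K) (@dp1 K) (@dp_psumM K) char0 (fun k => (1 - q ^+ k)^-1)
  (fun k => 1 - t ^+ k.+1) (gs q)).
- by move=> k; rewrite invr_eq0.
- exact: gs_newton.
- exact: scal_qt_linear.
- exact: scal_qtC.
- by move=> k g h; rewrite invrK; apply: scal_qt_adj.
- move=> {f} m'; rewrite scal_qtC; apply: (etrans (diag_formUl _ _ _)).
  rewrite -/(weight q t _) weight1 mulr1 rmorph_prod /=.
  under eq_bigr do rewrite gs_const.
  case: eqP => [->|ne]; first by rewrite big1 // => i _; rewrite mnm0E.
  case: (pickP (fun i => m' i != 0%N)) => [i ni|all0].
    by rewrite (bigD1 i) //= (negbTE ni) mul0r.
  by case: ne; apply/mnmP => i; rewrite mnm0E; apply/eqP; move/negbFE: (all0 i).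
- exact: ev_linear.
- exact: ev1.
by move=> k g; rewrite evM ev_psum scalerAl.
Qed.

End Pairing.

Section Span.
Variables (K : fieldType) (A : comAlgType K) (p : nat -> A).
Hypothesis A_ind : forall P : A -> Prop, P 1 -> (forall k f, P f -> P (p k * f)) ->
  (forall c f g, P f -> P g -> P (c *: f + g)) -> forall f, P f.
Variables (a : nat -> K) (g : nat -> A).
Hypothesis a_neq0 : forall k, a k.+1 != 0.
Hypothesis g_newton : newton (fun k => a k *: p k.-1) g.

(** Newton's recurrence solved for p_(k+1) involves g_(k+1) and products of earlier p_i with some
    g_j. The claim is strengthened by a product over [s], which collects the factors g split off
    while f is consumed. *)
Lemma newton_span (P : A -> Prop) : (forall s : seq nat, P (\prod_(i <- s) g i)) ->
  (forall c f h, P f -> P h -> P (c *: f + h)) -> forall f, P f.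
Proof.
move=> Pg PL f; suff H s : P (f * \prod_(i <- s) g i) by have := H [::]; rewrite big_nil mulr1.
have P0 : P 0.
  by have := PL (-1) _ _ (Pg [::]) (Pg [::]); rewrite scaleN1r addNr.
have PZ c x : P x -> P (c *: x) by move=> Px; rewrite -[_ *: _]addr0; apply: PL.
have PD x y : P x -> P y -> P (x + y) by move=> Px; rewrite -[x]scale1r; apply: PL.
elim/A_ind: f s => [|k f IH|c f h IHf IHh] s; first by rewrite mul1r.
  elim/ltn_ind: k s => k IHk s.
  have -> : p k = (a k.+1)^-1 *: (k.+1%:R *: g k.+1
                 - \sum_(i < k) (a i.+1 *: p i) * g (k - i)%N).
    rewrite scaler_nat -mulr_natl g_newton.2 big_ord_recr /= subnn g_newton.1 mulr1.
    rewrite [X in X + _ - _](eq_bigr (fun i : 'I_k => (a i.+1 *: p i) * g (k - i)%N)) //.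
    by rewrite [X in X - _]addrC addrK scalerA mulVf // scale1r.
  rewrite -!scalerAl; apply/PZ; rewrite !mulrBl; apply/PD.
    rewrite -!scalerAl; apply/PZ.
    by have := IH (k.+1 :: s); rewrite big_cons mulrCA mulrA.
  rewrite -scaleN1r; apply/PZ; rewrite !mulr_suml; apply: big_ind => // i _.
  rewrite -!scalerAl; apply/PZ.
  have := IHk i (ltn_ord i) ((k - i)%N :: s); rewrite big_cons.
  by rewrite -!mulrA [g _ * (f * _)]mulrCA.
by rewrite mulrDl -scalerAl; apply: PL.
Qed.

End Span.

Section Duality.
Variables (K : fieldType) (q t : K).
Hypothesis char0 : forall n, n.+1%:R != 0 :> K.
Hypothesis q_neq1 : forall n, 1 - q ^+ n.+1 != 0.
Hypothesis t_neq1 : forall n, 1 - t ^+ n.+1 != 0.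

Definition gl (s : seq nat) : Lam K := \prod_(i <- s) gs q i.

Lemma gs_span (P : Lam K -> Prop) : (forall s, P (gl s)) ->
  (forall c f h, P f -> P h -> P (c *: f + h)) -> forall f, P f.
Proof.
apply: (@newton_span K (Lam K) (fun k => psum K k.+1) (@lam_ind K)
  (fun k => (1 - q ^+ k)^-1)); last exact: gs_newton.
by move=> k; rewrite invr_eq0.
Qed.

Definition to_part (s : seq nat) : seq nat := sort geq [seq x <- s | (0 < x)%N].

Lemma to_part_is_part s : is_part (to_part s).
Proof.
apply/andP; split; first by apply: sort_sorted => x y; apply: leq_total.
by rewrite mem_sort mem_filter.
Qed.

Lemma gl_to_part s : gl (to_part s) = gl s.
Proof.
rewrite /gl /to_part (perm_big _ (permEl (perm_sort _ _))) /= big_filter.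
rewrite big_mkcond; apply: eq_bigr => i _.
by case: i => //=; rewrite (gs_newton q char0).1.
Qed.

Lemma gl_nondeg f : (forall la, is_part la -> scal_qt q t (gl la) f = 0) -> f = 0.
Proof.
move=> f0; apply: (@diag_form_nondeg _ (weight q t)); first exact: weight_neq0.
apply: gs_span => [s|c g h g0 h0].
  by rewrite -gl_to_part; apply: f0; apply: to_part_is_part.
by rewrite diag_formDl diag_formZl g0 h0 mulr0 addr0.
Qed.

Lemma scal_qt_gl N s f : size s = N ->
  scal_qt q t (gl s) f = (ev t N f)@_[multinom nth 0%N s i | i < N].
Proof.
move=> sN; rewrite -(scal_qt_gs t char0 q_neq1); congr (scal_qt _ _ _ _).
rewrite /gl (big_nth 0%N) sN big_mkord; apply: eq_bigr => i _; by rewrite mnmE.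
Qed.

End Duality.

(** * Partitions, dominance and the statistic n *)

Section NPart.
Implicit Types s mu : seq nat.

Lemma sumn_takeS s k : sumn (take k.+1 s) = (sumn (take k s) + nth 0 s k)%N.
Proof.
case: (ltnP k (size s)) => lt; last first.
  by rewrite !take_oversize ?nth_default ?addn0 // (leq_trans lt).
by rewrite (take_nth 0%N lt) sumn_rcons.
Qed.

Lemma n_part_wide M s : (size s <= M)%N -> n_part s = (\sum_(i < M) i * nth 0 s i)%N.
Proof.
move=> le; rewrite /n_part (big_ord_widen M (fun i => i * nth 0 s i)%N le).
rewrite big_mkcond; apply: eq_bigr => i _; case: ltnP => // ge.
by rewrite nth_default ?muln0.
Qed.

(* Abel summation: n(s) measures how low the partial sums of s are. *)
Lemma n_part_partial M s : (size s <= M)%N ->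
  (n_part s + \sum_(k < M) sumn (take k.+1 s) = M * sumn s)%N.
Proof.
move=> le; rewrite (n_part_wide le); have -> : sumn s = sumn (take M s).
  by rewrite take_oversize.
elim: M {le} => [|M IH]; first by rewrite !big_ord0 take0.
rewrite !big_ord_recr /= addnACA IH sumn_takeS; lia.
Qed.

(** By Abel summation, n is a constant minus the sum of the partial sums, so dominance reverses n,
    and equality forces every partial sum to agree. The sequences need not be sorted, which allows
    exponent vectors. *)
Lemma n_part_dom s mu : sumn s = sumn mu ->
  (forall k, sumn (take k s) <= sumn (take k mu))%N ->
  (n_part mu <= n_part s)%N /\
  (n_part mu = n_part s -> forall i, nth 0%N s i = nth 0%N mu i).
Proof.
move=> e le; pose M := maxn (size s) (size mu).
have es := n_part_partial (leq_maxl (size s) (size mu) : (size s <= M)%N).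
have em := n_part_partial (leq_maxr (size s) (size mu) : (size mu <= M)%N).
have les : (\sum_(k < M) sumn (take k.+1 s) <= \sum_(k < M) sumn (take k.+1 mu))%N.
  by apply: leq_sum => k _; apply: le.
split=> [|enp]; first by rewrite e in es; lia.
have eqs : (\sum_(k < M) sumn (take k.+1 s) == \sum_(k < M) sumn (take k.+1 mu))%N.
  by rewrite e in es; apply/eqP; lia.
have pe k : (k <= M)%N -> sumn (take k s) = sumn (take k mu).
  case: k => [|k] lek; first by rewrite !take0.
  have [_ eqC] := @leqif_sum 'I_M xpredT _ (fun k => sumn (take k.+1 s))
    (fun k => sumn (take k.+1 mu)) (fun k _ => leqif_eq (le k.+1)).
  by move: eqs; rewrite eqC => /forallP/(_ (Ordinal lek))/eqP.
move=> i; case: (ltnP i M) => lti; last first.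
  by rewrite !nth_default // (leq_trans _ lti) // ?leq_maxl ?leq_maxr.
by have := pe i.+1 lti; rewrite !sumn_takeS (pe i (ltnW lti)) => /addnI.
Qed.

Lemma part_eq s mu : is_part s -> is_part mu ->
  (forall i, nth 0%N s i = nth 0%N mu i) -> s = mu.
Proof.
have sz s' mu' : is_part s' -> (forall i, nth 0%N s' i = nth 0%N mu' i) ->
    (size s' <= size mu')%N.
  move=> /andP[_ n0] e; rewrite leqNgt; apply/negP => lt.
  have := e (size mu'); rewrite [RHS]nth_default // => e0.
  by move/negP: n0; apply; rewrite -e0 mem_nth.
move=> ps pm e; apply: (@eq_from_nth _ 0%N) => [|i _]; last exact: e.
by apply/eqP; rewrite eqn_leq !sz.
Qed.

Lemma part_size mu : is_part mu -> (size mu <= sumn mu)%N.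
Proof.
case/andP=> _; elim: mu => //= x mu IH; rewrite inE negb_or => /andP[x0 nmu].
by have := IH nmu; lia.
Qed.

Lemma n_part_le mu : (n_part mu <= size mu * sumn mu)%N.
Proof. by rewrite -(n_part_partial (leqnn _)) leq_addr. Qed.

Lemma to_part_id mu : is_part mu -> to_part mu = mu.
Proof.
case/andP=> so n0; rewrite /to_part; have -> : [seq x <- mu | (0 < x)%N] = mu.
  by apply/all_filterP/allP => x xin; rewrite lt0n; apply: contraNneq n0 => <-.
by apply: sorted_sort => // x y z xy yz; apply: leq_trans yz xy.
Qed.

(** A partition of n has at most n parts, each at most n, so sorting the n-tuples over ['I_n.+1] and
    dropping zeros reaches all of them. *)
Definition parts (n : nat) : seq (seq nat) :=
  [seq mu <- undup [seq to_part (map val (tval t)) | t <- enum {: n.-tuple 'I_n.+1}]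
   | sumn mu == n].

Lemma mem_parts n mu : (mu \in parts n) = is_part mu && (sumn mu == n).
Proof.
rewrite mem_filter mem_undup andbC; case: eqP => [e|_]; rewrite ?andbF ?andbT //.
apply/mapP/idP => [[t _ ->]|pm]; first exact: to_part_is_part.
have sz := part_size pm; rewrite e in sz.
exists [tuple inord (nth 0%N mu i) | i < n] => //.
  by rewrite mem_enum.
rewrite -[LHS](to_part_id pm) /to_part; congr sort.
have -> : map val [tuple (inord (nth 0%N mu i) : 'I_n.+1) | i < n]
        = mu ++ nseq (n - size mu) 0%N.
  apply: (@eq_from_nth _ 0%N) => [|i]; rewrite size_map size_tuple.
    by rewrite size_cat size_nseq subnKC.
  move=> lti; rewrite (nth_map ord0) ?size_tuple //.
  rewrite (_ : nth _ _ i = inord (nth 0%N mu i)); last first.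
    by rewrite -(tnth_nth ord0 _ (Ordinal lti)) tnth_mktuple.
  rewrite /= inordK.
    rewrite nth_cat nth_nseq; case: ltnP => // ge; rewrite nth_default //.
    by case: ifP.
  rewrite ltnS -e; elim: (mu) (i) => [|x l IH] [|j] //=; first exact: leq_addr.
  by apply: (leq_trans (IH j)); apply: leq_addl.
rewrite filter_cat [X in _ ++ X](_ : _ = [::]) ?cats0 //.
by elim: (n - size mu)%N.
Qed.

Lemma parts_uniq n : uniq (parts n).
Proof. by rewrite filter_uniq ?undup_uniq. Qed.

End NPart.

(** * Orthogonal families triangular for dominance *)

Section TriangularBasis.
Variables (K : fieldType) (A : lmodType K) (F : A -> A -> K).
Hypothesis F_linear : forall f, linear (F f : A -> K^o).
Hypothesis F_sym : forall f g, F f g = F g f.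
Hypothesis F_aniso : forall f, F f f = 0 -> f = 0.
Variables (gl H : seq nat -> A).
Hypothesis gl_nondeg : forall f, (forall la, is_part la -> F (gl la) f = 0) -> f = 0.
Hypothesis H_orth : forall la mu, is_part la -> is_part mu -> la <> mu ->
  F (H la) (H mu) = 0.
Hypothesis H_neq0 : forall mu, is_part mu -> H mu <> 0.
Hypothesis H_tri : forall mu s, is_part mu -> F (gl s) (H mu) != 0 ->
  sumn s = sumn mu /\ forall k, (sumn (take k s) <= sumn (take k mu))%N.

Lemma form0 f : F f 0 = 0.
Proof. by have := F_linear f (-1) 0 0; rewrite scaler0 addr0 scaleN1r addNr. Qed.

Lemma formZ f c g : F f (c *: g) = c * F f g.
Proof. by have := F_linear f c g 0; rewrite !addr0 form0 addr0. Qed.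

Lemma formD f g h : F f (g + h) = F f g + F f h.
Proof. by have := F_linear f 1 g h; rewrite !scale1r. Qed.

Lemma form_sum f (I : Type) (r : seq I) (P : pred I) (G : I -> A) :
  F f (\sum_(i <- r | P i) G i) = \sum_(i <- r | P i) F f (G i).
Proof. exact: (big_morph (F f) (formD f) (form0 f)). Qed.

Lemma H_tri_n_part mu s : is_part mu -> F (gl s) (H mu) != 0 ->
  sumn s = sumn mu /\ ((n_part mu < n_part s)%N \/ forall i, nth 0%N s i = nth 0%N mu i).
Proof.
move=> pm /(H_tri pm)[e le]; split=> //; have [le' eq'] := n_part_dom e le.
by case: (ltngtP (n_part mu) (n_part s)) le' => [|//|/eq'] lt _; [left | right].
Qed.

(** A filtration by n(s). Since n(s) <= n * n for partitions of n, the bound excludes everything at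
    h = 0 and nothing at h = n * n + 1. *)
Let supported (n h : nat) f := forall s, is_part s -> F (gl s) f != 0 ->
  sumn s = n /\ (n * n < n_part s + h)%N.

Let spanned (n h : nat) f := exists a : seq nat -> K,
  f = \sum_(mu <- parts n | (n * n < n_part mu + h)%N) a mu *: H mu.

Let n_part_bound n mu : is_part mu -> sumn mu = n -> (n_part mu <= n * n)%N.
Proof.
move=> pm <-; apply: leq_trans (n_part_le _) _.
by rewrite leq_mul2r part_size ?orbT.
Qed.

(** If the diagonal coefficient vanished, [H mu] would pair only with [gl s] for n(s) > n(mu), hence
    be a combination of [H la] with n(la) > n(mu). All of these are orthogonal to [H mu], which
    would then be isotropic. *)
Let diag_neq0_step n h : (forall f, supported n h f -> spanned n h f) ->
  forall mu, is_part mu -> sumn mu = n -> (n * n = n_part mu + h)%N ->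
  F (gl mu) (H mu) != 0.
Proof.
move=> sp mu pm smu e; apply/eqP => c0; case: (H_neq0 pm); apply: F_aniso.
have [a aE] : spanned n h (H mu).
  apply: sp => s ps nz; have [es [lt|eqs]] := H_tri_n_part pm nz.
    by rewrite es smu; split=> //; rewrite e; lia.
  by move: nz; rewrite (part_eq ps pm eqs) c0 eqxx.
rewrite {2}aE form_sum big_seq_cond big1 // => la /andP[]; rewrite mem_parts.
case/andP=> pl _ lt; rewrite formZ H_orth ?mulr0 //.
by move=> el; move: lt; rewrite -el; lia.
Qed.

(** Induction on h: subtract the combination of the [H mu] on the lowest level n(mu) = n * n - h
    that cancels the pairings with the [gl mu] of that level. The diagonal coefficients divided by
    are nonzero by [diag_neq0_step]. *)
Let triangular_span n h f : supported n h f -> spanned n h f.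
Proof.
elim: h f => [|h IH] f sf.
  exists (fun=> 0); rewrite big1 => [|mu _]; last by rewrite scale0r.
  apply: gl_nondeg => s ps; apply/eqP/negPn/negP => nz.
  have [es] := sf s ps nz; rewrite addn0 => lt.
  by have := n_part_bound ps es; lia.
pose lev (mu : seq nat) := (n * n == n_part mu + h)%N.
pose b mu := F (gl mu) f / F (gl mu) (H mu).
pose f' := f - \sum_(mu <- parts n | lev mu) b mu *: H mu.
have Ff' s : F (gl s) f' = F (gl s) f - \sum_(mu <- parts n | lev mu) b mu * F (gl s) (H mu).
  rewrite /f' -scaleN1r formD formZ form_sum mulN1r; congr (_ - _).
  by apply: eq_bigr => mu _; rewrite formZ.
have [a' f'E] : spanned n h f'.
  apply: (IH) => s ps nz.
  have [[mu] | nomu] := altP (@hasP _ (fun mu => lev mu && (F (gl s) (H mu) != 0)) (parts n)).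
    move=> muin /andP[/eqP lm nzm]; move: muin; rewrite mem_parts => /andP[pm /eqP smu].
    have [es [lt|eqs]] := H_tri_n_part pm nzm; first by rewrite es smu lm; split=> //; lia.
    have e := part_eq ps pm eqs; move: nz; rewrite e Ff'.
    have muin : mu \in [seq la <- parts n | lev la].
      by rewrite mem_filter mem_parts pm smu /lev lm !eqxx.
    rewrite -big_filter (bigD1_seq mu muin (filter_uniq _ (parts_uniq n))) /=.
    rewrite divfK; last by rewrite -[X in gl X]e.
    rewrite big_seq_cond big1 ?addr0 ?subrr ?eqxx // => la /andP[].
    rewrite mem_filter mem_parts => /andP[/eqP ll /andP[pl /eqP sl]] nla.
    have [->|nzl] := eqVneq (F (gl mu) (H la)) 0; first by rewrite mulr0.
    have [_ [lt|eqs']] := H_tri_n_part pl nzl; first by move: ll lm lt; lia.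
    by move: nla; rewrite (part_eq pm pl eqs') eqxx.
  move: nz; rewrite Ff' big_seq_cond big1 ?subr0 => [nz|mu /andP[muin lm]].
    have [es lt] := sf s ps nz; split=> //; rewrite ltn_neqAle.
    have ls : (n * n <= n_part s + h)%N by lia.
    rewrite ls andbT; apply: contra nomu => ll; apply/hasP; exists s.
      by rewrite mem_parts ps es eqxx.
    by rewrite /lev ll (diag_neq0_step IH ps es) //; apply/eqP.
  apply/eqP; rewrite mulf_eq0; apply/orP; right; apply: contraNT nomu => nzm.
  by apply/hasP; exists mu => //; rewrite lm nzm.
exists (fun mu => if lev mu then b mu else a' mu).
rewrite -[f](subrK (\sum_(mu <- parts n | lev mu) b mu *: H mu)) -/f' f'E.
rewrite [RHS](bigID lev) /= [LHS]addrC; congr (_ + _).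
  rewrite [LHS]big_mkcond [RHS]big_mkcond; apply: eq_bigr => mu _.
  case lm: (lev mu); rewrite ?andbF //= andbT ifT //.
  by move: lm; rewrite /lev => /eqP; lia.
rewrite [LHS]big_mkcond [RHS]big_mkcond; apply: eq_bigr => mu _.
case lm: (lev mu); rewrite ?andbF ?andbT /=.
  by rewrite ifF //; move: lm; rewrite /lev => /eqP; lia.
have -> // : (n * n < n_part mu + h.+1)%N = (n * n < n_part mu + h)%N.
by move: lm; rewrite /lev => /eqP; lia.
Qed.

Lemma H_diag_neq0 mu : is_part mu -> F (gl mu) (H mu) != 0.
Proof.
move=> pm; have b := n_part_bound pm erefl.
apply: (@diag_neq0_step (sumn mu) (sumn mu * sumn mu - n_part mu)) => //.
  exact: triangular_span.
by rewrite subnKC.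
Qed.

Lemma H_norm_neq0 mu : is_part mu -> F (H mu) (H mu) != 0.
Proof. by move=> pm; apply/eqP => /F_aniso; apply: H_neq0. Qed.

Lemma H_expand n f : (forall s, is_part s -> F (gl s) f != 0 -> sumn s = n) ->
  f = \sum_(mu <- parts n) (F f (H mu) / F (H mu) (H mu)) *: H mu.
Proof.
move=> sf; have [a aE] : spanned n (n * n).+1 f.
  by apply: triangular_span => s ps /sf -> //; split=> //; lia.
rewrite {1}aE; rewrite big_mkcond [LHS]big_seq [RHS]big_seq; apply: eq_bigr => mu.
rewrite mem_parts => /andP[pm /eqP smu].
have lt la : (n * n < n_part la + (n * n).+1)%N by lia.
rewrite lt F_sym {1}aE form_sum; under eq_bigl do rewrite lt.
rewrite (bigD1_seq mu) ?mem_parts ?parts_uniq ?pm ?smu ?eqxx //=.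
rewrite big_seq_cond big1 ?addr0 => [|la /andP[]].
  by rewrite formZ mulfK // H_norm_neq0.
rewrite mem_parts => /andP[pl _] nla; rewrite formZ H_orth ?mulr0 //.
by move=> e; rewrite e eqxx in nla.
Qed.

End TriangularBasis.

(** * A determinantal identity for the Cauchy kernel *)

Section CauchyKernel.
Variables (R : comNzRingType) (m : nat).
Implicit Types x y : 'I_m -> R.

Definition dl (k : 'I_m) : nat := (m - k.+1)%N.

Definition vdm x : 'M[R]_m := \matrix_(i, k) x i ^+ dl k.

(** Up to one factor per row, the entries are y_i^(delta_k) (1 + u t^(delta_k) T_i) applied to the
    Cauchy kernel prod_j (t x_j y_i; q)_oo / (x_j y_i; q)_oo: the q-shift T_i multiplies the kernel
    by prod_j (1 - x_j y_i) / (1 - t x_j y_i). Clearing denominators removes q. *)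
Definition kern_mx (t u : R) x y : 'M[R]_m :=
  \matrix_(i, k) (y i ^+ dl k * (\prod_j (1 - t * x j * y i)
                                 + u * t ^+ dl k * \prod_j (1 - x j * y i))).

Definition omit x (l : 'I_m) : {poly R} := \prod_(j | j != l) (1 - x j *: 'X).

(** Column l lists the coefficients of [omit x l], of degree below m, in the order of the columns of
    [vdm]. Multiplying on the right by this matrix turns monomials into values of [omit x l]. *)
Definition omit_mx x : 'M[R]_m := \matrix_(k, l) (omit x l)`_(dl k).

Lemma det_scale_rc (r c : 'I_m -> R) (A : 'M[R]_m) :
  \det (\matrix_(i, j) (r i * c j * A i j)) = (\prod_i r i) * (\prod_j c j) * \det A.
Proof.
have -> : \matrix_(i, j) (r i * c j * A i j)
    = diag_mx (\row_i r i) *m A *m diag_mx (\row_j c j).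
  apply/matrixP => i j; rewrite mul_mx_diag mxE mul_diag_mx !mxE.
  by rewrite -mulrA [c j * _]mulrC mulrA.
rewrite !det_mulmx !det_diag mulrAC; congr (_ * _ * _); apply: eq_bigr => i _; by rewrite mxE.
Qed.

Lemma omit_horner x l z : (omit x l).[z] = \prod_(j | j != l) (1 - x j * z).
Proof.
rewrite horner_prod; apply: eq_bigr => j _.
by rewrite hornerD hornerN hornerZ hornerX hornerC.
Qed.

Lemma full_prod x l z :
  \prod_j (1 - x j * z) = (1 - x l * z) * (omit x l).[z].
Proof. by rewrite (bigD1 l) //= omit_horner. Qed.

Lemma sum_omit_mx x l z : \sum_k z ^+ dl k * omit_mx x k l = (omit x l).[z].
Proof.
have sz : (size (omit x l) <= m)%N.
  have szl j : (size (1 - x j *: 'X : {poly R})%R <= 2)%N.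
    apply: (leq_trans (size_polyD _ _)); rewrite geq_max size_polyN size_poly1 /=.
    by apply: (leq_trans (size_scale_leq _ _)); rewrite size_polyX.
  have gen (P : pred 'I_m) (r : seq 'I_m) :
      (size (\prod_(j <- r | P j) (1 - x j *: 'X : {poly R}))%R <= (count P r).+1)%N.
    elim: r => [|j r IH]; first by rewrite big_nil size_poly1.
    rewrite big_cons /=; case: (P j) => //=.
    apply: (leq_trans (size_polyMleq _ _)); have := szl j.
    move: (size _) (size _) (count _ _) IH => a b c; lia.
  apply: leq_trans (gen _ _) _; rewrite -sum1_count sum1_card cardC1 card_ord.
  by case: m l => // -[].
rewrite (horner_coef_wide _ sz) (reindex_inj rev_ord_inj) /=.
by apply: eq_bigr => k _; rewrite mxE /dl /= subnSK // subKn 1?ltnW // mulrC.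
Qed.

Lemma vdm_omit x y : vdm y *m omit_mx x = \matrix_(i, l) (omit x l).[y i].
Proof.
apply/matrixP => i l; rewrite !mxE -sum_omit_mx.
by apply: eq_bigr => k _; rewrite !mxE.
Qed.

(** Both halves become values of [omit x l], at y_i and at t y_i, and each full product contributes
    its missing factor, leaving (1 - t x_l y_i) + u (1 - x_l y_i). At u = -1 and u = -t this
    collapses to the monomials (1 - t) x_l y_i and 1 - t, whence these two values of u. *)
Lemma kern_omit t u x y i l : (kern_mx t u x y *m omit_mx x) i l =
  (omit x l).[y i] * (omit x l).[t * y i] * (1 + u - (t + u) * (x l * y i)).
Proof.
have E : \prod_j (1 - t * x j * y i) = (1 - x l * (t * y i)) * (omit x l).[t * y i].
  by rewrite -full_prod; apply: eq_bigr => j _; rewrite mulrCA mulrA.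
rewrite mxE; transitivity ((\sum_k y i ^+ dl k * omit_mx x k l) * \prod_j (1 - t * x j * y i)
    + u * (\sum_k (t * y i) ^+ dl k * omit_mx x k l) * \prod_j (1 - x j * y i)).
  rewrite mulr_sumr !mulr_suml -big_split; apply: eq_bigr => k _ /=.
  rewrite mxE exprMn; move: (y i ^+ _) (t ^+ _) (omit_mx x k l) => y' t' o.
  by move: (\prod_j _) (\prod_j _) => P Q; ring.
rewrite !sum_omit_mx E (full_prod x l (y i)); ring.
Qed.

End CauchyKernel.

Section CauchyKernelField.
Variables (F : fieldType) (m : nat) (t : F).
Implicit Types x y : 'I_m -> F.

(** Dividing each row by its full product leaves the matrix of the 1 / P(x_l y_i), whose determinant
    is that of its transpose, and the product of all row factors is symmetric in x and y. *)
Lemma omit_exchange (P : F -> F) x y :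
  (forall i j, P (x j * y i) != 0) ->
  \det (\matrix_(i, l) \prod_(j | j != l) P (x j * y i)) =
  \det (\matrix_(l, i) \prod_(j | j != i) P (x l * y j)).
Proof.
move=> nz; pose C : 'M[F]_m := \matrix_(i, l) (P (x l * y i))^-1.
have -> : \matrix_(i, l) \prod_(j | j != l) P (x j * y i)
    = \matrix_(i, l) (\prod_j P (x j * y i) * 1 * C i l).
  by apply/matrixP => i l; rewrite !mxE mulr1 [in RHS](bigD1 l) //= [RHS]mulrC mulKf.
have -> : \matrix_(l, i) \prod_(j | j != i) P (x l * y j)
    = \matrix_(l, i) (\prod_j P (x l * y j) * 1 * C^T l i).
  by apply/matrixP => l i; rewrite !mxE mulr1 [in RHS](bigD1 i) //= [RHS]mulrC mulKf.
by rewrite !det_scale_rc det_tr exchange_big.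
Qed.

(** Evaluating at the points 1 / x_i gives a diagonal matrix with nonzero diagonal. *)
Lemma omit_mx_neq0 x : injective x -> (forall j, x j != 0) -> \det (omit_mx x) != 0.
Proof.
move=> injx x0; apply/eqP => d0.
have : \det (\matrix_(i, l) (omit x l).[(x i)^-1]) != 0.
  rewrite det_trig; last first.
    apply/is_trig_mxP => i l ltil; rewrite mxE omit_horner (bigD1 i) /=.
      by rewrite divff // subrr mul0r.
    by rewrite -val_eqE neq_ltn ltil.
  apply/prodf_neq0 => l _; rewrite mxE omit_horner; apply/prodf_neq0 => j njl.
  rewrite subr_eq0 eq_sym; apply: contra njl => /eqP e; apply/eqP/injx.
  by rewrite -[x l]mul1r -e divfK.
by rewrite -(vdm_omit x (fun i => (x i)^-1)) det_mulmx d0 mulr0 eqxx.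
Qed.

(* Multiplying both kernel matrices by [omit_mx] makes them Cauchy-like, and such
   determinants are symmetric under transposition ([omit_exchange]). *)
Lemma kern_sym_field x y : injective x -> (forall j, x j != 0) ->
  (forall i j, 1 - x j * y i != 0) -> (forall i j, 1 - t * (x j * y i) != 0) ->
  \det (vdm x) * \det (kern_mx t (-1) x y) =
  (\prod_j x j) * (\prod_i y i) * \det (vdm y) * \det (kern_mx t (- t) y x).
Proof.
move=> injx x0 nz1 nzt; apply: (mulIf (omit_mx_neq0 injx x0)).
rewrite /= -[LHS]mulrA -det_mulmx.
pose P z := (1 - z) * (1 - t * z).
have -> : kern_mx t (-1) x y *m omit_mx x = \matrix_(i, l) (((1 - t) * y i) * x l *
    (\matrix_(i, l) \prod_(j | j != l) P (x j * y i)) i l).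
  apply/matrixP => i l; rewrite kern_omit !mxE big_split /= !omit_horner.
  rewrite [X in _ * X * _](eq_bigr (fun j => 1 - t * (x j * y i))); last first.
    by move=> j _; rewrite mulrCA.
  by move: (\prod_(j | _) _) (\prod_(j | _) _) => P1 P2; ring.
(* The exchange for P z = 1 - z moves the unwanted determinant of [omit_mx x] to [omit_mx y], which
   is what the other kernel matrix needs. *)
have e1 : \det (vdm y) * \det (omit_mx x) = \det (vdm x) * \det (omit_mx y).
  rewrite -!det_mulmx !vdm_omit.
  transitivity (\det (\matrix_(i, l) \prod_(j | j != l) (1 - x j * y i))).
    by congr (\det _); apply/matrixP => i l; rewrite !mxE omit_horner.
  rewrite (omit_exchange (P := fun z => 1 - z)) //.
  congr (\det _); apply/matrixP => i l; rewrite !mxE omit_horner.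
  by apply: eq_bigr => j _; rewrite mulrC.
have -> : (\prod_j x j) * (\prod_i y i) * \det (vdm y) * \det (kern_mx t (- t) y x)
    * \det (omit_mx x) = (\prod_j x j) * (\prod_i y i) * (\det (vdm y) * \det (omit_mx x))
    * \det (kern_mx t (- t) y x) by ring.
rewrite e1 -!mulrA [\det (omit_mx y) * _]mulrC -(det_mulmx (kern_mx t (- t) y x)).
have -> : kern_mx t (- t) y x *m omit_mx y = \matrix_(l, i) ((1 - t) * 1 *
    (\matrix_(l, i) \prod_(j | j != i) P (x l * y j)) l i).
  apply/matrixP => l i; rewrite kern_omit !mxE big_split /= !omit_horner.
  rewrite [X in X * _ * _](eq_bigr (fun j => 1 - x l * y j)); last first.
    by move=> j _; rewrite mulrC.
  rewrite [X in _ * X * _](eq_bigr (fun j => 1 - t * (x l * y j))); last first.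
    by move=> j _; rewrite mulrC -mulrA.
  by move: (\prod_(j | _) _) (\prod_(j | _) _) => P1 P2; ring.
rewrite !det_scale_rc (omit_exchange (P := P)); last by move=> i j; rewrite mulf_neq0.
rewrite big_split /= big1_eq; move: (\det _) (\prod_i y i) => d py.
by move: (\det _) (\prod_j x j) (\prod_i _) => dx px pt; ring.
Qed.

End CauchyKernelField.

Lemma map_vdm (R S : comNzRingType) (f : {rmorphism R -> S}) m (x : 'I_m -> R) :
  map_mx f (vdm x) = vdm (f \o x).
Proof. by apply/matrixP => i k; rewrite !mxE rmorphXn. Qed.

Lemma map_kern_mx (R S : comNzRingType) (f : {rmorphism R -> S}) m (t u : R) (x y : 'I_m -> R) :
  map_mx f (kern_mx t u x y) = kern_mx (f t) (f u) (f \o x) (f \o y).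
Proof.
apply/matrixP => i k; rewrite !mxE rmorphM rmorphD !rmorphM !rmorph_prod !rmorphXn.
by congr (_ * (_ + _ * _)); apply: eq_bigr => j _; rewrite rmorphB rmorph1 !rmorphM.
Qed.

Lemma kern_sym (R : idomainType) m (t : R) (x y : 'I_m -> R) :
  injective x -> (forall j, x j != 0) ->
  (forall i j, 1 - x j * y i != 0) -> (forall i j, 1 - t * (x j * y i) != 0) ->
  \det (vdm x) * \det (kern_mx t (-1) x y) =
  (\prod_j x j) * (\prod_i y i) * \det (vdm y) * \det (kern_mx t (- t) y x).
Proof.
move=> injx x0 nz1 nzt; pose f : {rmorphism R -> {fraction R}} := @FracField.tofrac R.
have f_inj : injective f.
  by move=> a b /eqP; rewrite /f tofrac_eq => /eqP.
have f0 a : (f a == 0) = (a == 0) by rewrite -(rmorph0 f) (inj_eq f_inj).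
apply: (f_inj); rewrite !rmorphM !rmorph_prod -!det_map_mx !map_vdm !map_kern_mx.
rewrite !rmorphN !rmorph1; apply: kern_sym_field.
- exact: (inj_comp f_inj injx).
- by move=> j; rewrite /= f0.
- by move=> i j; rewrite /= -rmorphM -(rmorph1 f) -rmorphB f0.
by move=> i j; rewrite /= -!rmorphM -(rmorph1 f) -rmorphB f0.
Qed.

Lemma signZ (R : nzRingType) (A : lalgType R) (b : bool) (x : A) :
  (-1) ^+ b * x = (-1) ^+ b *: x.
Proof. by case: b; rewrite ?mulN1r ?scaleN1r ?mul1r ?scale1r. Qed.

(** * Alternants and q-difference operators *)

Section SubstituteVariable.
Variables (P : comNzRingType) (m : nat).

Definition zsub (i : 'I_m) (F : {poly P}) : {mpoly P[m]} :=
  (map_poly (@mpolyC m P) F).['X_i].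

Lemma zsubM i F G : zsub i (F * G) = zsub i F * zsub i G.
Proof. by rewrite /zsub rmorphM hornerM. Qed.

Lemma zsubD i F G : zsub i (F + G) = zsub i F + zsub i G.
Proof. by rewrite /zsub rmorphD hornerD. Qed.

Lemma zsubZ i c F : zsub i (c *: F) = c%:MP * zsub i F.
Proof. by rewrite /zsub map_polyZ hornerZ. Qed.

Lemma zsub1 i : zsub i 1 = 1.
Proof. by rewrite /zsub rmorph1 hornerC. Qed.

Lemma zsubX i : zsub i 'X = 'X_i.
Proof. by rewrite /zsub map_polyX hornerX. Qed.

Lemma zsubXn i n : zsub i 'X^n = 'X_i ^+ n.
Proof. by rewrite /zsub map_polyXn hornerXn. Qed.

Lemma zsub_prod i (I : finType) (F : I -> {poly P}) :
  zsub i (\prod_j F j) = \prod_j zsub i (F j).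
Proof. exact: (big_morph (zsub i) (zsubM i) (zsub1 i)). Qed.

Lemma zsub_linear i c : zsub i (1 - c *: 'X) = 1 - c%:MP * 'X_i.
Proof. by rewrite -scaleNr zsubD zsub1 zsubZ zsubX mpolyCN mulNr. Qed.

Lemma zsub_wide i (F : {poly P}) M : (size F <= M)%N ->
  zsub i F = \sum_(k < M) F`_k *: 'X_i ^+ k.
Proof.
move=> le; rewrite /zsub (@horner_coef_wide _ M); last first.
  by apply: leq_trans le; apply: size_poly.
by apply: eq_bigr => k _; rewrite coef_map mul_mpolyC.
Qed.

(** Each factor involves only its own variable, so exactly one choice of terms reaches the exponent
    b. *)
Lemma mcoeff_prod_zsub (F : 'I_m -> {poly P}) (b : 'X_{1..m}) :
  (\prod_i zsub i (F i))@_b = \prod_i (F i)`_(b i).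
Proof.
pose M := (\max_i (maxn (size (F i)) (b i).+1))%N.
have leM i : (size (F i) <= M)%N /\ (b i < M)%N.
  have := leq_bigmax (F := fun i => maxn (size (F i)) (b i).+1) i.
  by rewrite -/M geq_max => /andP.
rewrite (eq_bigr (fun i => \sum_(k < M) (F i)`_k *: 'X_i ^+ k)); last first.
  by move=> i _; apply: zsub_wide; case: (leM i).
rewrite (bigA_distr_bigA (fun i (k : 'I_M) => (F i)`_k *: ('X_i ^+ k : {mpoly P[m]}))).
pose f0 : {ffun 'I_m -> 'I_M} := [ffun i => Ordinal (leM i).2].
have term (f : {ffun 'I_m -> 'I_M}) : \prod_i ((F i)`_(f i) *: 'X_i ^+ f i)
    = (\prod_i (F i)`_(f i)) *: 'X_[P, [multinom (f i : nat) | i < m]].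
  rewrite scaler_prod; congr (_ *: _); rewrite mpolyXE_id.
  by apply: eq_bigr => i _; rewrite mnmE.
rewrite raddf_sum /= (bigD1 f0) //= [X in _ + X]big1 ?addr0 => [|f nf].
  rewrite (term f0) mcoeffZ mcoeffX; have -> : [multinom (f0 i : nat) | i < m] = b.
    by apply/mnmP => i; rewrite mnmE ffunE.
  by rewrite eqxx mulr1; apply: eq_bigr => i _; rewrite ffunE.
rewrite (term f) mcoeffZ mcoeffX; case: eqP => [e|_]; last by rewrite mulr0.
case/eqP: nf; apply/ffunP => i; apply: val_inj.
by rewrite ffunE /= -e mnmE.
Qed.

Lemma mcoeff_det_zsub (F : 'I_m -> {poly P}) (b : 'X_{1..m}) :
  (\det (\matrix_(i, k) zsub i (F k)))@_b = \det (\matrix_(i, k) (F k)`_(b i)).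
Proof.
rewrite /determinant raddf_sum; apply: eq_bigr => w _ /=.
rewrite signZ mcoeffZ; congr (_ * _); under eq_bigr do rewrite mxE.
by rewrite mcoeff_prod_zsub; apply: eq_bigr => i _; rewrite mxE.
Qed.

End SubstituteVariable.

Section Alternants.
Variables (K : fieldType) (q t : K) (m : nat).
Implicit Types (u : K) (b : 'X_{1..m}).

Definition wdl (w : 'S_m) : 'X_{1..m} := [multinom dl (w i) | i < m].

(* With delta = (m-1, ..., 1, 0), [alt q t u f b] is the coefficient of z^b in
   det (z_i^(delta_k) (1 + u t^(delta_k) T_i)) applied to the series sum_a f(a) z^a,
   where T_i is the q-shift z_i -> q z_i. *)
Definition alt (B : lmodType K) u (f : 'X_{1..m} -> B) b : B :=
  \sum_(w : 'S_m) ((-1) ^+ w * \prod_i (1 + u * t ^+ dl (w i) * q ^+ (b i - dl (w i))))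
     *: (if (wdl w <= b)%MM then f (b - wdl w)%MM else 0).

Lemma alt_sum (B : lmodType K) u (I : Type) (r : seq I) (p : pred I)
    (c : I -> 'X_{1..m} -> K) (h : I -> B) b :
  alt u (fun a => \sum_(i <- r | p i) c i a *: h i) b =
  \sum_(i <- r | p i) (alt u (c i : _ -> K^o) b) *: h i.
Proof.
rewrite /alt; under [RHS]eq_bigr do rewrite scaler_suml.
rewrite exchange_big; apply: eq_bigr => w _ /=; case: ifP => _.
  by rewrite scaler_sumr; apply: eq_bigr => i _; rewrite scalerA.
by rewrite scaler0 big1 // => i _; rewrite scaler0 scale0r.
Qed.

Lemma eq_alt (B : lmodType K) u (f g : 'X_{1..m} -> B) b :
  (forall w, (wdl w <= b)%MM -> f (b - wdl w)%MM = g (b - wdl w)%MM) ->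
  alt u f b = alt u g b.
Proof.
move=> e; apply: eq_bigr => w _; congr (_ *: _).
by case: ifP => // /e.
Qed.

Lemma alt_linear_map (B C : lmodType K) (h : B -> C) (h_lin : linear h) u
    (f : 'X_{1..m} -> B) b : h (alt u f b) = alt u (fun a => h (f a)) b.
Proof.
have h0 : h 0 = 0 by have := h_lin (-1) 0 0; rewrite scaler0 addr0 scaleN1r addNr.
rewrite /alt (big_morph h (id1 := 0) (op1 := +%R)) //; last first.
  by move=> x y; rewrite -[x]scale1r h_lin !scale1r.
apply: eq_bigr => w _; rewrite -[X in h X]addr0 h_lin h0 addr0; congr (_ *: _).
by case: ifP.
Qed.

(** On a family of products, the sum over w is a Leibniz expansion: the condition [wdl w <= b]
    splits into one condition per entry, and a failing entry is 0. *)
Lemma alt_det (B : comAlgType K) u (g : nat -> B) b :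
  alt u (fun a => \prod_i g (a i)) b = \det (\matrix_(i < m, k < m)
    if (dl k <= b i)%N then (1 + u * t ^+ dl k * q ^+ (b i - dl k)) *: g (b i - dl k)%N
    else 0).
Proof.
rewrite /alt /determinant; apply: eq_bigr => w _; rewrite -scalerA.
rewrite -signZ; congr (_ * _); under [RHS]eq_bigr do rewrite mxE.
case: ifP => [/mnm_lepP le|/negbT nle].
  rewrite -scaler_prod; apply: eq_bigr => i _; have := le i; rewrite mnmE => ->.
  by rewrite mnmBE mnmE.
have [i ni] : exists i, ~~ (dl (w i) <= b i)%N.
  apply/existsP; rewrite -negb_forall; apply: contra nle => /forallP le.
  by apply/mnm_lepP => i; rewrite mnmE.
by rewrite scaler0 (bigD1 i) //= (negbTE ni) mul0r.
Qed.

Definition dilate (I : {set 'I_m}) : {mpoly K[m]} -> {mpoly K[m]} :=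
  mmap (@mpolyC m K) (fun j => (if j \in I then q else 1) *: 'X_j).

HB.instance Definition _ I := GRing.RMorphism.copy (dilate I)
  (mmap (@mpolyC m K) (fun j => (if j \in I then q else 1) *: 'X_j)).

Lemma dilateZ I c f : dilate I (c *: f) = c *: dilate I f.
Proof. by rewrite -mul_mpolyC rmorphM /= {1}/dilate mmapC mul_mpolyC. Qed.

Lemma dilateU I j : dilate I 'X_j = (if j \in I then q else 1) *: 'X_j.
Proof. by rewrite /dilate mmapX mmap1U. Qed.

Lemma mcoeff_dilate I f a : (dilate I f)@_a = (\prod_(j in I) q ^+ a j) * f@_a.
Proof.
rewrite {1}[f]mpolyE rmorph_sum raddf_sum [f in RHS]mpolyE raddf_sum /= mulr_sumr.
apply: eq_bigr => b _; rewrite dilateZ !mcoeffZ /dilate mmapX /mmap1.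
rewrite (eq_bigr (fun i => (if i \in I then q ^+ b i else 1) *: 'X_i ^+ b i)); last first.
  by move=> i _; rewrite exprZn; case: ifP; rewrite ?expr1n.
rewrite scaler_prod -mpolyXE_id mcoeffZ mcoeffX -big_mkcond mulrCA.
by case: eqP => [->|] //; rewrite !mulr0.
Qed.

(** The Vandermonde determinant times Macdonald's operator D(u; q, t), with the product of the 1 + u
    t^(delta_(w j)) T_j expanded over subsets I; [dilate I] is the product of the T_j for j in I. *)
Definition altP u (f : {mpoly K[m]}) : {mpoly K[m]} :=
  \sum_(w : 'S_m) (-1) ^+ w * ('X_[wdl w] *
    \sum_(I : {set 'I_m}) (\prod_(j in I) (u * t ^+ dl (w j))) *: dilate I f).

Lemma mcoeff_altP u f b : (altP u f)@_b = alt u (fun a => f@_a : K^o) b.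
Proof.
rewrite /altP raddf_sum; apply: eq_bigr => w _ /=.
rewrite signZ mcoeffZ mcoeffXM -scalerA; congr (_ * _).
case: ifP => // le; last by rewrite scaler0.
rewrite raddf_sum /=; under eq_bigr do rewrite mcoeffZ mcoeff_dilate mulrA.
rewrite -mulr_suml; congr (_ * _).
under [RHS]eq_bigr do rewrite addrC.
rewrite bigA_distr; apply: eq_bigr => I _.
rewrite -big_split /= big_mkcond; apply: eq_bigr => j _.
by case: ifP => // _; rewrite mnmBE mnmE.
Qed.

End Alternants.

Lemma mcoeff_mulX (B : comNzRingType) N (p : {mpoly B[N]}) (a b : 'X_{1..N}) :
  ('X_[a] * p)@_b = if (a <= b)%MM then p@_(b - a) else 0.
Proof.
rewrite mulrC; case: ifP => [le | nle].
  by rewrite -{1}(submK le) addmC mcoeffMX.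
rewrite mcoeffM big1 // => -[c d] /= /eqP e.
rewrite mcoeffX; case: eqP => e2; last by rewrite mulr0.
have : (a <= b)%MM.
  by rewrite e e2; apply/mnm_lepP => i; rewrite mnmDE leq_addl.
by rewrite nle.
Qed.

Lemma mpoly_one_sub_neq0 (Q : idomainType) m (c : Q) (i : 'I_m) :
  1 - c%:MP * 'X_i != 0 :> {mpoly Q[m]}.
Proof.
apply/eqP => /(congr1 (mcoeff 0%MM)); rewrite mcoeffB mcoeff1 mcoeffCM mcoeffX mcoeff0.
by rewrite mnm1_eq0 eqxx mulr0 subr0 => /eqP; rewrite oner_eq0.
Qed.

Lemma kern_sym_mpoly (Q : idomainType) m (t : Q) (x : 'I_m -> Q) :
  injective x -> (forall j, x j != 0) ->
  let xs j : {mpoly Q[m]} := (x j)%:MP in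
  let zs i : {mpoly Q[m]} := 'X_i in
  \det (vdm xs) * \det (kern_mx t%:MP (-1) xs zs) =
  (\prod_j xs j) * (\prod_i zs i) * \det (vdm zs) * \det (kern_mx t%:MP (- t%:MP) zs xs).
Proof.
move=> xinj x0 xs zs.
apply: kern_sym.
- by move=> i j /(can_inj (@mpolyCK m Q)); apply: xinj.
- by move=> j; rewrite mpolyC_eq0.
- by move=> i j; apply: mpoly_one_sub_neq0.
by move=> i j; rewrite mulrA -rmorphM; apply: mpoly_one_sub_neq0.
Qed.

Section NewtonProducts.
Variable B : comNzRingType.

Lemma newton_eq (a phi psi : nat -> B) : phi =1 psi -> newton a phi -> newton a psi.
Proof.
move=> e [p0 pS]; split=> [|n]; first by rewrite -e.
by rewrite -e pS; apply: eq_bigr => i _; rewrite e.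
Qed.

Lemma newton_prod_linear (I : Type) (r : seq I) (c : I -> B) :
  newton (fun k => - \sum_(j <- r) c j ^+ k)
         (fun n => (\prod_(j <- r) (1 - c j *: 'X : {poly B}))`_n).
Proof.
elim: r => [|i r IH].
  split=> [|n]; first by rewrite big_nil coef1.
  rewrite big_nil coef1 big1 => [|j _]; last by rewrite big_nil oppr0 mul0r.
  by case: n => [|n]; rewrite ?mul0r ?mulr0.
apply: (newton_ext (a := fun k => - c i ^+ k + - \sum_(j <- r) c j ^+ k)).
  by move=> n; rewrite big_cons opprD.
apply: (newton_eq _ (newton_conv (newton_linear (c i)) IH)) => n.
by rewrite big_cons coefM.
Qed.

End NewtonProducts.

(** * The kernel identity for series in x and z *)

Section ThetaKernel.
Variables (K : fieldType) (q t : K) (m : nat).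
Hypothesis char0 : forall n, n.+1%:R != 0 :> K.
Hypothesis q_neq1 : forall n, 1 - q ^+ n.+1 != 0.
Local Notation P := {mpoly K[m]}.

Definition xp N k : {mpoly K[N]} := \sum_j 'X_j ^+ k.

Lemma mpoly_nat_reg N n : GRing.lreg (n.+1%:R : {mpoly K[N]}).
Proof. exact: lreg_nat. Qed.

Lemma ev_gs_newton (q' t' : K) N :
  newton (fun k => ((1 - q' ^+ k)^-1 * (1 - t' ^+ k)) *: xp N k) (fun n => ev t' N (gs q' n)).
Proof.
have [g0 gS] := gs_newton q' char0; split=> [|n]; first by rewrite g0 ev1.
rewrite mulr_natl -scaler_nat -evZ scaler_nat -mulr_natl gS.
rewrite (big_morph (ev t' N) (@evD K t' N) (@ev0 K t' N)); apply: eq_bigr => i _.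
by rewrite evM evZ ev_psum scalerA.
Qed.

Definition of_mdeg N d (f : {mpoly K[N]}) := forall a, f@_a != 0 -> mdeg a = d.

Lemma of_mdegM N d e f g : @of_mdeg N d f -> of_mdeg e g -> of_mdeg (d + e) (f * g).
Proof.
move=> hf hg a; apply: contra_neq_eq => ne; rewrite mcoeffM big1 // => -[b c] /= /eqP e'.
have [->|/hf fb] := eqVneq f@_b 0; first by rewrite mul0r.
have [->|/hg gc] := eqVneq g@_c 0; first by rewrite mulr0.
by case/eqP: ne; rewrite e' mdegD fb gc.
Qed.

Lemma of_mdegZ N d c f : @of_mdeg N d f -> of_mdeg d (c *: f).
Proof. by move=> hf a; rewrite mcoeffZ mulf_eq0 negb_or => /andP[_ /hf]. Qed.

Lemma of_mdeg_sum N d (I : Type) (r : seq I) (p : pred I) (f : I -> {mpoly K[N]}) :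
  (forall i, p i -> of_mdeg d (f i)) -> of_mdeg d (\sum_(i <- r | p i) f i).
Proof.
move=> hf; apply: big_ind => // [a|f1 f2 h1 h2 a]; first by rewrite mcoeff0 eqxx.
rewrite mcoeffD; have [->|/h1 //] := eqVneq f1@_a 0; rewrite add0r; exact: h2.
Qed.

Lemma of_mdeg_prod N (I : Type) (r : seq I) (d : I -> nat) (f : I -> {mpoly K[N]}) :
  (forall i, of_mdeg (d i) (f i)) -> of_mdeg (\sum_(i <- r) d i) (\prod_(i <- r) f i).
Proof.
move=> hf; elim: r => [|i r IH]; last by rewrite !big_cons; apply: of_mdegM.
by move=> a; rewrite !big_nil mcoeff1; case: (eqVneq a 0%MM) => [->|]; rewrite ?mdeg0 ?eqxx.
Qed.

Lemma of_mdeg_ev_gs q' t' N n : of_mdeg n (ev t' N (gs q' n)).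
Proof.
have [g0 gS] := ev_gs_newton q' t' N; elim/ltn_ind: n => -[|n] IH.
  by move=> a; rewrite g0 mcoeff1; case: (eqVneq a 0%MM) => [->|]; rewrite ?mdeg0 ?eqxx.
have -> : ev t' N (gs q' n.+1) = n.+1%:R^-1 *: (n.+1%:R * ev t' N (gs q' n.+1)).
  by rewrite mulr_natl -scaler_nat scalerA mulVf // scale1r.
rewrite gS; apply: of_mdegZ; apply: of_mdeg_sum => i _; rewrite -scalerAl; apply: of_mdegZ.
have := @of_mdegM N i.+1 (n.+1 - i.+1) (xp N i.+1) (ev t' N (gs q' (n.+1 - i.+1)%N)).
rewrite subnKC //; apply; last by apply: IH; rewrite subSS ltnS leq_subr.
apply: of_mdeg_sum => j _ a; rewrite mpolyXn mcoeffX; case: (eqVneq (U_(j) *+ i.+1)%MM a) => [<- _|]; rewrite ?eqxx //.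
by rewrite mdegMn mdeg1 mul1n.
Qed.

Let gam n : P := ev t m (gs q n).

(** The Cauchy kernel divided by prod_j (1 - t x_j z), that is, prod_j (t q x_j z; q)_oo / (x_j z;
    q)_oo. Polynomial multiples of this one series give the kernel and all its q-dilations in x, as
    [factors_phi] shows, which reduces the identity to polynomials. *)
Let phi : nat -> P := conv gam (fun n => t%:MP ^+ n * ev 0 m (gs 0 n)).

Let phi_newton : newton (fun k => ((1 - q ^+ k)^-1 * (1 - t ^+ k) + t ^+ k) *: xp m k) phi.
Proof.
apply: newton_ext (newton_conv (ev_gs_newton q t m) (newton_scale t%:MP (ev_gs_newton 0 0 m))).
move=> n; rewrite expr0n subr0 invr1 mulr1 scale1r -rmorphXn mul_mpolyC.
by rewrite -scalerDl.
Qed.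

Let factors (I : {set 'I_m}) : {poly P} :=
  \prod_j (1 - ((if j \in I then 1 else t) *: 'X_j) *: 'X).

(* (1-t^k) x^k / (1-q^k) - x^k + t^k x^k = q^k (1-t^k) x^k / (1-q^k) *)
Let factors_phi I n : conv (fun i => (factors I)`_i) phi n = dilate q I (gam n).
Proof.
move: n; apply: (newton_uniq (@mpoly_nat_reg m)
  (a := fun k => ((1 - q ^+ k)^-1 * (1 - t ^+ k)) *: dilate q I (xp m k))); last first.
  apply: newton_ext (newton_morph (dilate q I) (ev_gs_newton q t m)) => k /=.
  by rewrite dilateZ.
apply: newton_ext (newton_conv (newton_prod_linear _ _) phi_newton) => k.
rewrite rmorph_sum /= !scaler_sumr -sumrN -big_split; apply: eq_bigr => j _ /=.
rewrite rmorphXn /= dilateU !exprZn !scalerA -scaleNr -scalerDl; congr (_ *: _).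
case: ifP => _; rewrite ?expr1n; last by ring.
by have := q_neq1 k; move: (q ^+ _) (t ^+ _) => x y nz; field.
Qed.

Let dilate0 f : dilate q (set0 : {set 'I_m}) f = f.
Proof. by apply/mpolyP => a; rewrite mcoeff_dilate big_set0 mul1r. Qed.

(** [gam n] is homogeneous of degree n, so dilating every x_j amounts to the q-shift of z. *)
Let dilateT n : dilate q [set: 'I_m] (gam n) = q ^+ n *: gam n.
Proof.
apply/mpolyP => a; rewrite mcoeff_dilate mcoeffZ.
have [->|/of_mdeg_ev_gs <-] := eqVneq (gam n)@_a 0; first by rewrite !mulr0.
rewrite mdegE prodrXr; congr (q ^+ _ * _); by apply: eq_bigl => i; rewrite inE.
Qed.

Local Notation MP := (@mpolyC m P).
Let xs (j : 'I_m) : {mpoly P[m]} := MP 'X_j.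
Let zs (i : 'I_m) : {mpoly P[m]} := 'X_i.
Let tt : {mpoly P[m]} := MP t%:MP.

Let zsub_factors i I :
  zsub i (factors I) = \prod_j (1 - (if j \in I then 1 else tt) * xs j * zs i).
Proof.
rewrite /factors zsub_prod; apply: eq_bigr => j _; rewrite zsub_linear; congr (1 - _ * _).
by case: ifP => _; rewrite ?scale1r ?mul1r // -mul_mpolyC rmorphM.
Qed.

Let Phi N : {poly P} := \poly_(n < N) phi n.
Let Phis N : {mpoly P[m]} := \prod_i zsub i (Phi N).

Let factors_Phi N (b : 'X_{1..m}) I (k i : 'I_m) : (b i < N)%N -> (dl k <= b i)%N ->
  ('X^(dl k) * (factors I * Phi N))`_(b i) = dilate q I (gam (b i - dl k)).
Proof.
move=> lt le; rewrite coefXnM ltnNge le /= -factors_phi (conv_poly _ _ (N := N)) //.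
by apply: leq_ltn_trans lt; apply: leq_subr.
Qed.

Let det_zsub_Phi N (F : 'I_m -> {poly P}) :
  \det (\matrix_(i, k) zsub i (F k * Phi N)) = Phis N * \det (\matrix_(i, k) zsub i (F k)).
Proof.
rewrite (_ : \matrix_(i, k) _ = \matrix_(i, k) (zsub i (Phi N) * 1 * (\matrix_(i, k) zsub i (F k)) i k)).
  by rewrite det_scale_rc big1_eq mulr1.
by apply/matrixP => i k; rewrite !mxE mulr1 zsubM mulrC.
Qed.

(** The q-shift of z_i dilates all the x_j, so both halves of every entry in row i contain Phi(z_i),
    which leaves the determinant. [N] exceeds the exponents in b, so that truncating Phi is
    harmless. *)
Let ev_alt_det N (b : 'X_{1..m}) u : (forall i, (b i < N)%N) ->
  ev t m (alt q t u (fun a => \prod_i gs q (a i)) b) =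
  (Phis N * \det (kern_mx tt (MP u%:MP) xs zs))@_b.
Proof.
move=> b_lt; rewrite (alt_linear_map q t (@ev_linear K t m)).
have evp a : ev t m (\prod_(i < m) gs q (a i)) = \prod_i gam (a i).
  exact: (big_morph (ev t m) (@evM K t m) (@ev1 K t m)).
rewrite (@eq_alt K q t m _ u _ (fun a => \prod_i gam (a i))); last by move=> w _; apply: evp.
rewrite alt_det; pose F (k : 'I_m) := 'X^(dl k) * (factors set0 + (u * t ^+ dl k)%:MP *: factors setT).
transitivity (\det (\matrix_(i < m, k < m) (F k * Phi N)`_(b i))).
  congr (\det _); apply/matrixP => i k; rewrite !mxE /F -['X^_ * _ * _]mulrA mulrDl mulrDr -scalerAl -scalerAr.
  rewrite coefD coefZ; case: ifP => [le|/negbT nle]; last first.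
    by rewrite !coefXnM ltnNge nle mulr0 addr0.
  by rewrite !factors_Phi // dilate0 dilateT mul_mpolyC scalerA -{2}[gam _]scale1r -scalerDl.
rewrite -mcoeff_det_zsub det_zsub_Phi; congr ((_ * \det _)@_b).
have eD i : zsub i (factors set0) = \prod_j (1 - tt * xs j * zs i).
  by rewrite zsub_factors; apply: eq_bigr => j _; rewrite inE.
have eN i : zsub i (factors setT) = \prod_j (1 - xs j * zs i).
  by rewrite zsub_factors; apply: eq_bigr => j _; rewrite inE mul1r.
have ec (k : 'I_m) : MP (u * t ^+ dl k)%:MP = MP u%:MP * tt ^+ dl k.
  by rewrite /tt !rmorphM !rmorphXn.
by apply/matrixP => i k; rewrite !mxE /F zsubM zsubXn zsubD zsubZ eD eN ec.
Qed.

Let dilate_ev_alt0 N (b : 'X_{1..m}) I : (forall i, (b i < N)%N) ->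
  dilate q I (ev t m (alt q t 0 (fun a => \prod_i gs q (a i)) b)) =
  (Phis N * \det (vdm zs) * \prod_i zsub i (factors I))@_b.
Proof.
move=> b_lt; have lin : linear (dilate q I \o ev t m).
  by move=> c f g /=; rewrite ev_linear rmorphD /= dilateZ.
rewrite -[LHS]/((dilate q I \o ev t m) _) (alt_linear_map q t lin) /=.
have evp a : dilate q I (ev t m (\prod_(i < m) gs q (a i))) = \prod_i dilate q I (gam (a i)).
  by rewrite (big_morph (ev t m) (@evM K t m) (@ev1 K t m)) rmorph_prod.
rewrite (@eq_alt K q t m _ 0 _ (fun a => \prod_i dilate q I (gam (a i)))); last by move=> w _; apply: evp.
rewrite (alt_det q t 0 (fun n => dilate q I (gam n)) b).
pose F (k : 'I_m) : {poly P} := 'X^(dl k) * factors I.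
transitivity (\det (\matrix_(i < m, k < m) (F k * Phi N)`_(b i))).
  congr (\det _); apply/matrixP => i k; rewrite !mxE /F -['X^_ * _ * _]mulrA.
  case: ifP => [le|/negbT nle]; last by rewrite coefXnM ltnNge nle.
  by rewrite factors_Phi // !mul0r addr0 scale1r.
rewrite -mcoeff_det_zsub det_zsub_Phi -mulrA; congr ((_ * _)@_b).
rewrite mulrC (_ : \matrix_(i, k) _ = \matrix_(i, k) (zsub i (factors I) * 1 * vdm zs i k)).
  by rewrite det_scale_rc big1_eq mulr1.
by apply/matrixP => i k; rewrite !mxE mulr1 /F zsubM zsubXn mulrC.
Qed.

(** Here the difference operator acts in x. Dilating the x_j with j in I changes the kernels of all
    the z_i at once, by [factors I]; the sum over w and I is then the expansion of the kernel
    determinant with x and z exchanged. *)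
Let altP_ev_alt0 N (b : 'X_{1..m}) u : (forall i, (b i < N)%N) ->
  altP q t u (ev t m (alt q t 0 (fun a => \prod_i gs q (a i)) b)) =
  (Phis N * \det (vdm zs) * \det (kern_mx tt (MP u%:MP) zs xs))@_b.
Proof.
move=> b_lt; set Q := Phis N * _; have detE : \det (kern_mx tt (MP u%:MP) zs xs) =
    \sum_(w : 'S_m) MP ((-1) ^+ w * 'X_[wdl w]) * \sum_(I : {set 'I_m})
      MP (\prod_(j in I) (u * t ^+ dl (w j)))%:MP * \prod_i zsub i (factors I).
  apply: eq_bigr => w _; rewrite rmorphM rmorph_sign /= -mulrA; congr (_ * _).
  under eq_bigr do rewrite mxE; rewrite big_split /=; congr (_ * _).
    by rewrite mpolyXE_id rmorph_prod; apply: eq_bigr => j _; rewrite mnmE rmorphXn.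
  under eq_bigr do rewrite addrC.
  rewrite bigA_distr; apply: eq_bigr => I _.
  rewrite (big_mkcond (fun j => j \in I)) /= !rmorph_prod.
  under [X in _ = _ * X]eq_bigr do rewrite zsub_factors.
  rewrite exchange_big -big_split /=; apply: eq_bigr => j _.
  case: ifP => _; rewrite ?rmorph1 ?mul1r.
    congr (_ * _); first by rewrite !rmorphM !rmorphXn.
    by apply: eq_bigr => i _; rewrite ?mul1r [zs i * _]mulrC.
  by apply: eq_bigr => i _; rewrite [tt * zs i * _]mulrAC.
rewrite detE mulr_sumr raddf_sum; apply: eq_bigr => w _ /=.
rewrite [Q * _]mulrCA mcoeffCM -mulrA; congr (_ * (_ * _)).
rewrite mulr_sumr raddf_sum; apply: eq_bigr => I _ /=.
by rewrite [Q * _]mulrCA mcoeffCM mul_mpolyC (dilate_ev_alt0 _ b_lt).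
Qed.

Definition ones : 'X_{1..m} := [multinom 1%N | i < m].

Lemma X_ones (B : comNzRingType) : \prod_i 'X_i = 'X_[ones] :> {mpoly B[m]}.
Proof. by rewrite mpolyXE_id; apply: eq_bigr => i _; rewrite mnmE expr1. Qed.

(** [kern_sym_mpoly] multiplied by the common series [Phis] and read at z^b. The product of the x_j
    becomes ['X_[ones]]; the product of the z_i shifts b by [ones] and leaves nothing when some b_i
    is 0. *)
Lemma theta_kernel b :
  \det (vdm (fun j => 'X_j : P)) * ev t m (alt q t (-1) (fun a => \prod_i gs q (a i)) b) =
  if (ones <= b)%MM then
    'X_[ones] * altP q t (- t) (ev t m (alt q t 0 (fun a => \prod_i gs q (a i)) (b - ones)%MM))
  else 0.
Proof.
pose N := (\max_i (b i)).+1.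
have b_lt i : (b i < N)%N by rewrite ltnS (leq_bigmax (F := fun i => b i)).
have b'_lt i : ((b - ones)%MM i < N)%N by rewrite mnmBE (leq_ltn_trans (leq_subr _ _)).
have xinj : injective (fun j : 'I_m => 'X_j : P).
  move=> i j /(congr1 (mcoeff U_(i)%MM)).
  by rewrite !mcoeffXU eqxx; case: eqP => // _ /eqP; rewrite oner_eq0.
have x0 (j : 'I_m) : 'X_j != 0 :> P.
  by apply/eqP => /(congr1 (mcoeff U_(j)%MM)) /eqP; rewrite mcoeffXU eqxx mcoeff0 oner_eq0.
have key := @kern_sym_mpoly P m t%:MP (fun j => 'X_j) xinj x0.
have mapE : MP (\det (vdm (fun j => 'X_j : P))) = \det (vdm xs).
  by rewrite -det_map_mx map_vdm.
pose L : {mpoly P[m]} := Phis N * \det (kern_mx tt (MP (-1)%:MP) xs zs).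
pose R : {mpoly P[m]} := Phis N * \det (vdm zs) * \det (kern_mx tt (MP (- t)%:MP) zs xs).
have LR : MP (\det (vdm (fun j => 'X_j : P))) * L = MP 'X_[ones] * ('X_[ones] * R).
  have ex : \prod_j xs j = MP 'X_[ones] by rewrite -X_ones rmorph_prod.
  have ez : \prod_i zs i = 'X_[ones] by exact: X_ones.
  have eN : MP (- t)%:MP = - tt by rewrite !mpolyCN.
  have e1 : MP (-1)%:MP = -1 by rewrite !mpolyCN !mpolyC1.
  have swap (B : comNzRingType) (p a c d e : B) : p * (a * c * d * e) = a * (c * (p * d * e)).
    by ring.
  rewrite mapE /L /R eN e1 mulrCA; apply: etrans (congr1 ( *%R _) key) _.
  rewrite ex ez; exact: swap.
have toL : \det (vdm (fun j => 'X_j : P)) * L@_b = 'X_[ones] * ('X_[ones] * R)@_b.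
  by rewrite -!mcoeffCM LR.
apply: etrans (congr1 ( *%R _) (ev_alt_det _ b_lt)) _.
apply: etrans toL _.
rewrite mcoeff_mulX; case: ifP => _; last exact: mulr0.
apply: (congr1 ( *%R _)); exact: (esym (altP_ev_alt0 _ b'_lt)).
Qed.

Lemma det_vdm_altP f : \det (vdm (fun j => 'X_j : P)) * f = altP q t 0 f.
Proof.
rewrite mulr_suml; apply: eq_bigr => w _; rewrite -mulrA; congr (_ * (_ * _)).
  by rewrite mpolyXE_id; apply: eq_bigr => i _; rewrite mxE mnmE.
rewrite (bigD1 set0) //= big_set0 scale1r dilate0 big1 ?addr0 // => I /set0Pn[j jI].
by rewrite (bigD1 j jI) /= !mul0r scale0r.
Qed.

Lemma theta_kernel_coeff b e :
  alt q t 0 (fun a => (ev t m (alt q t (-1) (fun a => \prod_i gs q (a i)) b))@_a : K^o) e =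
  if (ones <= b)%MM && (ones <= e)%MM then
    alt q t (- t) (fun a => (ev t m (alt q t 0 (fun a => \prod_i gs q (a i))
                              (b - ones)%MM))@_a : K^o) (e - ones)%MM
  else 0.
Proof.
rewrite -mcoeff_altP -det_vdm_altP theta_kernel; case: ifP => _ /=; last by rewrite mcoeff0.
by rewrite mcoeffXM; case: ifP => // _; rewrite mcoeff_altP.
Qed.

End ThetaKernel.

(** * Operators adding a column *)

Section Exponents.
Variable m : nat.
Implicit Types (a b l : 'X_{1..m}) (mu : seq nat).

Definition delta : 'X_{1..m} := [multinom dl i | i < m].
Definition dsum : nat := (\sum_(i < m) dl i)%N.
(** The statistic n(mu) extended to exponent vectors. *)
Definition bw a : nat := (\sum_(i < m) i * a i)%N.
Definition mnmp mu : 'X_{1..m} := [multinom nth 0%N mu i | i < m].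

Lemma bwD a b : bw (a + b)%MM = (bw a + bw b)%N.
Proof. by rewrite /bw -big_split; apply: eq_bigr => i _; rewrite mnmDE mulnDr. Qed.

Lemma bw_mnmp mu : (size mu <= m)%N -> bw (mnmp mu) = n_part mu.
Proof. by move/n_part_wide->; apply: eq_bigr => i _; rewrite mnmE. Qed.

Lemma dsumE : dsum = (\sum_(i < m) i)%N.
Proof.
rewrite /dsum (reindex_inj rev_ord_inj) /=; apply: eq_bigr => i _.
by rewrite /dl /= subnSK // subKn // ltnW.
Qed.

Lemma bw_ones : bw (ones m) = dsum.
Proof. by rewrite dsumE; apply: eq_bigr => i _; rewrite mnmE muln1. Qed.

Lemma mdeg_wdl (w : 'S_m) : mdeg (wdl w) = dsum.
Proof.
rewrite mdegE /dsum [RHS](reindex_inj (@perm_inj _ w)) /=.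
by apply: eq_bigr => i _; rewrite mnmE.
Qed.

Lemma mdeg_ones : mdeg (ones m) = m.
Proof.
by rewrite mdegE; under eq_bigr do rewrite mnmE; rewrite sum1_card card_ord.
Qed.

Lemma wdl1 : wdl 1%g = delta.
Proof. by apply/mnmP => i; rewrite !mnmE perm1. Qed.

Lemma mdeg_delta : mdeg delta = dsum.
Proof. by rewrite -wdl1 mdeg_wdl. Qed.

(** Rearrangement: [bw (wdl w)] is a constant minus the sum of the i * w i, and 2 i w(i) <= i^2 +
    w(i)^2 with equality only for w(i) = i. *)
Lemma bw_wdl (w : 'S_m) : (bw delta <= bw (wdl w))%N /\ (bw (wdl w) = bw delta -> w = 1%g).
Proof.
have dlD (i : 'I_m) : (dl i + i = m.-1)%N by rewrite /dl; have := ltn_ord i; lia.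
have sq : (\sum_(i < m) w i ^ 2 = \sum_(i < m) i ^ 2)%N.
  by rewrite [RHS](reindex_inj (@perm_inj _ w)).
have tot (v : 'S_m) : (bw (wdl v) + \sum_(i < m) i * v i = m.-1 * \sum_(i < m) i)%N.
  rewrite /bw -big_split big_distrr; apply: eq_bigr => i _.
  by rewrite /= mnmE -mulnDr dlD mulnC.
have := tot w; have := tot 1%g; rewrite wdl1.
have -> : (\sum_(i < m) i * (1%g : 'S_m) i = \sum_(i < m) i ^ 2)%N.
  by apply: eq_bigr => i _; rewrite perm1 mulnn.
have [le eqC] := @leqif_sum 'I_m xpredT _ (fun i => 2 * (i * w i))%N
  (fun i => i ^ 2 + w i ^ 2)%N (fun i _ => nat_Cauchy i (w i)).
rewrite -big_distrr big_split /= sq in le; rewrite -big_distrr big_split /= sq in eqC.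
move: (m.-1 * _)%N => c e1 e2.
move: (\sum_(i < m) i * w i)%N (\sum_(i < m) i ^ 2)%N (bw delta) (bw (wdl w)) le e1 e2 eqC.
move=> x1 x2 x3 x4 le e1 e2 eqC; split; first by lia.
move=> e; have /forallP all : [forall i : 'I_m, true ==> (i == w i :> nat)].
  by rewrite -eqC; apply/eqP; lia.
by apply/permP => i; rewrite perm1; apply/val_inj/esym/eqP; apply: (all i).
Qed.

Lemma size_add_col mu : size (add_col m mu) = m.
Proof. by rewrite size_mkseq. Qed.

Lemma mnmp_add_col mu : mnmp (add_col m mu) = (mnmp mu + ones m)%MM.
Proof. by apply/mnmP => i; rewrite mnmDE !mnmE nth_mkseq // addn1. Qed.

Lemma n_part_add_col mu : (size mu <= m)%N ->
  n_part (add_col m mu) = (n_part mu + dsum)%N.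
Proof.
move=> le; rewrite -(bw_mnmp (mu := add_col m mu)) ?size_add_col //.
by rewrite mnmp_add_col bwD bw_ones bw_mnmp.
Qed.

Lemma sumn_mnmp mu : (size mu <= m)%N -> mdeg (mnmp mu) = sumn mu.
Proof.
move=> le; rewrite mdegE sumnE (big_nth 0%N) big_mkord.
rewrite (big_ord_widen m (fun i => nth 0%N mu i) le) [RHS]big_mkcond.
by apply: eq_bigr => i _; rewrite mnmE; case: ltnP => // ge; rewrite nth_default.
Qed.

Lemma sumn_add_col mu : (size mu <= m)%N -> sumn (add_col m mu) = (sumn mu + m)%N.
Proof.
move=> le; rewrite -(sumn_mnmp (mu := add_col m mu)) ?size_add_col //.
by rewrite mnmp_add_col mdegD sumn_mnmp // mdeg_ones.
Qed.

Lemma is_part_add_col mu : is_part mu -> is_part (add_col m mu).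
Proof.
case/andP=> so n0; apply/andP; split; last by apply/mapP => -[i].
apply/(sortedP 0%N) => i; rewrite size_add_col => lt.
rewrite /geq /= !nth_mkseq ?(ltnW lt) // ltnS.
case: (ltnP i.+1 (size mu)) => lti; last by rewrite (nth_default _ lti).
by move/(sortedP 0%N): so; apply.
Qed.

Lemma mnmp_inj mu nu : is_part mu -> is_part nu -> (size mu <= m)%N -> (size nu <= m)%N ->
  mnmp mu = mnmp nu -> mu = nu.
Proof.
move=> pm pn sm sn e; apply: part_eq => // i.
case: (ltnP i m) => lt; last by rewrite !nth_default // (leq_trans _ lt).
by have := congr1 (fun a => a (Ordinal lt)) e; rewrite !mnmE.
Qed.

End Exponents.

Section ColumnKernel.
Variables (K : fieldType) (q t : K) (m : nat) (A : lmodType K).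
Variables (H : seq nat -> A) (G : 'X_{1..m} -> A) (J : seq nat -> 'X_{1..m} -> K^o).
Variable nrm : seq nat -> K.
Hypothesis m_gt0 : (0 < m)%N.
Hypothesis t_neq0 : t != 0.
Hypothesis nrm_neq0 : forall mu, is_part mu -> nrm mu != 0.
Hypothesis G_expand : forall a, G a = \sum_(mu <- parts (mdeg a)) (J mu a / nrm mu) *: H mu.
Hypothesis J_supp : forall mu a, is_part mu -> (size mu <= m)%N -> J mu a != 0 ->
  mdeg a = sumn mu /\ ((n_part mu < bw a)%N \/ a = mnmp m mu).
Hypothesis J_diag : forall mu, is_part mu -> (size mu <= m)%N -> J mu (mnmp m mu) != 0.
Hypothesis J_long : forall mu a, is_part mu -> (m < size mu)%N -> J mu a = 0.
Hypothesis kernel : forall b e,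
  \sum_(nu <- parts (mdeg b - dsum m))
     (alt q t (-1) (J nu) b / nrm nu) * alt q t 0 (J nu) e =
  if (ones m <= b)%MM && (ones m <= e)%MM then
    \sum_(mu <- parts (mdeg (b - ones m)%MM - dsum m))
       (alt q t 0 (J mu) (b - ones m)%MM / nrm mu) * alt q t (- t) (J mu) (e - ones m)%MM
  else 0.
Variable L : nat -> A -> K.
Hypothesis L_linear : forall n, linear (L n : A -> K^o).
Hypothesis L_H : forall mu, is_part mu -> L (sumn mu) (H mu) = t ^+ n_part mu.
Hypothesis L_alt : forall n b,
  L (n + m) (alt q t (-1) G (b + ones m)%MM) = t ^+ dsum m * L n (alt q t 0 G b).

Lemma alt_small (B : lmodType K) u (f : 'X_{1..m} -> B) b :
  (mdeg b < dsum m)%N -> alt q t u f b = 0.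
Proof.
move=> lt; rewrite /alt big1 // => w _; case: ifP => [le|_]; last by rewrite scaler0.
by move: lt; rewrite -(submK le) mdegD mdeg_wdl; lia.
Qed.

Lemma alt_G u b : alt q t u G b =
  \sum_(mu <- parts (mdeg b - dsum m)) (alt q t u (J mu) b / nrm mu) *: H mu.
Proof.
transitivity (alt q t u (fun a => \sum_(mu <- parts (mdeg b - dsum m)) (J mu a / nrm mu) *: H mu) b).
  (* All the b - w delta have the same degree [mdeg b - dsum m], so one list of partitions serves
     every w. *)
  apply: eq_alt => w le; rewrite G_expand; congr (\sum_(mu <- parts _) _).
  by rewrite -[X in (mdeg X - _)%N](submK le) mdegD mdeg_wdl addnK.
rewrite alt_sum; apply: eq_bigr => mu _; congr (_ *: _).
rewrite /alt mulr_suml; apply: eq_bigr => w _; rewrite /GRing.scale /= -[RHS]mulrA; congr (_ * _).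
by case: ifP => // _; exact: (esym (mul0r _)).
Qed.

(** The Vandermonde factor preserves triangularity up to the shift by delta: the exponents w delta
    with w <> 1 have larger [bw] than delta. *)
Lemma alt_J_supp u mu l : is_part mu -> (size mu <= m)%N ->
  alt q t u (J mu) (delta m + l)%MM != 0 ->
  mdeg l = sumn mu /\ ((n_part mu < bw l)%N \/ l = mnmp m mu).
Proof.
move=> pm sm nz; have [w /andP[le nzw]] : exists w : 'S_m,
    (wdl w <= delta m + l)%MM && (J mu (delta m + l - wdl w)%MM != 0).
  apply/existsP; apply: contraNT nz; rewrite negb_exists => /forallP all0.
  rewrite /alt big1 // => w _; have := all0 w; rewrite negb_and negbK.
  by case: ifP => [_ /eqP ->|_ _]; rewrite scaler0.
have [dg sup] := J_supp pm sm nzw.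
have e := submK le; have [lew eqw] := bw_wdl w.
have eb : (bw (delta m + l - wdl w)%MM + bw (wdl w) = bw (delta m) + bw l)%N.
  by rewrite -!bwD e.
split.
  have := congr1 (@mdeg m) e; rewrite !mdegD mdeg_wdl mdeg_delta dg; lia.
case: sup => [lt|ea]; first by left; lia.
move: (eb); rewrite ea bw_mnmp // => eb'.
have [lt|ge] := ltnP (bw (delta m)) (bw (wdl w)); first by left; lia.
right; have w1 : w = 1%g by apply: eqw; lia.
by rewrite -ea w1 wdl1 addmC addmK.
Qed.

Lemma alt_J_diag mu : is_part mu -> (size mu <= m)%N ->
  alt q t 0 (J mu) (delta m + mnmp m mu)%MM = J mu (mnmp m mu).
Proof.
move=> pm sm; rewrite /alt (bigD1 (1%g : 'S_m)) //= [X in _ + X]big1 => [|w nw]; last first.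
  case: ifP => [le|_]; last by rewrite scaler0.
  have [->|nz] := eqVneq (J mu (delta m + mnmp m mu - wdl w)%MM) 0; first by rewrite scaler0.
  have e := submK le; have [lew eqw] := bw_wdl w.
  have eb : (bw (delta m + mnmp m mu - wdl w)%MM + bw (wdl w) = bw (delta m) + n_part mu)%N.
    by rewrite -(bw_mnmp sm) -!bwD e.
  have [_ [lt|ea]] := J_supp pm sm nz; first by lia.
  case/eqP: nw; apply: eqw; move: eb; rewrite ea bw_mnmp //; lia.
rewrite addr0 odd_perm1 expr0 mul1r wdl1 big1 ?scale1r => [|i _]; last first.
  by rewrite !mul0r addr0.
by rewrite lem_addr addmC addmK.
Qed.

Lemma alt_J_long u mu b : is_part mu -> (m < size mu)%N -> alt q t u (J mu) b = 0.
Proof.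
move=> pm lt; rewrite /alt big1 // => w _; rewrite J_long // if_same; exact: scaler0.
Qed.

(** Triangular elimination along n(mu): at b = delta + mu, the terms other than mu vanish by
    induction or for lack of support. Vector coefficients are allowed so that the lemma also applies
    to values of operators. *)
Lemma alt_J_free (B : lmodType K) n (x : seq nat -> B) :
  (forall b, mdeg b = (n + dsum m)%N ->
     \sum_(mu <- parts n) (alt q t 0 (J mu) b : K) *: x mu = 0) ->
  forall mu, is_part mu -> sumn mu = n -> (size mu <= m)%N -> x mu = 0.
Proof.
move=> sum0 mu; move: {2}(n_part mu) (erefl (n_part mu)) => h; elim/ltn_ind: h mu.
move=> h IH mu eh pm dm sm; have := sum0 (delta m + mnmp m mu)%MM.
rewrite mdegD mdeg_delta sumn_mnmp // dm addnC => /(_ erefl).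
rewrite (bigD1_seq mu) ?parts_uniq ?mem_parts ?pm ?dm ?eqxx //= alt_J_diag //.
rewrite big_seq_cond big1 ?addr0 => [/eqP|nu /andP[]].
  by rewrite scaler_eq0 (negbTE (J_diag pm sm)) => /eqP.
rewrite mem_parts => /andP[pn /eqP dn] nnu.
have [lt|sn] := ltnP m (size nu); first by rewrite alt_J_long // scale0r.
have [->|nz] := eqVneq (alt q t 0 (J nu) (delta m + mnmp m mu)%MM) 0; first by rewrite scale0r.
have [_ [lt|e]] := alt_J_supp pn sn nz.
  by rewrite (IH (n_part nu)) ?scaler0 // -eh -(bw_mnmp sm).
by case/eqP: nnu; apply: (mnmp_inj (m := m)).
Qed.

Section FixedDegree.
Variable n : nat.

Let Y nu b : K := alt q t (-1) (J nu) (b + ones m)%MM / nrm nu.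

Let kernelY b e : mdeg b = (n + dsum m)%N ->
  \sum_(nu <- parts (n + m)) Y nu b * alt q t 0 (J nu) e =
  if (ones m <= e)%MM then \sum_(mu <- parts n)
       (alt q t 0 (J mu) b / nrm mu) * alt q t (- t) (J mu) (e - ones m)%MM else 0.
Proof.
move=> db; have := kernel (b + ones m)%MM e.
by rewrite addmK mdegD mdeg_ones db lem_addl addnAC !addnK.
Qed.

(** [Y nu] is sought in the span of the alternants of the [J mu], with coefficients y independent of
    b. The support condition is one half of the triangularity that later isolates nu = 1^m|mu. *)
Let good (h : nat) (y : seq nat -> seq nat -> K) := forall nu, is_part nu ->
  sumn nu = (n + m)%N -> (size nu <= m)%N -> (n_part nu < h)%N ->
  (forall b, mdeg b = (n + dsum m)%N ->
     Y nu b = \sum_(mu <- parts n) y nu mu * alt q t 0 (J mu) b) /\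
  (forall mu, is_part mu -> sumn mu = n -> (size mu <= m)%N -> y nu mu != 0 ->
     (n_part (add_col m mu) < n_part nu)%N \/ nu = add_col m mu).

(* The kernel identity at [e = delta + nu] determines [Y nu] from those of smaller [n_part]. *)
Let goodP h : exists y, good h y.
Proof.
elim: h => [|h [y gy]]; first by exists (fun _ _ => 0) => nu.
pose e nu := (delta m + mnmp m nu)%MM.
pose below nu ka := (n_part ka < n_part nu)%N && (size ka <= m)%N.
pose y' nu mu := if (n_part nu < h)%N then y nu mu else (J nu (mnmp m nu))^-1 *
  ((if (ones m <= e nu)%MM then alt q t (- t) (J mu) (e nu - ones m)%MM / nrm mu else 0)
   - \sum_(ka <- parts (n + m) | below nu ka) y ka mu * alt q t 0 (J ka) (e nu)).
exists y' => nu pn dn sn; rewrite ltnS leq_eqVlt => /orP[/eqP enu|lt]; last first.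
  by rewrite /y' lt; apply: gy.
rewrite /y' enu ltnn; have c0 := J_diag pn sn; split=> [b db|mu pm dm sm].
  have := kernelY (e nu) db.
  rewrite (bigD1_seq nu) ?parts_uniq ?mem_parts ?pn ?dn ?eqxx //= alt_J_diag //.
  move/(canRL (addrK _))/(canRL (mulfK c0)) => ->.
  rewrite [LHS]mulrC; under [RHS]eq_bigr do rewrite -mulrA.
  rewrite -mulr_sumr; congr (_ * _).
  under [RHS]eq_bigr do rewrite mulrBl.
  rewrite sumrB; congr (_ - _).
    case: ifP => _; last by rewrite big1 // => mu _; rewrite mul0r.
    by apply: eq_bigr => mu _; rewrite mulrC mulrA mulrAC -mulrA mulrC -mulrA mulrC.
  under [RHS]eq_bigr do rewrite mulr_suml.
  rewrite exchange_big /= [RHS]big_mkcond [LHS]big_mkcond [LHS]big_seq [RHS]big_seq.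
  apply: eq_bigr => ka; rewrite mem_parts => /andP[pk /eqP dk].
  rewrite /below; case: (leqP (size ka) m) => sk; last first.
    by rewrite andbF alt_J_long // mulr0 if_same.
  rewrite andbT; case: (ltnP (n_part ka) (n_part nu)) => ltk.
    have nk : ka != nu by apply: contraTneq ltk => ->; rewrite ltnn.
    rewrite nk; have [-> // _] := gy ka pk dk sk (leq_trans ltk (eq_leq enu)).
    by rewrite mulr_suml; apply: eq_bigr => mu _; rewrite mulrAC.
  case: ifP => // nk.
  have [->|nz] := eqVneq (alt q t 0 (J ka) (e nu)) 0; first by rewrite mulr0.
  have [_ [lt|ee]] := alt_J_supp pk sk nz; first by rewrite bw_mnmp // in lt; lia.
  by move: nk; rewrite (mnmp_inj pk pn sk sn) ?eqxx.
rewrite mulf_eq0 negb_or => /andP[_ nz].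
have [s0|nzs] := eqVneq (\sum_(ka <- parts (n + m) | below nu ka)
    y ka mu * alt q t 0 (J ka) (e nu)) 0; last first.
  have [ka kin /andP[/andP[ltk sk] nzy]] : exists2 ka, ka \in parts (n + m) &
      below nu ka && (y ka mu != 0).
    apply/hasP; apply: contraNT nzs => /hasPn all0.
    rewrite big_seq_cond big1 // => ka /andP[kin bk].
    by have := all0 ka kin; rewrite bk /= negbK => /eqP ->; rewrite mul0r.
  move: kin; rewrite mem_parts => /andP[pk /eqP dk].
  have [_ /(_ mu pm dm sm nzy)] := gy ka pk dk sk (leq_trans ltk (eq_leq enu)).
  by case=> [|<-]; left; lia.
move: nz; rewrite s0 subr0; case: ifP => [le|]; last by rewrite eqxx.
rewrite mulf_eq0 negb_or => /andP[nz _].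
(* The last entry of delta is 0, so [ones m <= e nu] forces the m-th part of nu to be positive: nu
   has exactly m parts and a column can be removed. *)
have nu_ge1 i : (0 < nth 0%N nu i)%N || (m <= i)%N.
  have lt1 : (m.-1 < m)%N by rewrite prednK.
  have last_gt0 : (0 < nth 0%N nu m.-1)%N.
    have /mnm_lepP /(_ (Ordinal lt1)) := le.
    by rewrite mnmDE !mnmE /dl /= prednK // subnn.
  case: (leqP m i) => lti; rewrite ?orbT // orbF.
  have szm : (m.-1 < size nu)%N.
    by rewrite ltnNge; apply: contraTN last_gt0 => ge; rewrite nth_default.
  have /andP[_ n0] := pn; rewrite lt0n; apply: contraNneq n0 => <-; apply: mem_nth.
  by apply: leq_ltn_trans szm; rewrite -ltnS prednK.
have le1 : (ones m <= mnmp m nu)%MM.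
  by apply/mnm_lepP => i; rewrite !mnmE; case/orP: (nu_ge1 i) => //; rewrite leqNgt ltn_ord.
move: nz; rewrite /e -(submK le1) addmA addmK => /(alt_J_supp pm sm) [_ sup].
have eb : (bw (mnmp m nu - ones m)%MM + dsum m = n_part nu)%N.
  by rewrite -bw_ones -bwD submK // bw_mnmp.
rewrite n_part_add_col //; case: sup => [lt|ee]; first by left; lia.
right; apply: (mnmp_inj (m := m)) => //; rewrite ?size_add_col //.
  exact: is_part_add_col.
by rewrite mnmp_add_col -ee submK.
Qed.

(** A nonzero y_(nu, mu) with nu <> 1^m|mu has n(1^m|mu) < n(nu) by [good], but then [Y nu] vanishes
    at delta + mu, contradicting the diagonal term there. So only nu = 1^m|mu contributes, and [L]
    determines its scalar. *)
Lemma column_kernel b : mdeg b = (n + dsum m)%N ->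
  alt q t (-1) G (b + ones m)%MM =
  \sum_(mu <- parts n) (alt q t 0 (J mu) b / nrm mu) *: H (add_col m mu).
Proof.
pose M := (\max_(nu <- parts (n + m)) n_part nu).+1.
have leM nu : is_part nu -> sumn nu = (n + m)%N -> (n_part nu < M)%N.
  by move=> pn dn; rewrite ltnS; apply: leq_bigmax_seq; rewrite // mem_parts pn dn eqxx.
have [y gy] := goodP M.
have y_diag nu mu : is_part nu -> sumn nu = (n + m)%N -> (size nu <= m)%N ->
    is_part mu -> sumn mu = n -> (size mu <= m)%N -> nu != add_col m mu -> y nu mu = 0.
  move=> pn dn sn; move: {2}(n_part mu) (erefl (n_part mu)) => h.
  elim/ltn_ind: h mu => h IH mu eh pm dm sm ne; apply/eqP/negPn/negP => nz.
  have [yE supp] := gy nu pn dn sn (leM nu pn dn).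
  have [lt|e] := supp mu pm dm sm nz; last by rewrite e eqxx in ne.
  have := yE (delta m + mnmp m mu)%MM.
  rewrite mdegD mdeg_delta sumn_mnmp // dm addnC => /(_ erefl).
  have -> : Y nu (delta m + mnmp m mu)%MM = 0.
    rewrite /Y -addmA; have [->|nz'] := eqVneq
      (alt q t (-1) (J nu) (delta m + (mnmp m mu + ones m))%MM) 0; first by rewrite mul0r.
    have [_] := alt_J_supp pn sn nz'; rewrite -mnmp_add_col.
    rewrite bw_mnmp ?size_add_col //; case=> [|/mnmp_inj ee]; first by lia.
    by case/eqP: ne; rewrite ee ?size_add_col //; apply: is_part_add_col.
  rewrite (bigD1_seq mu) ?parts_uniq ?mem_parts ?pm ?dm ?eqxx //= alt_J_diag //.
  rewrite big_seq_cond big1 ?addr0 => [/esym/eqP|ka /andP[]].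
    by rewrite mulf_eq0 (negbTE nz) (negbTE (J_diag pm sm)).
  rewrite mem_parts => /andP[pk /eqP dk] nk.
  have [ltk|sk] := ltnP m (size ka); first by rewrite alt_J_long // mulr0.
  have [->|nz'] := eqVneq (alt q t 0 (J ka) (delta m + mnmp m mu)%MM) 0; first by rewrite mulr0.
  have [_ [ltk|ee]] := alt_J_supp pk sk nz'; last by case/eqP: nk; apply: (mnmp_inj (m := m)).
  rewrite bw_mnmp // in ltk; rewrite (IH (n_part ka)) ?mul0r -?eh //.
  by apply: contraTneq lt => ->; rewrite !n_part_add_col //; lia.
pose z mu := y (add_col m mu) mu.
have WE b' : mdeg b' = (n + dsum m)%N -> alt q t (-1) G (b' + ones m)%MM =
    \sum_(mu <- parts n) (alt q t 0 (J mu) b' * z mu) *: H (add_col m mu).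
  move=> db; rewrite alt_G mdegD mdeg_ones db addnAC addnK.
  transitivity (\sum_(nu <- parts (n + m) | (size nu <= m)%N)
      \sum_(mu <- parts n | (size mu <= m)%N) (y nu mu * alt q t 0 (J mu) b') *: H nu).
    rewrite [RHS]big_mkcond [LHS]big_seq [RHS]big_seq; apply: eq_bigr => nu.
    rewrite mem_parts => /andP[pn /eqP dn]; case: (leqP (size nu) m) => sn; last first.
      by rewrite alt_J_long // mul0r scale0r.
    rewrite -/(Y nu b') (gy nu pn dn sn (leM nu pn dn)).1 // scaler_suml [RHS]big_mkcond.
    rewrite [LHS]big_seq [RHS]big_seq; apply: eq_bigr => mu.
    rewrite mem_parts => /andP[pm _]; case: leqP => // sm.
    by rewrite alt_J_long // mulr0 scale0r.
  rewrite exchange_big /= big_mkcond [LHS]big_seq [RHS]big_seq; apply: eq_bigr => mu.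
  rewrite mem_parts => /andP[pm /eqP dm]; case: (leqP (size mu) m) => sm; last first.
    by rewrite alt_J_long // mul0r scale0r.
  have pa := is_part_add_col m pm; have da := sumn_add_col sm; rewrite dm in da.
  have ain : add_col m mu \in [seq nu <- parts (n + m) | (size nu <= m)%N].
    by rewrite mem_filter mem_parts pa da size_add_col leqnn eqxx.
  rewrite -big_filter (bigD1_seq (add_col m mu) ain (filter_uniq _ (parts_uniq _))) /=.
  rewrite big_seq_cond big1 ?addr0 => [|nu /andP[]]; first by rewrite mulrC.
  rewrite mem_filter mem_parts => /andP[sn /andP[pn /eqP dn]] ne.
  by rewrite (y_diag nu mu) // mul0r scale0r.
move=> db; rewrite WE // [LHS]big_seq [RHS]big_seq; apply: eq_bigr => mu.
rewrite mem_parts => /andP[pm /eqP dm]; case: (leqP (size mu) m) => sm; last first.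
  by rewrite alt_J_long // !mul0r.
have Lsum k (c : seq nat -> K) (h : seq nat -> A) :
    L k (\sum_(nu <- parts n) c nu *: h nu) = \sum_(nu <- parts n) c nu * L k (h nu).
  have L0 : L k 0 = 0.
    by have := L_linear k (-1) 0 0; rewrite scaler0 addr0 scaleN1r addNr.
  have LD x x' : L k (x + x') = L k x + L k x'.
    by have := L_linear k 1 x x'; rewrite !scale1r.
  have LZ c' x : L k (c' *: x) = c' * L k x.
    by have := L_linear k c' x 0; rewrite !addr0 L0 addr0.
  by rewrite (big_morph (L k) LD L0); apply: eq_bigr => nu _; apply: LZ.
congr (_ *: _); congr (_ * _).
(* After scaling by t^(n(mu) + dsum), the value of [L] on H_(1^m|mu), the claim for all mu becomes
   the single equation [L_alt], and [alt_J_free] separates the mu. *)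
apply: (mulIf (expf_neq0 (n_part mu + dsum m) t_neq0)); apply/eqP.
rewrite [_^-1 * _]mulrC -subr_eq0; apply/eqP.
apply: (@alt_J_free K^o n (fun nu => z nu * t ^+ (n_part nu + dsum m)
   - t ^+ (n_part nu + dsum m) / nrm nu)) => // b' db'.
under eq_bigr do rewrite scalerBr.
apply/eqP; rewrite sumrB subr_eq0; apply/eqP.
have := L_alt n b'; rewrite WE // alt_G db' addnK !Lsum mulr_sumr => LE.
transitivity (\sum_(nu <- parts n)
    alt q t 0 (J nu) b' * z nu * L (n + m) (H (add_col m nu))).
  rewrite [LHS]big_seq [RHS]big_seq; apply: eq_bigr => nu.
  rewrite mem_parts => /andP[pn /eqP dn].
  case: (leqP (size nu) m) => sn; last by rewrite alt_J_long // !mul0r; exact: scale0r.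
  rewrite -dn -sumn_add_col // L_H ?is_part_add_col // n_part_add_col //.
  by rewrite /GRing.scale /= mulrA.
rewrite LE [LHS]big_seq [RHS]big_seq; apply: eq_bigr => nu.
rewrite mem_parts => /andP[pn /eqP dn]; rewrite -dn L_H //.
rewrite /GRing.scale /= exprD.
by move: (alt _ _ _ _ _) (t ^+ _) (t ^+ _) (nrm nu)^-1 => x1 x2 x3 x4; ring.
Qed.

End FixedDegree.

(** The degrees that [column_kernel] omits: there the subtraction of [dsum m] would truncate. The
    kernel identity has zero right-hand side, and freeness kills the remaining coefficients. *)
Lemma column_kernel_small b : (mdeg b < dsum m)%N ->
  alt q t (-1) G (b + ones m)%MM = 0.
Proof.
move=> lt; rewrite alt_G; set n' := (_ - _)%N.
have [lt'|ge] := ltnP (mdeg (b + ones m)%MM) (dsum m).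
  by rewrite big1 // => mu _; rewrite alt_small // mul0r scale0r.
rewrite big_seq big1 // => nu; rewrite mem_parts => /andP[pn /eqP dn].
case: (leqP (size nu) m) => sn; last by rewrite alt_J_long // mul0r scale0r.
rewrite (_ : _ / _ = 0) ?scale0r //.
apply: (@alt_J_free K^o n' (fun nu => alt q t (-1) (J nu) (b + ones m)%MM / nrm nu)) => //.
move=> e de; under eq_bigr do rewrite [_ *: _]mulrC.
rewrite kernel; case: ifP => // _; rewrite addmK big1 // => mu _.
by rewrite alt_small // !mul0r.
Qed.

(** Both identities see V only on the [H mu] with at most m parts, since the alternants of longer
    [J mu] vanish. Given [column_kernel], one direction is substitution and the other is
    [alt_J_free]. *)
Lemma column_operatorP (V : A -> A) : linear V ->
  (forall mu, is_part mu -> (size mu <= m)%N -> V (H mu) = H (add_col m mu)) <->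
  (forall b, alt q t 0 (fun a => V (G a)) b = alt q t (-1) G (b + ones m)%MM).
Proof.
move=> linV; have V0 : V 0 = 0.
  by have := linV (-1) 0 0; rewrite scaler0 addr0 scaleN1r addNr.
have VD x y : V (x + y) = V x + V y by rewrite -[x]scale1r linV !scale1r.
have VZ c x : V (c *: x) = c *: V x by rewrite -[c *: x]addr0 linV V0 addr0.
have altV b : alt q t 0 (fun a => V (G a)) b =
    \sum_(mu <- parts (mdeg b - dsum m)) (alt q t 0 (J mu) b / nrm mu) *: V (H mu).
  rewrite -(alt_linear_map q t linV) alt_G (big_morph V VD V0).
  by apply: eq_bigr => mu _; rewrite VZ.
split=> [VH b|VG mu pm sm].
  rewrite altV; have [lt|ge] := ltnP (mdeg b) (dsum m).
    by rewrite column_kernel_small // big1 // => mu _; rewrite alt_small // mul0r scale0r.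
  rewrite (@column_kernel (mdeg b - dsum m)) ?subnK //.
  rewrite [LHS]big_seq [RHS]big_seq; apply: eq_bigr => mu; rewrite mem_parts => /andP[pm _].
  case: (leqP (size mu) m) => sm; first by rewrite VH.
  by rewrite alt_J_long // mul0r !scale0r.
have z0 : (nrm mu)^-1 *: (V (H mu) - H (add_col m mu)) = 0.
  apply: (@alt_J_free A (sumn mu)
    (fun nu => (nrm nu)^-1 *: (V (H nu) - H (add_col m nu)))) => // b db.
  under eq_bigr do rewrite scalerA scalerBr.
  rewrite sumrB -(column_kernel db).
  by have := VG b; rewrite altV db addnK => ->; rewrite subrr.
apply/eqP; rewrite -subr_eq0; move/eqP: z0.
by rewrite scaler_eq0 invr_eq0 (negbTE (nrm_neq0 pm)).
Qed.

End ColumnKernel.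

(** * Twisting an alternant identity from q = 0 *)

Section AbstractTwist.
Variables (K : fieldType) (q t : K) (m : nat) (A : comAlgType K) (B : comAlgType A).
Variables (g h : nat -> A) (c : nat -> A) (Yh T : nat -> B).
Hypothesis cE : forall n, c n = q ^+ n *: g n.
Hypothesis h0 : h 0%N = 1.
Hypothesis gE : forall n, g n = \sum_(i < n.+1) c i * h (n - i)%N.
Hypothesis TE : forall n, T n = \sum_(i < n.+1) c i *: Yh (n - i)%N.
Variables (V : A -> A) (Vh : B -> A).
Hypothesis Vh_linear : linear (Vh : B -> A^o).
Hypothesis Vh_prod : forall a : 'X_{1..m}, Vh (\prod_i Yh (a i)) = V (\prod_i h (a i)).
Hypothesis V_alt : forall b, alt 0 t 0 (fun a => V (\prod_i h (a i))) b =
  alt 0 t (-1) (fun a => \prod_i h (a i)) (b + ones m)%MM.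

Let bnd (n M : nat) : pred 'I_M := fun j => (j <= n)%N.

Let sum_bnd (C : nmodType) n M (F : nat -> C) : (n < M)%N ->
  \sum_(i < n.+1) F i = \sum_(j < M | bnd n j) F j.
Proof. by move=> lt; rewrite (big_ord_widen M F lt). Qed.

Let prod_T M (a : 'X_{1..m}) : (forall i, (a i < M)%N) -> \prod_i T (a i) =
  \sum_(f in family (fun i => bnd (a i) (M := M)))
     (\prod_i c (f i)) *: \prod_i Yh (a i - f i)%N.
Proof.
move=> lt; under eq_bigr do rewrite TE.
rewrite (eq_bigr (fun i => \sum_(j < M | bnd (a i) j) c j *: Yh (a i - j)%N)); last first.
  by move=> i _; apply: (sum_bnd (fun j => c j *: Yh (a i - j)%N)).
rewrite (bigA_distr_big_dep (fun i => @bnd (a i) M) (fun i (j : 'I_M) => c j *: Yh (a i - j)%N)).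
apply: eq_bigr => f _.
by rewrite scaler_prod.
Qed.

Let mof M (f : {ffun 'I_m -> 'I_M}) : 'X_{1..m} := [multinom (f i : nat) | i < m].

Let in_bnd M (f : {ffun 'I_m -> 'I_M}) (a : 'X_{1..m}) :
  (f \in family (fun i => bnd (a i) (M := M))) = (mof f <= a)%MM.
Proof.
apply/familyP/mnm_lepP => le i; have := le i; rewrite ?mnmE; by rewrite unfold_in.
Qed.

Let alt_Vh b : alt q t 0 (fun a => Vh (\prod_i T (a i))) b =
  \sum_(f : {ffun 'I_m -> 'I_(mdeg b).+1} | (mof f <= b)%MM)
     (\prod_i c (f i)) * alt 0 t 0 (fun a => V (\prod_i h (a i))) (b - mof f)%MM.
Proof.
have Vh0 : Vh 0 = 0.
  by have := Vh_linear (-1) 0 0; rewrite scaler0 addr0 scaleN1r addNr.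
have VhD x y : Vh (x + y) = Vh x + Vh y.
  by have := Vh_linear 1 x y; rewrite !scale1r.
have VhZ k x : Vh (k *: x) = k * Vh x.
  by have := Vh_linear k x 0; rewrite !addr0 Vh0 addr0.
rewrite /alt; under [RHS]eq_bigr do rewrite mulr_sumr.
rewrite exchange_big /=; apply: eq_bigr => w _.
under [RHS]eq_bigr do rewrite -scalerAr.
rewrite [X in _ = X](eq_bigr (fun f : {ffun 'I_m -> 'I_(mdeg b).+1} => (-1) ^+ w *:
   ((\prod_i c (f i)) * (if (wdl w <= b - mof f)%MM
      then V (\prod_i h ((b - mof f - wdl w)%MM i)) else 0)))); last first.
  by move=> f _; rewrite big1 ?mulr1 // => i _; rewrite !mul0r addr0.
rewrite -scaler_sumr big1 ?mulr1; last by move=> i _; rewrite !mul0r addr0.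
congr (_ *: _); case: ifP => [le|nle]; last first.
  rewrite big1 // => f lef; rewrite ifF ?mulr0 //; apply: contraFF nle.
  by move=> le; apply: lepm_trans le (lem_subr _ _).
have lt i : ((b - wdl w)%MM i < (mdeg b).+1)%N.
  by rewrite ltnS mnmBE (leq_trans (leq_subr _ _)) // mdegE (bigD1 i) //= leq_addr.
rewrite (prod_T lt) (big_morph Vh VhD Vh0).
under eq_bigl do rewrite in_bnd.
rewrite [LHS]big_mkcond [RHS]big_mkcond; apply: eq_bigr => f _.
have e : (mof f <= b - wdl w)%MM = (mof f <= b)%MM && (wdl w <= b - mof f)%MM.
  apply/mnm_lepP/andP => [lef|[/mnm_lepP lef /mnm_lepP lew] i].
    by split; apply/mnm_lepP => i; have := lef i; have /mnm_lepP /(_ i) := le;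
       rewrite !mnmBE; lia.
  by have := lef i; have := lew i; rewrite !mnmBE; lia.
rewrite e; case: (mof f <= b)%MM => //=; case: ifP => _; last by rewrite mulr0.
rewrite VhZ; congr (_ * _).
rewrite (_ : b - mof f - wdl w = b - wdl w - mof f)%MM; last first.
  by rewrite !submDA addmC.
rewrite -Vh_prod; congr Vh; apply: eq_bigr => i _.
by rewrite (mnmBE i (b - wdl w)%MM (mof f)) [mof f i]mnmE.
Qed.

Let theta0 k n : A := if (dl (m := m) k <= n)%N then
  (1 - t ^+ dl k * 0 ^+ (n - dl k)) *: h (n - dl k)%N else 0.

(** At q = 0 the shift replaces h(z) by its constant term 1. Multiplying h(z) - t^delta_k by c(z) =
    g(qz) gives g(z) - t^delta_k g(qz), which is 1 - t^delta_k T applied to g. *)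
Let conv_theta k n : \sum_(i < n.+1) c i * theta0 k (n.+1 - i) =
  if (dl (m := m) k <= n.+1)%N then (1 - t ^+ dl k * q ^+ (n.+1 - dl k)) *: g (n.+1 - dl k)%N
  else 0.
Proof.
(* The added term i = n + 1 is zero: at index 0 either delta_k > 0 or the coefficient is 1 - t^0 0^0
   = 0. This reconciles sums bounded by b_i with the exponent b_i + 1 on the right. *)
transitivity (\sum_(i < n.+2) c i * theta0 k (n.+1 - i)).
  rewrite [RHS]big_ord_recr /= subnn /theta0 leqn0; case: eqP => [->|_].
    by rewrite subn0 !expr0 mulr1 subrr scale0r mulr0 addr0.
  by rewrite mulr0 addr0.
case: ifP => [le|nle]; last first.
  rewrite big1 // => i _; rewrite /theta0 ifF ?mulr0 //; have := ltn_ord i; lia.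
pose N := (n.+1 - dl k)%N.
transitivity (\sum_(i < N.+1) c i * ((1 - t ^+ dl k * 0 ^+ (N - i)) *: h (N - i)%N)).
  rewrite (big_ord_widen n.+2 (fun i => c i * ((1 - t ^+ dl k * 0 ^+ (N - i)) *: h (N - i)%N))).
    rewrite [RHS]big_mkcond; apply: eq_bigr => i _; have := ltn_ord i; rewrite /theta0 /N.
    move=> lt; have -> : (dl k <= n.+1 - i)%N = (i < (n.+1 - dl k).+1)%N by lia.
    case: ifP => lt'; last by rewrite mulr0.
    by rewrite subnAC.
  rewrite /N; lia.
under eq_bigr do rewrite scalerBl scale1r mulrBr.
rewrite sumrB -gE scalerBl scale1r; congr (_ - _).
rewrite big_ord_recr /= subnn expr0 mulr1 h0 cE big1 ?add0r => [|i _].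
  by rewrite -scalerAr mulr1 scalerA.
have -> : 0 ^+ (N - i) = 0 :> K by rewrite expr0n; have := ltn_ord i; case: eqP => //; lia.
by rewrite mulr0 scale0r mulr0.
Qed.

(** T(z) = c(z) Yh(z), so the left side is the identity at q = 0 convolved with the product of the
    c(z_i). On the right, the convolution is absorbed into the rows of the determinant, whose
    entries [conv_theta] evaluates. *)
Lemma twist_alt b : alt q t 0 (fun a => Vh (\prod_i T (a i))) b =
  alt q t (-1) (fun a => \prod_i g (a i)) (b + ones m)%MM.
Proof.
rewrite alt_Vh; under eq_bigr do rewrite V_alt.
rewrite alt_det.
pose F (i k : 'I_m) (j : nat) : A := c j * theta0 k (b i + 1 - j)%N.
transitivity (\det (\matrix_(i < m, k < m) \sum_(j < (mdeg b).+1 | bnd (b i) j) F i k j)); last first.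
  congr (\det _); apply/matrixP => i k; rewrite !mxE.
  have lt : (b i < (mdeg b).+1)%N by rewrite ltnS mdegE (bigD1 i) //= leq_addr.
  rewrite -(sum_bnd (F i k) lt) /F addn1 conv_theta mnmDE mnmE addn1.
  by rewrite mulN1r mulNr.
rewrite /determinant.
transitivity (\sum_(w : 'S_m) \sum_(f in family (fun i => @bnd (b i) (mdeg b).+1))
    (-1) ^+ w * \prod_i F i (w i) (f i)); last first.
  apply: eq_bigr => w _; rewrite -mulr_sumr; congr (_ * _).
  rewrite -(bigA_distr_big_dep (fun i => @bnd (b i) _) (fun i (j : 'I_(mdeg b).+1) => F i (w i) j)).
  by apply: eq_bigr => i _; rewrite mxE.
rewrite [RHS]exchange_big /=; apply: eq_big => [f|f lef]; first by rewrite in_bnd.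
rewrite alt_det /determinant mulr_sumr; apply: eq_bigr => w _.
rewrite mulrCA; congr (_ * _); rewrite -big_split; apply: eq_bigr => i _ /=.
rewrite mxE /F /theta0 mnmDE mnmBE !mnmE mulN1r mulNr.
have /mnm_lepP /(_ i) := lef; rewrite mnmE => le.
by rewrite addnBAC.
Qed.

End AbstractTwist.

(** * Specialization to a single variable *)

Section PrincipalSpecialization.
Variables (K : fieldType) (q t : K).
Hypothesis char0 : forall n, n.+1%:R != 0 :> K.
Hypothesis q_neq1 : forall n, 1 - q ^+ n.+1 != 0.
Local Notation x := ('X_ord0 : {mpoly K[1]}).

(* For X = x a single variable, (1 - x z) Omega[x z/(1-q)] = Omega[x q z/(1-q)]. *)
Lemma gs_single n : ev 0 1 (gs q n.+1) - x * ev 0 1 (gs q n)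
  = q ^+ n.+1 *: ev 0 1 (gs q n.+1).
Proof.
have nw := ev_gs_newton char0 q 0 1.
have := @newton_uniq _ (@mpoly_nat_reg K char0 1)
  (fun k => ((1 - q ^+ k)^-1 * (1 - 0 ^+ k) * q ^+ k) *: xp K 1 k)
  (conv (fun n => (1 - x *: 'X : {poly {mpoly K[1]}})`_n) (fun n => ev 0 1 (gs q n)))
  (fun n => q%:MP ^+ n * ev 0 1 (gs q n)) _ _ n.+1.
rewrite -rmorphXn mul_mpolyC => <-.
- rewrite /conv !big_ord_recl big1 ?addr0 => [|i _].
    rewrite /= !(coefB, coefZ, coefX, coef1) subn0 subSS subn0 /=.
    by rewrite mulr0 subr0 mul1r sub0r mulr1 mulNr.
  by rewrite /= !(coefB, coefZ, coefX, coef1) /= mulr0 subr0 mul0r.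
- apply: newton_ext (newton_conv (newton_linear x) nw) => k.
  rewrite /xp big_ord1 expr0n subr0 mulr1 -scaleN1r -scalerDl; congr (_ *: _).
  by have := q_neq1 k; move: (q ^+ _) => y nz; field.
apply: newton_ext (newton_scale q%:MP nw) => k.
by rewrite -rmorphXn mul_mpolyC scalerA; congr (_ *: _); rewrite mulrC.
Qed.

(** By [gs_single], with d = delta_l the entry (1 - t^d q^(n+1)) g_(n+1) equals (1 - t^d) g_(n+1) +
    t^d x g_n, and g_(n+1) is the entry of the next column at u = 0. So the matrices differ by the
    bidiagonal factor [U], and in the last column d = 0 removes the first term. *)
Lemma ev_single_alt m b : (0 < m)%N ->
  ev 0 1 (alt q t (-1) (fun a : 'X_{1..m} => \prod_i gs q (a i)) (b + ones m)%MM) =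
  t ^+ dsum m *: (x ^+ m * ev 0 1 (alt q t 0 (fun a : 'X_{1..m} => \prod_i gs q (a i)) b)).
Proof.
move=> m_gt0; pose gam n := ev 0 1 (gs q n).
have evp a : ev 0 1 (\prod_(i < m) gs q (a i)) = \prod_i gam (a i).
  exact: (big_morph (ev 0 1) (@evM K 0 1) (@ev1 K 0 1)).
have altE u b' : ev 0 1 (alt q t u (fun a : 'X_{1..m} => \prod_i gs q (a i)) b') =
    alt q t u (fun a => \prod_i gam (a i)) b'.
  apply: etrans (alt_linear_map q t (@ev_linear K 0 1) u _ b') _.
  by apply: eq_alt => w _; apply: evp.
apply: etrans (altE _ _) _.
apply: etrans (congr1 (fun z => t ^+ dsum m *: (x ^+ m * z)) (esym (altE 0 b))).
rewrite !alt_det; set C := (X in _ = _ *: (_ * \det X)).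
pose U : 'M[{mpoly K[1]}]_m := \matrix_(k, l)
  (if k == l then t ^+ dl l *: x else if (k == l.+1 :> nat) then (1 - t ^+ dl l)%:MP else 0).
have detU : \det U = t ^+ dsum m *: x ^+ m.
  rewrite det_trig; last first.
    apply/is_trig_mxP => i j lt; rewrite mxE -val_eqE /= ltn_eqF //.
    by rewrite ltn_eqF // (leq_trans lt).
  under eq_bigr do rewrite mxE eqxx.
  by rewrite scaler_prod prodrXr prodr_const card_ord.
rewrite scalerAl -detU mulrC -det_mulmx; congr (\det _).
apply/matrixP => i l; rewrite !mxE mulN1r mulNr mnmDE mnmE addn1.
have Cik k : C i k = if (dl k <= b i)%N then gam (b i - dl k)%N else 0.
  by rewrite mxE; case: ifP => // _; rewrite !mul0r addr0 scale1r.
have tailE : \sum_(k < m | k != l) C i k * U k l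
    = (1 - t ^+ dl l) *: (if (dl l <= (b i).+1)%N then gam ((b i).+1 - dl l)%N else 0).
  case: (ltnP l.+1 m) => lt.
    have nl : Ordinal lt != l by rewrite -val_eqE /= gtn_eqF.
    rewrite (bigD1 (Ordinal lt)) //= big1 => [|k /andP[nk nk1]].
      rewrite addr0 Cik mxE (negbTE nl) /= eqxx mulrC mul_mpolyC.
      have -> : dl (Ordinal lt) = (dl l).-1 by rewrite /dl /=; lia.
      have : (0 < dl l)%N by rewrite /dl; lia.
      by case: (dl l) => // d _ /=; rewrite subSS.
    rewrite [U _ _]mxE (negbTE nk); case: eqP => [e|]; last by rewrite mulr0.
    by case/eqP: nk1; apply: val_inj.
  rewrite (_ : dl l = 0%N); last by rewrite /dl; lia.
  rewrite expr0 subrr scale0r big1 // => k nk.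
  rewrite [U _ _]mxE (negbTE nk); case: eqP => [e|]; last by rewrite mulr0.
  by have := ltn_ord k; lia.
rewrite (bigD1 l) //= tailE Cik mxE eqxx.
case: (ltnP (b i) (dl l)) => lt.
  rewrite mul0r add0r; case: ifP => le; last by rewrite scaler0.
  have -> : ((b i).+1 - dl l = 0)%N by lia.
  by rewrite expr0 mulr1.
rewrite (leq_trans lt) // subSn //; set n := (b i - dl l)%N.
have := gs_single n; rewrite -/(gam _) -/(gam _) => e.
rewrite scalerBl scale1r -scalerA -e scalerBr -scalerAr [gam n * _]mulrC scalerBl scale1r.
rewrite opprB; move: (t ^+ _ *: gam _) (t ^+ _ *: _) => a1 a2.
by rewrite addrCA addrC.
Qed.

(** The Hall product is [scal_qt] at q = t = 0, where [gs] is [hsym]; this is [scal_qt_gs] in one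
    variable. *)
Lemma hall_hsym n f : hall f (hsym K n) = (ev 0 1 f)@_(U_(ord0) *+ n)%MM.
Proof.
have nz0 k : 1 - 0 ^+ k.+1 != 0 :> K by rewrite expr0n subr0 oner_eq0.
have gsE k : gs 0 k = hsym K k.
  apply: (@newton_uniq (Lam K) (@lreg_nat K (Lam K) char0) (fun k => psum K k)).
    apply: newton_ext (gs_newton 0 char0) => j.
    by rewrite expr0n subr0 invr1 scale1r.
  exact: hsym_newton.
have hallE g h : hall g h = scal_qt 0 0 g h.
  apply: eq_bigr => nu _; congr (_ * _); rewrite big1 ?mulr1 // => i _.
  by rewrite expr0n subr0 mulr1 expr1n.
rewrite hallE scal_qtC -gsE -(scal_qt_gs 0 char0 nz0) big_ord1.
by rewrite mulmnE mnm1E eqxx mul1n.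
Qed.

End PrincipalSpecialization.

(** * Column operators for Macdonald functions *)

Section MacdonaldColumns.
Variables (K : fieldType) (q t : K).
Hypothesis char0 : forall n, n.+1%:R != 0 :> K.
Hypothesis q_neq1 : forall n, 1 - q ^+ n.+1 != 0.
Hypothesis t_neq1 : forall n, 1 - t ^+ n.+1 != 0.
Hypothesis t_neq0 : t != 0.
Hypothesis aniso : forall f : Lam K, scal_qt q t f f = 0 -> f = 0.
Variable H : seq nat -> Lam K.
Hypothesis H_orth : forall la mu, is_part la -> is_part mu -> la <> mu ->
  scal_qt q t (H la) (H mu) = 0.
Hypothesis H_tri : forall mu N (a : 'X_{1..N}), is_part mu -> (ev t N (H mu))@_a != 0 ->
  mdeg a = sumn mu /\ forall k, (sumn (take k a) <= sumn (take k mu))%N.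
Hypothesis H_norm : forall mu, is_part mu -> hall (H mu) (hsym K (sumn mu)) = t ^+ n_part mu.

Let F := scal_qt q t.

Let H_neq0 mu : is_part mu -> H mu <> 0.
Proof.
move=> pm e; have := H_norm pm; rewrite e hall_hsym // => /esym/eqP.
by rewrite ev0 mcoeff0 expf_eq0 (negbTE t_neq0) andbF.
Qed.

Let nondeg f : (forall la, is_part la -> F (gl q la) f = 0) -> f = 0.
Proof. exact: gl_nondeg. Qed.

Lemma seq_of_mnm N (s : seq nat) : size s = N ->
  [multinom nth 0%N s i | i < N] = s :> seq nat.
Proof.
move=> sN; apply: (@eq_from_nth _ 0%N); rewrite size_tuple ?sN // => i lt.
by rewrite -(mnm_nth _ _ (Ordinal lt)) mnmE.
Qed.

Let F_tri mu s : is_part mu -> F (gl q s) (H mu) != 0 ->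
  sumn s = sumn mu /\ forall k, (sumn (take k s) <= sumn (take k mu))%N.
Proof.
move=> pm; rewrite /F (scal_qt_gl t char0 q_neq1 _ (erefl (size s))) => /(H_tri pm).
by rewrite /mdeg seq_of_mnm // -sumnE.
Qed.

Section Column.
Variable m : nat.
Hypothesis m_gt0 : (0 < m)%N.

Let G (a : 'X_{1..m}) : Lam K := \prod_i gs q (a i).
Let J mu (a : 'X_{1..m}) : K^o := (ev t m (H mu))@_a.
Let nrm mu : K := F (H mu) (H mu).

Let JE mu a : J mu a = F (G a) (H mu).
Proof. by rewrite /J -(scal_qt_gs t char0 q_neq1). Qed.

Let nrm_neq0 mu : is_part mu -> nrm mu != 0.
Proof. by move=> pm; apply/eqP => /aniso; apply: H_neq0. Qed.

Let F_G_deg a s : F (gl q s) (G a) != 0 -> sumn s = mdeg a.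
Proof.
rewrite /F (scal_qt_gl t char0 q_neq1 _ (erefl (size s))) /G.
rewrite (big_morph (ev t _) (@evM K t _) (@ev1 K t _)) => nz.
have := @of_mdeg_prod K (size s) _ (index_enum 'I_m) (fun i => a i)
  (fun i => ev t (size s) (gs q (a i))).
move=> /(_ (fun i => @of_mdeg_ev_gs K char0 q t (size s) (a i))) /(_ _ nz).
by rewrite /mdeg seq_of_mnm // -sumnE -/(mdeg a) mdegE.
Qed.

Let G_expand a : G a = \sum_(mu <- parts (mdeg a)) (J mu a / nrm mu) *: H mu.
Proof.
rewrite [LHS](@H_expand K (Lam K) F (@scal_qt_linear K q t) (@scal_qtC K q t) aniso
  (gl q) H nondeg H_orth H_neq0 F_tri (mdeg a)).
  by apply: eq_bigr => mu _; rewrite JE.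
by move=> s _; apply: F_G_deg.
Qed.

Let nth_mnm (a : 'X_{1..m}) (i : 'I_m) : nth 0%N a i = a i.
Proof. by rewrite (mnm_nth 0%N). Qed.

Let J_supp mu a : is_part mu -> (size mu <= m)%N -> J mu a != 0 ->
  mdeg a = sumn mu /\ ((n_part mu < bw a)%N \/ a = mnmp m mu).
Proof.
move=> pm sm /(H_tri pm) [e le]; split=> //.
have ba : bw a = n_part a.
  by rewrite (n_part_wide (M := m)) ?size_tuple //; apply: eq_bigr => i _; rewrite nth_mnm.
have sa : sumn a = sumn mu by rewrite -e /mdeg sumnE.
have [le' eq'] := n_part_dom sa le.
rewrite ba; case: (ltngtP (n_part mu) (n_part a)) le' => [lt _|//|ee _]; first by left.
by right; apply/mnmP => i; rewrite mnmE -(eq' ee) nth_mnm.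
Qed.

Let J_diag mu : is_part mu -> (size mu <= m)%N -> J mu (mnmp m mu) != 0.
Proof.
move=> pm sm; rewrite JE.
have -> : G (mnmp m mu) = gl q mu.
  rewrite /G /gl (big_nth 0%N) big_mkord.
  rewrite (big_ord_widen m (fun i => gs q (nth 0%N mu i)) sm) [RHS]big_mkcond.
  apply: eq_bigr => i _; rewrite mnmE; case: ltnP => // ge.
  by rewrite nth_default // (gs_newton q char0).1.
exact: (@H_diag_neq0 K (Lam K) F (@scal_qt_linear K q t) aniso
  (gl q) H nondeg H_orth H_neq0 F_tri mu pm).
Qed.

(** Dominance at k = m would bound |mu| by the sum of its first m parts, although a positive part
    follows. *)
Let J_long mu a : is_part mu -> (m < size mu)%N -> J mu a = 0.
Proof.
move=> pm lt; apply/eqP/negPn/negP => /(H_tri pm)[e /(_ m)].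
have sa : sumn a = sumn mu by rewrite -e /mdeg sumnE.
rewrite take_oversize ?size_tuple // sa -{1}(cat_take_drop m mu) sumn_cat.
rewrite (drop_nth 0%N lt) /=; have /andP[_ n0] := pm.
have : (0 < nth 0%N mu m)%N by rewrite lt0n; apply: contraNneq n0 => <-; apply: mem_nth.
lia.
Qed.

Let ev_alt_G u b a : (ev t m (alt q t u G b))@_a =
  \sum_(mu <- parts (mdeg b - dsum m)) (alt q t u (J mu) b / nrm mu) * J mu a.
Proof.
rewrite (@alt_G K q t m (Lam K) H G J nrm G_expand u b).
rewrite (big_morph (ev t m) (@evD K t m) (@ev0 K t m)) raddf_sum.
by apply: eq_bigr => mu _ /=; rewrite evZ mcoeffZ.
Qed.

Let kernel b e :
  \sum_(nu <- parts (mdeg b - dsum m))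
     (alt q t (-1) (J nu) b / nrm nu) * alt q t 0 (J nu) e =
  if (ones m <= b)%MM && (ones m <= e)%MM then
    \sum_(mu <- parts (mdeg (b - ones m)%MM - dsum m))
       (alt q t 0 (J mu) (b - ones m)%MM / nrm mu) * alt q t (- t) (J mu) (e - ones m)%MM
  else 0.
Proof.
have step u v b' e' : alt q t v (fun a => (ev t m (alt q t u G b'))@_a : K^o) e' =
    \sum_(nu <- parts (mdeg b' - dsum m)) (alt q t u (J nu) b' / nrm nu) * alt q t v (J nu) e'.
  rewrite (@eq_alt K q t m _ v _ (fun a => \sum_(nu <- parts (mdeg b' - dsum m))
     J nu a *: (alt q t u (J nu) b' / nrm nu : K^o))); last first.
    by move=> w _; rewrite ev_alt_G; apply: eq_bigr => nu _; apply: mulrC.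
  by rewrite alt_sum; apply: eq_bigr => nu _; apply: mulrC.
by rewrite -!step; apply: theta_kernel_coeff.
Qed.

Let L n (f : Lam K) : K := (ev 0 1 f)@_(U_(ord0) *+ n)%MM.

Let L_linear n : linear (L n : Lam K -> K^o).
Proof. by move=> c f g; rewrite /L ev_linear mcoeffD mcoeffZ. Qed.

Let L_H mu : is_part mu -> L (sumn mu) (H mu) = t ^+ n_part mu.
Proof. by move=> pm; rewrite /L -hall_hsym // H_norm. Qed.

Let L_alt n b :
  L (n + m) (alt q t (-1) G (b + ones m)%MM) = t ^+ dsum m * L n (alt q t 0 G b).
Proof.
apply: etrans (congr1 (mcoeff _) (@ev_single_alt K q t char0 q_neq1 m b m_gt0)) _.
rewrite mcoeffZ mpolyXn mcoeffXM; congr (_ * _).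
have le : ((U_(ord0) *+ m : 'X_{1..1}) <= U_(ord0) *+ (n + m))%MM.
  by apply/mnm_lepP => i; rewrite !mulmnE leq_mul2l leq_addl orbT.
rewrite le; congr (_@__); apply/mnmP => i.
by rewrite mnmBE !mulmnE -mulnBr addnK.
Qed.

(* An operator adding columns is characterized by an identity not involving [H]. *)
Lemma macdonald_columnP (V : Lam K -> Lam K) : linear V ->
  (forall mu, is_part mu -> (size mu <= m)%N -> V (H mu) = H (add_col m mu)) <->
  (forall b : 'X_{1..m}, alt q t 0 (fun a => V (\prod_i gs q (a i))) b =
     alt q t (-1) (fun a => \prod_i gs q (a i)) (b + ones m)%MM).
Proof.
exact: (@column_operatorP K q t m (Lam K) H G J nrm m_gt0 t_neq0 nrm_neq0 G_expand
  J_supp J_diag J_long kernel L L_linear L_H L_alt V).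
Qed.

End Column.

(** Triangularity makes [H [::]] pair only with the empty product, so it is a constant, and the
    normalization makes that constant 1. *)
Lemma macdonald_nil : H [::] = 1.
Proof.
have pn : is_part [::] by [].
pose c := F (gl q [::]) (H [::]).
have FE la f : F (gl q la) f = (ev t (size la) f)@_[multinom nth 0%N la i | i < size la].
  exact: scal_qt_gl.
have e : H [::] = c *: 1.
  apply/eqP; rewrite -subr_eq0; apply/eqP; apply: nondeg => la pl.
  have Fsub f g : F (gl q la) (f - g) = F (gl q la) f - F (gl q la) g.
    rewrite /F (formD (@scal_qt_linear K q t)) -[- g]scaleN1r (formZ (@scal_qt_linear K q t)).
    by rewrite mulN1r.
  have FZ : F (gl q la) (c *: 1) = c * F (gl q la) 1.
    exact: (formZ (@scal_qt_linear K q t)).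
  rewrite Fsub FZ; have F1 : F (gl q la) 1 = (la == [::])%:R.
    rewrite FE ev1 mcoeff1; congr (nat_of_bool _)%:R.
    apply/eqP/eqP => [e0|->]; last by apply/mnmP => -[].
    case: la pl {Fsub FZ} e0 => // x la /andP[_ n0] /mnmP/(_ ord0).
    by rewrite mnmE mnm0E /= => x0; rewrite x0 inE eqxx in n0.
  rewrite F1; case: eqP => [->|ne]; first by rewrite mulr1 subrr.
  rewrite mulr0 subr0; apply/eqP/negPn/negP => /(F_tri pn)[s0 _].
  case: la pl ne s0 {Fsub FZ F1} => // x la /andP[_ n0] _ /= s0.
  by move: n0; rewrite inE; case: x s0.
have := H_norm pn; rewrite hall_hsym // e /n_part big_ord0 expr0 mulm0n.
by rewrite evZ ev1 mcoeffZ mcoeff1 eqxx mulr1 => ->; rewrite scale1r.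
Qed.

End MacdonaldColumns.

(** * The q-twisting *)

Section DoubleAlgebra.
Variables (K : fieldType) (A : comAlgType K) (B : comAlgType A).

(** Used with c = 1/(1 - q^k), d = 1 - q^k and e = q^k: the substitution X/(1-q) cancels the factor
    1 - q^k in front of p_k[Y]. Scalars of K reach B through A, hence the nested embeddings. *)
Lemma scale_alg_twist (c d e : K) (x : A) (u : B) : c * d = 1 ->
  ((c%:A : A)%:A : B) * ((e *: x)%:A + (d%:A : A) *: u) = (e *: (c *: x))%:A + u.
Proof.
move=> cd; rewrite mulrDr -!scalerAl !mul1r !scalerA; congr (_ *: _ + _).
  by rewrite -scalerAl mul1r !scalerA mulrC.
by rewrite -scalerAl mul1r scalerA cd !scale1r.
Qed.

Lemma double_nat_reg (char0 : forall n, n.+1%:R != 0 :> K) n : GRing.lreg (n.+1%:R : B).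
Proof.
move=> x y /(congr1 ( *:%R ((n.+1%:R^-1 : K)%:A : A))).
have E z : ((n.+1%:R^-1 : K)%:A : A) *: (n.+1%:R * z : B) = z.
  rewrite mulr_natl -scaler_nat scalerA -scalerAl mul1r -[n.+1%:R : A]scaler_nat.
  by rewrite scaler_nat -scaler_nat scalerA mulVf // !scale1r.
by rewrite !E.
Qed.

End DoubleAlgebra.

Lemma scale_geometric (K : fieldType) (U : lmodType K) (c : K) (k : nat) (x : U) :
  1 - c != 0 ->
  c *: ((1 - c)^-1 *: x) + (1 - 0 ^+ k.+1)^-1 *: x = (1 - c)^-1 *: x.
Proof.
move=> nz; rewrite expr0n subr0 invr1 scalerA -scalerDl; congr (_ *: _).
by field.
Qed.

Lemma newton_scaleK (K : fieldType) (A : comAlgType K) (q : K) (a phi : nat -> A) :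
  newton a phi -> newton (fun k => q ^+ k *: a k) (fun n => q ^+ n *: phi n).
Proof.
move=> nw; have E k x : (q%:A : A) ^+ k * x = q ^+ k *: x.
  by rewrite exprZn expr1n -scalerAl mul1r.
apply: newton_ext (newton_eq _ (newton_scale q%:A nw)) => n; exact: E.
Qed.

Lemma malg_scaleU (R : comNzRingType) (y : R) (nu : psmonom) :
  << y *g nu >> = y *: << nu >> :> {malg R[psmonom]}.
Proof.
apply/malgP => k; rewrite monalg.mcoeffU [RHS]monalg.mcoeffZ monalg.mcoeffU.
by case: (nu == k); rewrite /= !(mulr0n, mulr1n, mulr1, mulr0).
Qed.

Lemma mmap_idfun_scale (R : comNzRingType) (h : psmonom -> R) (c : R)
    (f : {malg R[psmonom]}) :
  monalg.mmap idfun h (c *: f) = c * monalg.mmap idfun h f.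
Proof.
rewrite (monalg.mmapEw (d := monalg.msupp f)) ?monalg.msuppZ_le // [in RHS]/monalg.mmap.
rewrite mulr_sumr; apply: eq_bigr => nu _.
by rewrite monalg.mcoeffZ /= mulrA.
Qed.

Lemma mmap_idfunU (R : comNzRingType) (h : psmonom -> R) nu :
  monalg.mmap idfun h << nu >> = h nu.
Proof. by apply: etrans (monalg.mmapU _ _) _; rewrite mul1r. Qed.

Lemma mmap_idfun_linear (R : comNzRingType) (h : psmonom -> R) c f g :
  monalg.mmap idfun h (c *: f + g) =
  c * monalg.mmap idfun h f + monalg.mmap idfun h g.
Proof. by rewrite raddfD /= mmap_idfun_scale. Qed.

Lemma mulUU (R : comNzRingType) (mu nu : psmonom) :
  << mu >> * << nu >> = << (mu * nu)%M >> :> {malg R[psmonom]}.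
Proof. by rewrite monalg.malgM_def fgmulUU mulr1. Qed.

Lemma psmonom_evalU (R : comNzRingType) (e : nat -> R) k :
  psmonom_eval e (ucm k) = e k.+1.
Proof. by rewrite /psmonom_eval monalg.mdomU big_seq_fset1 monalg.cmUU expr1. Qed.

Lemma psmonom_eval_gen (R : comNzRingType) nu :
  psmonom_eval (fun k => << ucm k.-1 >>) nu = << nu >> :> {malg R[psmonom]}.
Proof.
elim/psmonom_ind: nu => [|k nu IH].
  exact: (mmorph1 (@psmonom_eval _ _)).
apply: etrans (mmorphM (@psmonom_eval _ _) _ _) _.
apply: etrans (congr1 ( *%R _) IH) _.
apply: etrans (congr1 ( *%R^~ _) (psmonom_evalU _ k)) _.
exact: mulUU.
Qed.

Section Twist.
Variables (K : fieldType) (q t : K).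
Hypothesis char0 : forall n, n.+1%:R != 0 :> K.
Hypothesis q_neq1 : forall n, 1 - q ^+ n.+1 != 0.
Local Notation A := (Lam K).
Local Notation B := {malg (Lam K)[psmonom]}.

(* f[Y], where the coefficients of [B] are symmetric functions in X *)
Definition in_Y : A -> B :=
  plethysm (in_alg B \o in_alg A) (fun k => << ucm k.-1 >>).

Lemma in_YU nu : in_Y << nu >> = << nu >>.
Proof.
rewrite /in_Y /plethysm; apply: etrans (monalg.mmapU _ _) _.
by rewrite /= !scale1r mul1r; apply: psmonom_eval_gen.
Qed.

Lemma in_Y_linear c f g : in_Y (c *: f + g) = c%:A *: in_Y f + in_Y g.
Proof.
rewrite /in_Y rmorphD /= plethysmZ /=; congr (_ + _).
by rewrite -scalerAl mul1r.
Qed.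

Lemma qtwist_in_Y (V : A -> A) : linear V -> forall f,
  monalg.mmap idfun (fun nu : psmonom => V << nu >>) (in_Y f) = V f.
Proof.
move=> linV f; elim/lam_lin_ind: f => [nu|c f g IHf IHg].
  by rewrite in_YU; apply: mmap_idfunU.
apply: etrans (congr1 (monalg.mmap idfun _) (in_Y_linear c f g)) _.
apply: etrans (mmap_idfun_linear _ _ _ _) _.
apply: etrans (congr2 +%R (congr1 ( *%R _) IHf) IHg) _.
apply: etrans (congr1 (+%R^~ _) (mulr_algl c (V f))) _.
exact: (esym (linV c f g)).
Qed.

Let T_newton : newton (fun k => (q ^+ k *: ((1 - q ^+ k)^-1 *: psum K k.-1.+1))%:A
    + << ucm k.-1 >>) (fun n => pleth_XY q (gs q n) : B).
Proof.
apply: newton_ext (newton_morph (plethysm (in_alg B \o in_alg A)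
  (fun k => (q ^+ k *: psum K k) *: 1 + << (1 - q ^+ k) *: 1 *g ucm k.-1 >>))
  (gs_newton q char0)) => k /=.
rewrite plethysmZ plethysm_psum //= malg_scaleU.
by apply: scale_alg_twist; rewrite mulVf.
Qed.

Let Y_newton : newton (fun k => << ucm k.-1 >> : B) (fun n => in_Y (gs 0 n)).
Proof.
apply: newton_ext (newton_morph (plethysm (in_alg B \o in_alg A)
  (fun k => << ucm k.-1 >>)) (gs_newton 0 char0)) => k /=.
rewrite expr0n subr0 invr1 scale1r plethysm_psum //.
Qed.

(** Both generating series have p_k-sequence q^k p_k[X] / (1 - q^k) + p_k[Y], and Newton's
    recurrence has only one solution. *)
Lemma pleth_XY_gs n : pleth_XY q (gs q n) =
  \sum_(i < n.+1) (q ^+ i *: gs q i) *: in_Y (gs 0 (n - i)).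
Proof.
have nw := newton_conv (newton_morph (in_alg B) (newton_scaleK q (gs_newton q char0))) Y_newton.
rewrite (newton_uniq (@double_nat_reg K A B char0) T_newton nw n).
by apply: eq_bigr => i _ /=; rewrite -scalerAl mul1r.
Qed.

Lemma gs_conv n : gs q n = \sum_(i < n.+1) (q ^+ i *: gs q i) * gs 0 (n - i).
Proof.
have nw := newton_conv (newton_scaleK q (gs_newton q char0)) (gs_newton 0 char0).
apply: (fun nw' => @newton_uniq A (@lreg_nat K A char0) _ (gs q)
  (conv (fun i => q ^+ i *: gs q i) (gs 0)) (gs_newton q char0) nw' n).
apply: newton_ext nw => k; exact: scale_geometric.
Qed.

Lemma qtwist_linear (V : A -> A) : linear (qtwist q V).
Proof.
move=> c f g; rewrite /qtwist /pleth_XY rmorphD /= plethysmZ /= raddfD /=.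
congr (_ + _); rewrite -scalerAl mul1r mmap_idfun_scale.
by rewrite -scalerAl mul1r.
Qed.

Lemma qtwist_alt m (V : A -> A) : linear V ->
  (forall b : 'X_{1..m}, alt 0 t 0 (fun a => V (\prod_i gs 0 (a i))) b =
     alt 0 t (-1) (fun a => \prod_i gs 0 (a i)) (b + ones m)%MM) ->
  forall b : 'X_{1..m}, alt q t 0 (fun a => qtwist q V (\prod_i gs q (a i))) b =
     alt q t (-1) (fun a => \prod_i gs q (a i)) (b + ones m)%MM.
Proof.
move=> linV VG b; pose Vh : B -> A := monalg.mmap idfun (fun nu : psmonom => V << nu >>).
pose Yh n := in_Y (gs 0 n); pose T n : B := pleth_XY q (gs q n).
have Vh_linear : linear (Vh : B -> A^o).
  by move=> c f g; rewrite /Vh raddfD /= mmap_idfun_scale.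
have Vh_prod (a : 'X_{1..m}) : Vh (\prod_i Yh (a i)) = V (\prod_i gs 0 (a i)).
  rewrite -(qtwist_in_Y linV); congr Vh; rewrite /in_Y rmorph_prod; exact: eq_bigr.
rewrite -(@twist_alt K q t m A B (gs q) (gs 0) (fun n => q ^+ n *: gs q n) Yh T
  (fun=> erefl) (gs_newton 0 char0).1 gs_conv pleth_XY_gs V Vh Vh_linear Vh_prod VG).
apply: eq_alt => w _; rewrite /qtwist -/Vh; congr Vh.
by rewrite /T /pleth_XY rmorph_prod.
Qed.

End Twist.

(** * Anisotropy *)

Section Fractions.
Local Open Scope quotient_scope.
Variable R : idomainType.

Lemma fractionP (x : {fraction R}) : exists n d : R, d != 0 /\ x = n%:F / d%:F.
Proof.
elim/quotW: x => r; exists (\n_r), (\d_r); split; first exact: denom_ratioP.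
have d0 : (\d_r)%:F != 0 :> {fraction R} by rewrite tofrac_eq0 denom_ratioP.
apply: (mulIf d0); rewrite mulfVK //.
have tf (y : R) : y%:F = \pi_({fraction R}) (Ratio y 1) by unlock FracField.tofrac.
rewrite !tf -[LHS]FracField.pi_mul; apply/eqmodP => /=.
rewrite FracField.equivfE /FracField.mulf !numden_Ratio ?mulf_neq0 ?oner_neq0 ?denom_ratioP //.
by rewrite !mulr1 mulrC.
Qed.

Lemma common_denom (I : eqType) (r : seq I) (a : I -> {fraction R}) :
  exists (d : R) (n : I -> R), d != 0 /\ forall i, i \in r -> a i * d%:F = (n i)%:F.
Proof.
elim: r => [|i r [d [n [d0 IH]]]]; first by exists 1, (fun=> 0); rewrite oner_neq0.
have [m [e [e0 ai]]] := fractionP (a i).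
exists (d * e), (fun j => if j == i then m * d else n j * e).
rewrite mulf_neq0 //; split=> // j; rewrite inE tofracM => /predU1P[->|jr].
  by rewrite eqxx ai mulrCA mulfVK ?tofrac_eq0 // tofracM mulrC.
case: eqP => [->|_]; last by rewrite mulrA IH // tofracM.
by rewrite ai mulrCA mulfVK ?tofrac_eq0 // tofracM mulrC.
Qed.
End Fractions.

(** Attached to a class of weights, not to one form, so that it can be transported from Q to Q(t)
    and then to Q(t)(q), one variable at a time. *)
Definition anisotropic (R : comNzRingType) (P : R -> Prop) :=
  forall (I : eqType) (r : seq I) (a w : I -> R),
    (forall i, i \in r -> P (w i)) -> \sum_(i <- r) a i ^+ 2 * w i = 0 ->
    forall i, i \in r -> a i = 0.

Lemma anisotropic_rat : anisotropic (fun w : rat => 0 < w).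
Proof.
move=> I r a w w0 e i ir; have /eqP := e; rewrite big_seq psumr_eq0 => [|j jr].
  move=> /allP/(_ i ir); rewrite ir /= mulf_eq0 (gt_eqF (w0 i ir)) orbF.
  by rewrite sqrf_eq0 => /eqP.
by rewrite mulr_ge0 ?sqr_ge0 // ltW // w0.
Qed.

Section AnisotropicPoly.
Variables (K : fieldType) (P : K -> Prop).
Hypothesis aniso : anisotropic P.

(* Descent on the degree: evaluating at 0 shows that 'X divides every [a i]. *)
Lemma anisotropic_poly : anisotropic (fun w : {poly K} => P w.[0]).
Proof.
move=> I r a w Pw; have [n] := ubnP (\max_(i <- r) size (a i)).
elim: n a => // n IH a lt e.
have a0 i : i \in r -> (a i).[0] = 0.
  apply: (@aniso I r (fun i => (a i).[0]) (fun i => (w i).[0]) Pw).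
  rewrite -[RHS](horner0 (0 : K)) -e horner_sum.
  by apply: eq_bigr => j _; rewrite hornerM horner_exp.
pose b i := a i %/ 'X.
have aE i : i \in r -> a i = b i * 'X.
  move=> ir; rewrite /b divpK // -['X]subr0 -polyC0 -root_factor_theorem.
  by apply/rootP; apply: a0.
have [r0|[k kr k0]] : (forall i, i \in r -> a i = 0) \/ exists2 k, k \in r & a k != 0.
  elim: (r) => [|k s [IHs|[l ls l0]]]; first by left.
    case: (eqVneq (a k) 0) => [k0|k0]; last by right; exists k; rewrite ?inE ?eqxx.
    by left=> i; rewrite inE => /predU1P[->|/IHs].
  by right; exists l; rewrite // inE ls orbT.
  by [].
have bE : forall i, i \in r -> b i = 0.
  apply: IH.
    have n0 : (0 < \max_(i <- r) size (a i))%N.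
      by apply: leq_trans (leq_bigmax_seq _ kr isT); rewrite size_poly_gt0.
    rewrite ltnS in lt; apply: leq_trans lt; rewrite -(prednK n0) ltnS.
    apply/bigmax_leqP_seq => i ir _; rewrite size_divp ?polyX_eq0 // size_polyX subn1.
    by rewrite -!subn1 leq_sub2r // (leq_bigmax_seq i ir isT).
  suff /eqP : 'X ^+ 2 * \sum_(i <- r) b i ^+ 2 * w i = 0.
    by rewrite mulf_eq0 expf_eq0 polyX_eq0 => /eqP.
  transitivity (\sum_(i <- r) a i ^+ 2 * w i); last exact: e.
  rewrite mulr_sumr big_seq [RHS]big_seq.
  by apply: eq_bigr => i ir; rewrite (aE i ir) exprMn; ring.
by move=> i ir; rewrite aE // bE // mul0r.
Qed.

(** The square of a common denominator of the [a i] factors out of the sum, and the weights are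
    already polynomials. *)
Lemma anisotropic_fraction :
  anisotropic (fun w : {fraction {poly K}} => exists2 p : {poly K}, w = p%:F & P p.[0]).
Proof.
move=> I r a w Pw e; have [d [n [d0 dP]]] := common_denom r a.
have [v vP] : exists v : I -> {poly K}, forall i, i \in r -> w i = (v i)%:F /\ P (v i).[0].
  elim: r Pw {e dP} => [|i r IH] Pw; first by exists (fun=> 0).
  have [p wp pP] := Pw i (mem_head _ _).
  have [|v vP] := IH; first by move=> j jr; apply: Pw; rewrite inE jr orbT.
  exists (fun j => if j == i then p else v j) => j.
  by rewrite inE => /predU1P[->|/vP vj]; [rewrite eqxx | case: eqP => [->|]].
have n0 : forall i, i \in r -> n i = 0.
  apply: (anisotropic_poly (w := v)) => [i /vP[]//|].
  apply/eqP; rewrite -tofrac_eq0 rmorph_sum /=; apply/eqP.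
  transitivity (d%:F ^+ 2 * \sum_(i <- r) a i ^+ 2 * w i); last by rewrite e mulr0.
  rewrite mulr_sumr big_seq [RHS]big_seq.
  apply: eq_bigr => i ir; have [wi _] := vP i ir.
  by rewrite tofracM tofracXn -dP // -wi exprMn; ring.
move=> i ir; have := dP i ir; rewrite n0 // tofrac0 => /eqP.
by rewrite mulf_eq0 tofrac_eq0 (negbTE d0) orbF => /eqP.
Qed.
End AnisotropicPoly.

Definition value0 (K : fieldType) (P : K -> Prop) (w : {fraction {poly K}}) : Prop :=
  exists2 p : {poly K}, w = p%:F & P p.[0].

Lemma subXn_frac (K : fieldType) (c : K) n :
  1 - (c%:P)%:F ^+ n = ((1 - c ^+ n)%:P)%:F :> {fraction {poly K}}.
Proof. by rewrite polyCB tofracB polyC_exp tofracXn polyC1 tofrac1. Qed.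

Section ValueAtZero.
Variables (K : fieldType) (P : K -> Prop).
Local Notation Q := (value0 P).

Lemma value0M (PM : forall x y, P x -> P y -> P (x * y)) x y : Q x -> Q y -> Q (x * y).
Proof.
by move=> [p -> Pp] [r -> Pr]; exists (p * r); rewrite ?tofracM // hornerM; apply: PM.
Qed.

Lemma value0C c : P c -> Q (c%:P)%:F.
Proof. by move=> Pc; exists c%:P; rewrite ?hornerC. Qed.

Lemma value0_nat n : P n%:R -> Q n%:R.
Proof.
by move=> Pn; have := value0C Pn; rewrite polyC_natr -(rmorph_nat (@FracField.tofrac _)).
Qed.

Lemma value0_subX n : P 1 -> Q (1 - ('X : {poly K})%:F ^+ n.+1).
Proof.
move=> P1; exists (1 - 'X ^+ n.+1 : {poly K}); first by rewrite tofracB tofrac1 tofracXn.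
by rewrite hornerD hornerN hornerC hornerXn expr0n subr0.
Qed.
End ValueAtZero.

Definition positive (w : Qqt) : Prop := value0 (value0 (fun x : rat => 0 < x)) w.

Lemma positiveM x y : positive x -> positive y -> positive (x * y).
Proof. by do 2![apply: value0M => {x y} x y]; apply: mulr_gt0. Qed.

Lemma positive_nat n : positive n.+1%:R.
Proof. by do 2!apply: value0_nat; rewrite ltr0n. Qed.

Lemma positive1 : positive 1.
Proof. exact: (positive_nat 0). Qed.

Lemma positive_subq n : positive (1 - q_ ^+ n.+1).
Proof. by apply: value0_subX; apply: (@value0_nat _ _ 1); rewrite ltr01. Qed.

Lemma positive_subt n : positive (1 - t_ ^+ n.+1).
Proof.
have -> : 1 - t_ ^+ n.+1 = Qt_inj (1 - ('X : {poly rat})%:F ^+ n.+1).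
  exact: subXn_frac.
by apply: value0C; apply: value0_subX; rewrite ltr01.
Qed.

Lemma anisotropic_positive : anisotropic positive.
Proof. by do 2!apply: anisotropic_fraction; apply: anisotropic_rat. Qed.

Lemma positive_neq0 w : positive w -> w != 0.
Proof.
move=> w0; apply/eqP => e.
have := @anisotropic_positive unit [:: tt] (fun=> 1) (fun=> w) (fun _ _ => w0).
rewrite big_seq1 e mulr0 => /(_ erefl tt (mem_head _ _)) /eqP.
by rewrite oner_eq0.
Qed.

Lemma t_neq0 : t_ != 0.
Proof. by rewrite /t_ /Qt_inj tofrac_eq0 polyC_eq0 tofrac_eq0 polyX_eq0. Qed.

Lemma scal_qt_aniso (q : Qqt) (f : Lam Qqt) :
  (forall n, positive (1 - q ^+ n.+1)) -> scal_qt q t_ f f = 0 -> f = 0.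
Proof.
move=> q1 e; apply/malgP => nu; rewrite monalg.mcoeff0.
case: (boolP (nu \in monalg.msupp f)) => [nuf|]; last exact: monalg.mcoeff_outdom.
apply: (@anisotropic_positive _ (monalg.msupp f) (fun nu => monalg.mcoeff nu f) (weight q t_)) nuf.
  move=> mu _; rewrite /weight; apply: positiveM.
    rewrite -(@prednK (zmonom mu)); first exact: positive_nat.
    rewrite /zmonom big_seq prodn_cond_gt0 // => i _.
    by rewrite muln_gt0 expn_gt0 fact_gt0.
  apply: (big_ind positive positive1 positiveM) => i _.
  elim: (mu i) => [|n IH]; first exact: positive1.
  by rewrite exprS; apply: positiveM IH; apply: positiveM (q1 i) (positive_subt i).
by rewrite -[RHS]e; apply: eq_bigr => mu _; rewrite expr2.
Qed.

Lemma scal_qt_aniso_q f : scal_qt q_ t_ f f = 0 -> f = 0.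
Proof. exact: scal_qt_aniso positive_subq. Qed.

Lemma scal_0t_aniso f : scal_qt 0 t_ f f = 0 -> f = 0.
Proof. by apply: scal_qt_aniso => n; rewrite expr0n subr0; apply: positive1. Qed.

(** * Specialization at q = 0 *)

Lemma ev_ucmM (K : fieldType) (s : K) N k nu : ev s N << (ucm k * nu)%M >> =
  ((1 - s ^+ k.+1) *: \sum_i 'X_i ^+ k.+1) * ev s N << nu >>.
Proof.
apply: etrans (congr1 (ev s N) (esym (mul_psumU K k nu))) _.
apply: etrans (evM _ _ _ _) _.
exact: (congr1 ( *%R^~ _) (ev_psum s N k)).
Qed.

Section SpecializeAtZero.
Variable K : fieldType.
Local Notation Fr := {fraction {poly K}}.

(* The relation [value_q0] for an arbitrary field of coefficients. *)
Definition specializes (f g : Fr) : Prop :=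
  exists a b : {poly K},
    [/\ b.[0] != 0, f = a%:F / b%:F & g = ((a.[0] / b.[0])%:P)%:F].

Let den_neq0 (b : {poly K}) : b.[0] != 0 -> b%:F != 0 :> Fr.
Proof. by rewrite tofrac_eq0; apply: contraNneq => ->; rewrite horner0. Qed.

Lemma specializesC (c : K) : specializes (c%:P)%:F (c%:P)%:F.
Proof.
by exists c%:P, 1; rewrite !hornerC oner_neq0 tofrac1 !divr1.
Qed.

Lemma specializesX : specializes ('X : {poly K})%:F 0.
Proof.
by exists 'X, 1; rewrite hornerX !hornerC oner_neq0 tofrac1 mul0r tofrac0 divr1.
Qed.

Lemma specializesD f g f' g' : specializes f g -> specializes f' g' ->
  specializes (f + f') (g + g').
Proof.
move=> [a [b [b0 -> ->]]] [a' [b' [b0' -> ->]]].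
exists (a * b' + a' * b), (b * b'); split; first by rewrite hornerM mulf_neq0.
  by rewrite addf_div ?den_neq0 // tofracD !tofracM.
by rewrite -tofracD -polyCD hornerD !hornerM addf_div.
Qed.

Lemma specializesM f g f' g' : specializes f g -> specializes f' g' ->
  specializes (f * f') (g * g').
Proof.
move=> [a [b [b0 -> ->]]] [a' [b' [b0' -> ->]]].
exists (a * a'), (b * b'); split; first by rewrite hornerM mulf_neq0.
  by rewrite mulf_div !tofracM.
by rewrite -tofracM -polyCM !hornerM mulf_div.
Qed.

Lemma specializes_eq0 g : specializes 0 g -> g = 0.
Proof.
move=> [a [b [b0 /esym/eqP]]]; rewrite mulf_eq0 invr_eq0 (negbTE (den_neq0 b0)) orbF.
by rewrite tofrac_eq0 => /eqP -> ->; rewrite horner0 mul0r.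
Qed.

Lemma specializes0 : specializes 0 0.
Proof. by have := specializesC 0; rewrite tofrac0. Qed.

Lemma specializes1 : specializes 1 1.
Proof. by have := specializesC 1; rewrite tofrac1. Qed.

Lemma specializesN f g : specializes f g -> specializes (- f) (- g).
Proof.
move=> fg; have := specializesM (specializesC (-1)) fg.
by rewrite polyCN tofracN tofrac1 !mulN1r.
Qed.

Lemma specializes_inj f g g' : specializes f g -> specializes f g' -> g = g'.
Proof.
move=> fg /specializesN/(specializesD fg); rewrite subrr => /specializes_eq0/eqP.
by rewrite subr_eq0 => /eqP.
Qed.

Lemma specializesXn f g n : specializes f g -> specializes (f ^+ n) (g ^+ n).
Proof.
move=> fg; elim: n => [|n IH]; first exact: specializes1.
by rewrite !exprS; apply: specializesM.
Qed.

Lemma specializes_nat n : specializes n%:R n%:R.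
Proof.
elim: n => [|n IH]; first exact: specializes0.
by rewrite -addn1 !natrD; apply: specializesD IH specializes1.
Qed.

Lemma specializes_sum (I : Type) (r : seq I) (P : pred I) (a b : I -> Fr) :
  (forall i, P i -> specializes (a i) (b i)) ->
  specializes (\sum_(i <- r | P i) a i) (\sum_(i <- r | P i) b i).
Proof. by move=> ab; apply: (big_ind2 specializes specializes0 _ ab) => *; apply: specializesD. Qed.

Lemma specializes_prod (I : Type) (r : seq I) (P : pred I) (a b : I -> Fr) :
  (forall i, P i -> specializes (a i) (b i)) ->
  specializes (\prod_(i <- r | P i) a i) (\prod_(i <- r | P i) b i).
Proof. by move=> ab; apply: (big_ind2 specializes specializes1 _ ab) => *; apply: specializesM. Qed.

Lemma specializes_weight (q q' t t' : Fr) nu :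
  specializes q q' -> specializes t t' -> specializes (weight q t nu) (weight q' t' nu).
Proof.
move=> sq st; apply: specializesM (specializes_nat _) _.
apply: specializes_prod => i _; apply: specializesXn.
by apply: specializesM; apply: specializesD specializes1 (specializesN (specializesXn _ _)).
Qed.

Definition sym_specializes (f g : Lam Fr) : Prop :=
  forall nu : psmonom, specializes (monalg.mcoeff nu f) (monalg.mcoeff nu g).

Lemma specializes_scal_qt (q q' t t' : Fr) f f' g g' :
  specializes q q' -> specializes t t' -> sym_specializes f f' -> sym_specializes g g' ->
  specializes (scal_qt q t f g) (scal_qt q' t' f' g').
Proof.
move=> sq st ff gg; pose D := (monalg.msupp f `|` monalg.msupp f')%fset.
rewrite !scal_qtE (@diag_formEw _ _ D) ?fsubsetUl //.
rewrite (@diag_formEw _ _ D) ?fsubsetUr //.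
apply: specializes_sum => nu _; apply: specializesM (specializes_weight _ sq st).
exact: specializesM.
Qed.

Definition mp_specializes N (f g : {mpoly Fr[N]}) : Prop :=
  forall a, specializes f@_a g@_a.

Lemma mp_specializes0 N : @mp_specializes N 0 0.
Proof. by move=> a; rewrite mcoeff0; apply: specializes0. Qed.

Lemma mp_specializesD N (f g f' g' : {mpoly Fr[N]}) :
  mp_specializes f g -> mp_specializes f' g' -> mp_specializes (f + f') (g + g').
Proof. by move=> fg fg' a; rewrite !mcoeffD; apply: specializesD. Qed.

Lemma mp_specializesM N (f g f' g' : {mpoly Fr[N]}) :
  mp_specializes f g -> mp_specializes f' g' -> mp_specializes (f * f') (g * g').
Proof.
move=> fg fg' a; rewrite !mcoeffM; apply: specializes_sum => i _.
exact: specializesM.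
Qed.

Lemma mp_specializesZ N c d (f g : {mpoly Fr[N]}) :
  specializes c d -> mp_specializes f g -> mp_specializes (c *: f) (d *: g).
Proof. by move=> cd fg a; rewrite !mcoeffZ; apply: specializesM. Qed.

Lemma mp_specializes1 N : @mp_specializes N 1 1.
Proof. by move=> a; rewrite mcoeff1; apply: specializes_nat. Qed.

Lemma mp_specializesX N i : @mp_specializes N 'X_i 'X_i.
Proof. by move=> a; rewrite mcoeffX; apply: specializes_nat. Qed.

Lemma specializes_ev (t t' : Fr) N f g : specializes t t' -> sym_specializes f g ->
  mp_specializes (ev t N f) (ev t' N g).
Proof.
(* The supports may differ, since a nonzero coefficient can specialize to 0. *)
move=> tt fg; pose D := (monalg.msupp f `|` monalg.msupp g)%fset.
have evE (s : Fr) h : (monalg.msupp h `<=` D)%fset ->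
    ev s N h = \sum_(nu <- D) monalg.mcoeff nu h *: ev s N << nu >>.
  move=> le.
  rewrite {1}[h]malg_decomp (big_morph (ev s N) (@evD Fr s N) (@ev0 Fr s N)) (big_fset_incl _ le); last first.
    by move=> nu _ /monalg.mcoeff_outdom ->; rewrite scale0r ev0.
  by apply: eq_bigr => nu _; rewrite evZ.
rewrite !evE ?fsubsetUl ?fsubsetUr //.
apply: (big_ind2 (@mp_specializes N)) => [|????|nu _].
- exact: mp_specializes0.
- exact: mp_specializesD.
apply: mp_specializesZ (fg nu) _.
elim/psmonom_ind: nu => [|k nu IH]; first by rewrite !ev1; apply: mp_specializes1.
rewrite (ev_ucmM t N k nu) (ev_ucmM t' N k nu).
apply: mp_specializesM IH.
apply: mp_specializesZ; first exact: specializesD specializes1 (specializesN (specializesXn _ _)).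
apply: (big_ind2 (@mp_specializes N)) => [|????|i _].
- exact: mp_specializes0.
- exact: mp_specializesD.
elim: k.+1 => [|j IHj]; first exact: mp_specializes1.
by rewrite exprS; apply: mp_specializesM IHj; apply: mp_specializesX.
Qed.

End SpecializeAtZero.

(** * Partitions and the theorem *)

(** Greedy exchange: remove from u the head of l if it occurs there, and otherwise any element,
    which is no larger; what is left of u is contained in the tail of l. *)
Lemma sumn_take_sorted (l u : seq nat) k : sorted geq l ->
  (forall x, count_mem x u <= count_mem x l)%N -> (size u <= k)%N ->
  (sumn u <= sumn (take k l))%N.
Proof.
elim: l u k => [|x l IH] [|y0 u0] // [|k] // so sub le.
  by have := sub y0; rewrite /= eqxx.
set u := y0 :: u0 in sub le *; pose y := if x \in u then x else y0.
have yu : y \in u by rewrite /y; case: ifP => // _; rewrite inE eqxx.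
have yx : (y <= x)%N.
  have : y \in x :: l by rewrite -has_pred1 has_count (leq_trans _ (sub y)) // -has_count has_pred1.
  have tr : transitive geq by move=> a b c /= ba ac; apply: leq_trans ac ba.
  by rewrite inE => /predU1P[->//|]; apply: (allP (order_path_min tr so)).
have yE : x \in u -> y = x by rewrite /y => ->.
clearbody y u; rewrite (perm_sumn (perm_to_rem yu)) /= leq_add // IH //.
- exact: path_sorted so.
- move=> z; have /= := sub z; have := seq.permP (perm_to_rem yu) (pred1 z) => /= ->.
  case xu : (x \in u); first by rewrite {1}(yE xu) leq_add2l.
  case: (x =P z) => [<-|_] le_l; last exact: leq_trans (leq_addl _ _) le_l.
  have := seq.permP (perm_to_rem yu) (pred1 x); rewrite (count_memPn _) ?xu //= => /esym/eqP.
  by rewrite addn_eq0 => /andP[_ /eqP ->].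
by rewrite size_rem // -subn1 leq_subLR add1n.
Qed.

Lemma sumn_filter_pos (s : seq nat) : sumn [seq x <- s | (0 < x)%N] = sumn s.
Proof. by elim: s => //= -[|x] s IH /=; rewrite IH. Qed.

Lemma mcoeff_msympoly_neq0 (K : fieldType) N la (a : 'X_{1..N}) :
  (msympoly K N la)@_a != 0 -> perm_eq [seq x <- a | (0 < x)%N] la.
Proof.
apply: contraR => ne; rewrite /msympoly raddf_sum /= big1 // => m pm.
by rewrite mcoeffX; case: eqP => // e; move: ne; rewrite -e pm.
Qed.

(** A monomial exponent a is a rearrangement, with zeros, of some la <= mu; its first k entries sum
    to at most the k largest parts of la. *)
Lemma macdonald_dominance (K : fieldType) (q t : K) H : is_macdonald q t H ->
  forall mu N (a : 'X_{1..N}), is_part mu -> (ev t N (H mu))@_a != 0 ->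
  mdeg a = sumn mu /\ forall k, (sumn (take k a) <= sumn (take k mu))%N.
Proof.
move=> [_ tri _] mu N a pm; have [s [c [dom /(_ N) e]]] := tri mu pm.
rewrite ev.unlock e raddf_sum /= => nz.
have [la las nzla] : exists2 la, la \in s & (msympoly K N la)@_a != 0.
  apply/hasP; apply: contraNT nz => /hasPn z; rewrite big_seq big1 // => la las.
  by rewrite mcoeffZ; have := z la las; rewrite negbK => /eqP ->; rewrite mulr0.
have [/andP[so _] [de le]] := dom la las; have pl := mcoeff_msympoly_neq0 nzla.
split=> [|k]; first by rewrite -de -(perm_sumn pl) sumn_filter_pos /mdeg sumnE.
apply: leq_trans (le k); rewrite -sumn_filter_pos; apply: sumn_take_sorted so _ _.
  move=> x; rewrite -(seq.permP pl) -{2}(cat_take_drop k a) filter_cat count_cat.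
  exact: leq_addr.
apply: leq_trans (size_subseq (filter_subseq _ _)) _.
by rewrite size_take_min geq_minl.
Qed.

Lemma is_part_cons m la : is_part (m :: la) ->
  [/\ (0 < m)%N, is_part la & all (geq m) la].
Proof.
case/andP=> so; rewrite inE negb_or eq_sym -lt0n => /andP[m0 n0]; split=> //.
  by rewrite /is_part (path_sorted so).
by apply: order_path_min so => a b c /= ba ac; apply: leq_trans ac ba.
Qed.

Lemma size_conj_part la : size (conj_part la) = head 0%N la.
Proof. exact: size_mkseq. Qed.

Lemma conj_part_cons m la : is_part (m :: la) ->
  conj_part (m :: la) = add_col m (conj_part la).
Proof.
case/is_part_cons=> _ pla le; apply: (@eq_from_nth _ 0%N); rewrite !size_mkseq //= => i im.
rewrite [LHS]nth_mkseq // [RHS]nth_mkseq //= im add1n; congr S.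
case: (ltnP i (head 0%N la)) => lt; first by rewrite nth_mkseq.
rewrite nth_default ?size_conj_part //; apply/eqP; rewrite -leqn0 leqNgt -has_count.
apply/hasPn => x; case: la pla le lt => //= y la /is_part_cons[_ _ ley] _ lt.
rewrite inE -leqNgt => /predU1P[->//|/(allP ley) /= xy]; exact: leq_trans xy lt.
Qed.

Lemma is_part_conj la : is_part la -> is_part (conj_part la).
Proof.
elim: la => // m la IH pm; rewrite conj_part_cons //.
by apply: is_part_add_col; apply: IH; have [] := is_part_cons pm.
Qed.

(* Properties (1)-(3) of [is_macdonald], with (2) in the weaker form used here. *)
Definition macdonald_like (K : fieldType) (q t : K) (H : seq nat -> Lam K) : Prop :=
  [/\ forall la mu, is_part la -> is_part mu -> la <> mu -> scal_qt q t (H la) (H mu) = 0,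
      forall mu N (a : 'X_{1..N}), is_part mu -> (ev t N (H mu))@_a != 0 ->
        mdeg a = sumn mu /\ forall k, (sumn (take k a) <= sumn (take k mu))%N
    & forall mu, is_part mu -> hall (H mu) (hsym K (sumn mu)) = t ^+ n_part mu].

Lemma is_macdonald_like (K : fieldType) (q t : K) H :
  is_macdonald q t H -> macdonald_like q t H.
Proof. by move=> mH; have [? _ ?] := mH; split=> //; apply: macdonald_dominance mH. Qed.

(** Equations and vanishing of coefficients survive at q = 0. This is where the weak form of (2)
    helps: the coefficients [c] of the monomial expansion would first have to be shown free of
    poles. *)
Lemma macdonald_like_specializes (K : fieldType) (q q' t : {fraction {poly K}}) H H'
    (char0 : forall n, n.+1%:R != 0 :> {fraction {poly K}}) :
  specializes q q' -> specializes t t -> macdonald_like q t H ->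
  (forall mu, is_part mu -> sym_specializes (H mu) (H' mu)) -> macdonald_like q' t H'.
Proof.
move=> sq st [orth tri norm] HH; split.
- move=> la mu pl pm ne; apply: specializes_eq0; rewrite -(orth la mu pl pm ne).
  exact: specializes_scal_qt sq st (HH la pl) (HH mu pm).
- move=> mu N a pm nz; apply: (tri mu N a pm); apply: contraNneq nz => z.
  by apply/eqP/specializes_eq0; rewrite -z; apply: specializes_ev st (HH mu pm) a.
move=> mu pm; apply: (@specializes_inj _ (t ^+ n_part mu)); last exact: specializesXn.
rewrite -(norm mu pm) !hall_hsym //; apply: specializes_ev (specializes0 _) (HH mu pm) _.
Qed.

Section TwistedColumns.
Variables (K : fieldType) (q t : K).
Hypothesis char0 : forall n, n.+1%:R != 0 :> K.
Hypothesis q_neq1 : forall n, 1 - q ^+ n.+1 != 0.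
Hypothesis t_neq1 : forall n, 1 - t ^+ n.+1 != 0.
Hypothesis t_neq0 : t != 0.
Hypothesis aniso_q : forall f : Lam K, scal_qt q t f f = 0 -> f = 0.
Hypothesis aniso_0 : forall f : Lam K, scal_qt 0 t f f = 0 -> f = 0.
Variables H HL : seq nat -> Lam K.
Hypothesis H_mac : macdonald_like q t H.
Hypothesis HL_mac : macdonald_like 0 t HL.

Lemma qtwist_column m (V : Lam K -> Lam K) : (0 < m)%N -> linear V ->
  (forall mu, is_part mu -> (size mu <= m)%N -> V (HL mu) = HL (add_col m mu)) ->
  forall mu, is_part mu -> (size mu <= m)%N -> qtwist q V (H mu) = H (add_col m mu).
Proof.
move=> m0 linV VHL; have [o0 tri0 n0] := HL_mac; have [oq triq nq] := H_mac.
have nz0 n : 1 - 0 ^+ n.+1 != 0 :> K by rewrite expr0n subr0 oner_eq0.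
apply/(macdonald_columnP char0 q_neq1 t_neq1 t_neq0 aniso_q oq triq nq m0 (qtwist_linear q V)).
apply: (qtwist_alt char0 q_neq1 linV).
exact/(macdonald_columnP char0 nz0 t_neq1 t_neq0 aniso_0 o0 tri0 n0 m0 linV).
Qed.

Lemma qtwist_columns (V : nat -> Lam K -> Lam K) : (forall m, linear (V m)) ->
  (forall m, (1 <= m)%N -> forall mu, is_part mu -> (size mu <= m)%N ->
    V m (HL mu) = HL (add_col m mu)) ->
  forall la, is_part la -> foldr (fun m P => qtwist q (V m) P) 1 la = H (conj_part la).
Proof.
move=> linV VHL; elim=> [_|m la IH pm] /=.
  by have [_ triq nq] := H_mac; rewrite (macdonald_nil char0 q_neq1 t_neq1 triq nq).
have [m0 pla le] := is_part_cons pm; rewrite IH // conj_part_cons //.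
apply: (qtwist_column m0 (linV m) (VHL m m0)); first exact: is_part_conj.
by rewrite size_conj_part; case: (la) le => //= x l /andP[].
Qed.

End TwistedColumns.

Theorem theorem5
    (H : seq nat -> Lam Qqt)
    (H_macdonald : is_macdonald q_ t_ H)
    (HL : seq nat -> Lam Qqt)
    (HL_def : forall mu : seq nat, is_part mu -> sym_value_q0 (H mu) (HL mu))
    (V : nat -> {linear Lam Qqt -> Lam Qqt})
    (V_def : forall m : nat, (1 <= m)%N ->
       forall mu : seq nat, is_part mu -> (size mu <= m)%N ->
         V m (HL mu) = HL (add_col m mu))
    (la : seq nat) (la_part : is_part la) :
  foldr (fun (m : nat) (P : Lam Qqt) => qtwist q_ (V m) P) 1 la
    = H (conj_part la).
Proof.
have char0 n : n.+1%:R != 0 :> Qqt by apply: positive_neq0; apply: positive_nat.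
have q1 n : 1 - q_ ^+ n.+1 != 0 by apply: positive_neq0; apply: positive_subq.
have t1 n : 1 - t_ ^+ n.+1 != 0 by apply: positive_neq0; apply: positive_subt.
have H_mac := is_macdonald_like H_macdonald.
have HL_mac : macdonald_like 0 t_ HL.
  (* [sym_value_q0] unfolds to [sym_specializes] over [Qt]; [q_] is the variable, which specializes
     to 0, and [t_] is a constant. *)
  apply: (macdonald_like_specializes char0 _ _ H_mac HL_def).
    exact: specializesX.
  exact: specializesC.
apply: (qtwist_columns char0 q1 t1 t_neq0 scal_qt_aniso_q scal_0t_aniso H_mac HL_mac
  (V := fun m => V m)) => // m.
exact: linearP.
Qed.
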